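(* Let $k\ge2$, let $\mathbb{S}$ be a marked surface, and let $\mathcal{M}$ be either $\mathcal{A}_{{\rm SL}_k,\mathbb{S}}$ or $\mathcal{A}'_{{\rm SL}_k,\mathbb{S}}$. Let $\mathcal{C}$ and $\mathcal{C}'$ be mutation-adjacent $P$-clusters in the good part $\mathbb{E}_{\rm good}$ of the exchange graph of $\mathscr{A}(\mathcal{M})$. Then the decorated ordered set partitions $(\Pi_p(\mathcal{C}),\varepsilon_p(\mathcal{C}))$ and $(\Pi_p(\mathcal{C}'),\varepsilon_p(\mathcal{C}'))$ disagree at at most one puncture $p\in\mathbb{M}_\circ$.
   Context: **Marked surfaces.** $\mathbb{S}=(\mathbf{S},\mathbb{M})$ is an oriented marked surface (Fomin–Shapiro–Thurston); $\mathbb{M}_\circ$ is the set of interior marked points (punctures). Excluded throughout: spheres with at most $2$ punctures, the unpunctured monogon and digon, the once-punctured monogon. A boundary interval is a piece of $\partial\mathbf S$ connecting adjacent boundary points. A triangulation is a maximal set of noncrossing arcs. It is regular if it has no loop enclosing a single puncture, and taut if it is regular and each triangle has at most one side which is a boundary interval. Taut triangulations exist unless $\mathbb S$ is an unpunctured polygon (in which case there are no punctures). **Cluster algebras, combinatorially.** $\mathcal{A}_{{\rm SL}_k,\mathbb{S}}$ is the Fock–Goncharov moduli space of (twisted, for $k$ even) ${\rm SL}_k$-local systems with an affine flag at each marked point, invariant under the monodromy at punctures; in $\mathcal{A}'_{{\rm SL}_k,\mathbb{S}}$ the boundary points carry vectors instead of affine flags. $\mathscr{A}(\mathcal{M})$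 is the cluster algebra with the following initial quiver; the $P$-cluster data below depend only on this quiver and the stated weights. Let $Q_k$ be the quiver with vertices $(a,b,c)\in\mathbb{N}^3$, $a+b+c=k$, excluding $(k,0,0),(0,k,0),(0,0,k)$, and, for every $(i,j,l)\in\mathbb{N}^3$ with $i+j+l=k-2$, arrows $(i{+}1,j{+}1,l)\to(i{+}1,j,l{+}1)\to(i,j{+}1,l{+}1)\to(i{+}1,j{+}1,l)$. For a triangle $\delta$ place a copy of $Q_k$ in $\delta$, with $(k,0,0),(0,k,0),(0,0,k)$ at its corners in clockwise order. For $\mathcal{M}=\mathcal{A}_{{\rm SL}_k,\mathbb{S}}$ and a regular triangulation $\Delta$, $Q_k(\Delta)$ is obtained by gluing these along the $k-1$ vertices of each common side and cancelling oriented $2$-cycles; vertices on boundary intervals are frozen. For $\mathcal{M}=\mathcal{A}'_{{\rm SL}_k,\mathbb{S}}$ and a taut triangulation $\Delta$, $Q'_k(\Delta)$ is obtained in the same way except that a triangle with a boundary-interval side (drawn as its bottom side) receives instead the quiver $Q_k^1$ with vertices $L_1,\dots,L_{k-1}$ (on the left side), $R_1,\dots,R_{k-1}$ (on the right side; index $k-1$ nearest the top corner), a frozen vertex $M$ on the bottom side, and arrows $R_a\to L_a$ $(1\le a\le k-1)$, $L_a\to R_{a-1}\to R_a$ $(2\le a\le k-1)$, $L_1\to M\to R_1$. Different triangulations give mutation-equivalent seeds. **Weights and $P$-seeds.** $P=\mathbb{Z}^k/{\rm span}(1,\dots,1)$, $e_i$ = image of the $i$th standard basis vector, $\omega_a=e_1+\cdots+e_a$.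 A $P$-seed is a quiver $Q$ without frozen vertices with weights ${\rm wt}(v)\in P^{\oplus\mathbb{M}_\circ}$ satisfying $\sum_{u\to v}{\rm wt}(u)=\sum_{v\to u}{\rm wt}(u)$ at every $v$; its $P$-cluster is the multiset of weights; mutation at $v$ mutates the quiver and replaces ${\rm wt}(v)$ by $-{\rm wt}(v)+\sum_{u\to v}{\rm wt}(u)$. The initial $P$-seed is obtained from the initial quiver by deleting frozen vertices; the vertex $(a,b,c)$ of a triangle with corners $q_1,q_2,q_3$ has as weight the sum of $\omega_a$ in the copy of $P$ at $q_1$, $\omega_b$ at $q_2$, $\omega_c$ at $q_3$, where corners that are boundary points contribute $0$; in a copy of $Q^1_k$ the vertices $L_a,R_a$ have weight $\omega_a$ at the top corner (or $0$ if this is a boundary point). Performing mutations, every seed of $\mathscr{A}(\mathcal{M})$ has an underlying $P$-seed. $\pi_p:P^{\oplus\mathbb{M}_\circ}\to P$ is the projection to the copy at $p$. **Compatibility.** $\lambda,\mu\in P$ are $W$-sortable if for some permutation $w$ of $[k]$ both $\lambda_{w(1)}\ge\cdots\ge\lambda_{w(k)}$ and $\mu_{w(1)}\ge\cdots\ge\mu_{w(k)}$; they are root-conjugate if $\lambda-\mu=e_a-e_b$ for some $a\ne b$ and $\mu$ is obtained from $\lambda$ by swapping the coordinates $a$ and $b$; they are compatible if $W$-sortable or root-conjugate. A multiset of pairwise compatible vectors is basic if every element that is root-conjugate to another element has multiplicity one. $\mathbb{E}_{\rm good}$ is the maximal connected subgraph of the exchange graph of $\mathscr{A}(\mathcal{M})$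 containing the initial seed and consisting of seeds for which $\pi_p(\mathcal{C})$ is a basic multiset of pairwise compatible vectors for every puncture $p$ ($\mathcal{C}$ the $P$-cluster). Mutation-adjacent $P$-clusters in the good part are the $P$-clusters of two adjacent seeds of $\mathbb{E}_{\rm good}$. **From $P$-clusters to dosps.** An ordered set partition (osp) of $[k]$ is a sequence $B_1|\cdots|B_\ell$ of nonempty disjoint blocks with union $[k]$. For $\lambda\in P$, $\Pi(\lambda)$ is the osp with $a,b$ in the same block iff $\lambda_a=\lambda_b$ and $a$ in an earlier block than $b$ iff $\lambda_a>\lambda_b$. $\Pi$ refines $\Pi'$ if each block of $\Pi'$ is a union of consecutive blocks of $\Pi$; $\bigvee$ is the least upper bound in the order in which finer osps are larger. For a basic multiset $\mathcal{C}$ of pairwise compatible vectors, being root-conjugate generates an equivalence relation on $\mathcal{C}$ (vectors not root-conjugate to any other, each copy separately, form singleton classes), and $\Pi(\mathcal{C}):=\bigvee_{\mathcal{O}}\Pi(\sum_{\lambda\in\mathcal{O}}\lambda)$ over the classes $\mathcal{O}$. The ground set of a class $\mathcal{O}$ is $\{a:\exists\lambda,\mu\in\mathcal{O},b\in[k],\ \lambda-\mu=e_a-e_b\}$. For a class of size at least three with ground set $B$, there are a unique $\nu\in P$ with constant $B$-coordinates and unique sign $\varepsilon$ with $\mathcal{O}=\{\nu+\varepsilon e_a:a\in B\}$. A decorated osp (dosp) is an osp with a sign for each block of size at least three. For a $P$-cluster in $\mathbb{E}_{\rm good}$, $\Pi_p(\mathcal{C}):=\Pi(\pi_p(\mathcal{C}))$;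 each block $B$ with $|B|\ge3$ is the ground set of a class of $\pi_p(\mathcal{C})$ and $\varepsilon_p(\mathcal{C})(B)$ is the sign of that class.
   Formalization: The case k = 2 with the sphere with three punctures is excluded: there the initial quiver has three isolated vertices, and every mutation changes the ordered set partition at two punctures, so the claim is false. *)

(* Defs.v *)
From HB Require Import structures.
From mathcomp Require Import all_boot all_order all_fingroup.
From mathcomp Require Import ssralg ssrnum ssrint zmodp matrix generic_quotient ring_quotient.
Set Implicit Arguments.
Unset Strict Implicit.
Unset Printing Implicit Defensive.
Import Order.TTheory GRing.Theory Num.Theory.

(* An oriented marked surface with a triangulation is presented as a finite
   set of triangles glued along sides.  The corners of a triangle are numbered
   0, 1, 2 in clockwise order, so that the corner following [i] clockwise is
   [ordS i] and the one preceding it is [ord_pred i]; side [i] is the side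
   opposite to corner [i].  A side fixed by [glue] is a boundary interval; two
   distinct sides exchanged by [glue] are identified to one arc, in the only
   way that is compatible with the orientations. *)
Record triangulation := Triangulation {
  tri : finType;
  glue : tri * 'I_3 -> tri * 'I_3;
  glueK : involutive glue;
  tri_nonempty : 0 < #|tri|;
  tri_connected : forall t t' : tri,
    connect (fun x y => [exists i, (glue (x, i)).1 == y]) t t' }.

Section Surface.
Variable D : triangulation.

Definition corner := (tri D * 'I_3)%type.
Definition side := (tri D * 'I_3)%type.

Definition boundary_side (s : side) : bool := glue s == s.

(* The orientations of two glued sides are opposite: the clockwise end of one
   is the counterclockwise end of the other. *)
Definition corner_glue (c c' : corner) : bool :=
  [exists i, exists i', [&& glue (c.1, i) == (c'.1, i'),
     ~~ boundary_side (c.1, i) &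
     ((c.2 == ordS i) && (c'.2 == ord_pred i')) ||
     ((c.2 == ord_pred i) && (c'.2 == ordS i'))]].

(* A marked point is the set of corners which are glued to it. *)
Definition marked_point_of (c : corner) : {set corner} :=
  [set c' | connect corner_glue c c'].

Definition boundary_corner (c : corner) : bool :=
  boundary_side (c.1, ordS c.2) || boundary_side (c.1, ord_pred c.2).

Definition is_puncture (m : {set corner}) : bool :=
  [exists c, m == marked_point_of c] && [forall c in m, ~~ boundary_corner c].

Definition puncture := {m : {set corner} | is_puncture m}.

(* In a triangulation, the disk cut out by a loop enclosing a single puncture
   is one triangle with two of its sides glued to each other. *)
Definition regular : bool :=
  [forall t : tri D, forall i, forall j, (glue (t, i) == (t, j)) ==> (i == j)].

Definition taut : bool :=
  regular && [forall t : tri D, #|[set i | boundary_side (t, i)]| <= 1].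

(* For a closed surface, the Euler characteristic [V - E + F] is
   [#|puncture| - 3 F / 2 + F] with [F] the number of triangles; it is 2 for a
   sphere. *)
Definition thrice_punctured_sphere : bool :=
  [&& [forall s : side, ~~ boundary_side s],
      (#|{: puncture}|.*2 == #|tri D| + 4) & #|{: puncture}| == 3].

End Surface.

(* [AffineFlags] is the moduli space A, [BoundaryVectors] is A'. *)
Variant moduli := AffineFlags | BoundaryVectors.

Definition admissible (M : moduli) (D : triangulation) : bool :=
  if M is AffineFlags then regular D else taut D.

Section Quiver.
Variables (k : nat) (M : moduli) (D : triangulation).

(* A triangle receives the quiver [Q_k^1] when it has a bottom side [s], and
   [Q_k] otherwise.  The top corner is then [s], and, by the clockwise
   numbering, the left side is [ordS s] and the right side is [ord_pred s]. *)
Definition bottom (t : tri D) : option 'I_3 :=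
  if M is BoundaryVectors then [pick s | boundary_side (t, s)] else None.

(* The triple (a, b, c): coordinate [i] is attached to corner [i]. *)
Definition position := {ffun 'I_3 -> 'I_k.+1}.

Definition is_position (d : position) : bool :=
  (\sum_i (d i : nat) == k) && [forall i, d i < k].

(* [None] stands for the vertex on the bottom side of [Q_k^1], which is frozen.
   The vertex [L_a] (resp. [R_a]) is given by the triple on the left (resp.
   right) side whose coordinate at the top corner is [a]. *)
Definition node := (tri D * option position)%type.

Definition is_node (x : node) : bool :=
  match bottom x.1, x.2 with
  | None, Some d => is_position d
  | None, None => false
  | Some s, Some d =>
      is_position d && ((d (ordS s) == 0 :> nat) || (d (ord_pred s) == 0 :> nat))
  | Some s, None => true
  end.

(* In [(i+1,j+1,l) -> (i+1,j,l+1) -> (i,j+1,l+1) -> (i+1,j+1,l)], each arrow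
   keeps a nonzero coordinate [m], decreases the next one and increases the
   previous one. *)
Definition Qk_arrow (d e : position) : bool :=
  [exists m, [&& 0 < d m, d m == e m :> nat,
     d (ordS m) == (e (ordS m)).+1 :> nat &
     e (ord_pred m) == (d (ord_pred m)).+1 :> nat]].

Definition Qk1_arrow (s : 'I_3) (x y : option position) : bool :=
  let isL (d : position) := d (ordS s) == 0 :> nat in
  let isR (d : position) := d (ord_pred s) == 0 :> nat in
  match x, y with
  | Some d, Some e =>
      [|| [&& isR d, isL e & d s == e s :> nat],
          [&& isL d, isR e & d s == (e s).+1 :> nat] |
          [&& isR d, isR e & (d s).+1 == e s :> nat]]
  | Some d, None => isL d && (d s == 1 :> nat)
  | None, Some e => isR e && (e s == 1 :> nat)
  | None, None => false
  end.

Definition arrow (x y : node) : bool :=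
  (x.1 == y.1) &&
  match bottom x.1, x.2, y.2 with
  | None, Some d, Some e => Qk_arrow d e
  | None, _, _ => false
  | Some s, x2, y2 => Qk1_arrow s x2 y2
  end.

Definition node_glue (x y : node) : bool :=
  [&& is_node x, is_node y &
    match x.2, y.2 with
    | Some d, Some e =>
        [exists i, exists j, [&& glue (x.1, i) == (y.1, j),
           ~~ boundary_side (x.1, i), d i == 0 :> nat, e j == 0 :> nat,
           d (ordS i) == e (ord_pred j) & d (ord_pred i) == e (ordS j)]]
    | _, _ => false
    end].

Definition frozen_node (x : node) : bool :=
  if x.2 is Some d then
    [exists i, boundary_side (x.1, i) && (d i == 0 :> nat)]
  else true.

(* A vertex of the glued quiver is represented by the canonical element of its
   class of identified nodes. *)
Definition vertex := {x : node | is_node x && (root node_glue x == x)}.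

Definition frozen (v : vertex) : bool := frozen_node (val v).

(* A quiver without loops and oriented 2-cycles is encoded by the signed
   number of arrows from [u] to [v], so that adding up these numbers cancels
   the 2-cycles. *)
Definition surface_quiver (u v : vertex) : int :=
  (\sum_(x : node | root node_glue x == val u)
     \sum_(y : node | root node_glue y == val v)
        ((arrow x y)%:Z - (arrow y x)%:Z))%R.

Definition mutable_vertex := {v : vertex | ~~ frozen v}.

End Quiver.

Local Open Scope ring_scope.
Local Open Scope quotient_scope.

Section WeightLattice.
Variable k : nat.

(* The constant vectors, i.e., the span of (1, ..., 1). *)
Definition span_ones : {pred 'rV[int]_k} :=
  fun v => [forall a, forall b, v 0 a == v 0 b].

Fact span_ones_zmod_closed : zmod_closed span_ones.
Proof.
split=> [|u v /forallP hu /forallP hv].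
  by apply/forallP=> a; apply/forallP=> b; rewrite !mxE.
apply/forallP=> a; apply/forallP=> b; rewrite !mxE.
by rewrite (eqP (forallP (hu a) b)) (eqP (forallP (hv a) b)).
Qed.

HB.instance Definition _ :=
  GRing.isZmodClosed.Build 'rV[int]_k span_ones span_ones_zmod_closed.

(* P = Z^k / span (1, ..., 1) *)
Definition weightP := Quotient.quot span_ones.
HB.instance Definition _ := GRing.Zmodule.on weightP.
HB.instance Definition _ := EqQuotient.on weightP.

Definition P_of (v : 'rV[int]_k) : weightP := \pi_weightP v.

Definition e_ (a : 'I_k) : weightP := P_of (delta_mx 0 a).

Definition omega (a : nat) : weightP := \sum_(i < k | (i < a)%N) e_ i.

(* Coordinates of an element of [weightP] are defined up to a common additive
   constant; they are only used through comparisons between them. *)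
Definition coord (l : weightP) (a : 'I_k) : int := (repr l) 0 a.

Definition swap (a b : 'I_k) (l : weightP) : weightP := P_of (xcol a b (repr l)).

Definition W_sortable (l m : weightP) : bool :=
  [exists w : 'S_k, forall i : 'I_k, forall j : 'I_k, (i <= j)%N ==>
     (coord l (w j) <= coord l (w i)) && (coord m (w j) <= coord m (w i))].

Definition root_conjugate (l m : weightP) : bool :=
  [exists a, exists b, [&& a != b, l - m == e_ a - e_ b & m == swap a b l]].

Definition compatible (l m : weightP) : bool := W_sortable l m || root_conjugate l m.

Definition is_osp (s : seq {set 'I_k}) : bool :=
  uniq s && partition [set B in s] [set: 'I_k].

(* An osp of [k] has at most [k] blocks; the bound makes [osp] a finite type. *)
Record osp := Osp { blocks :> k.-bseq {set 'I_k}; _ : is_osp blocks }.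

HB.instance Definition _ := [isSub for blocks].
HB.instance Definition _ := [Finite of osp by <:].

(* [p] refines [q]: cutting [p] into consecutive pieces (of sizes [sh]) and
   taking the union of each piece yields the blocks of [q], in order. *)
Definition refines (p q : osp) : bool :=
  [exists sh : (size q).-tuple 'I_k.+1,
    let sh' := [seq nat_of_ord i | i <- sh] in
    (sumn sh' == size p) &&
    ([seq \bigcup_(B <- s) B | s <- reshape sh' p] == q :> seq {set 'I_k})].

Definition is_join (F : {set osp}) (p : osp) : bool :=
  [forall q in F, refines p q] &&
  [forall r : osp, [forall q in F, refines r q] ==> refines r p].

Definition osp_join (F : {set osp}) : option osp := [pick p | is_join F p].

Section OspOf.
Variable l : weightP.

Definition level (a : 'I_k) : {set 'I_k} := [set b | coord l b == coord l a].

Definition levels : seq {set 'I_k} :=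
  undup [seq level a | a <- sort (fun a b => coord l b <= coord l a) (enum 'I_k)].

Fact size_levels : (size levels <= k)%N.
Proof.
apply: leq_trans (size_undup _) _.
by rewrite size_map size_sort size_enum_ord.
Qed.

Lemma mem_levels (B : {set 'I_k}) : (B \in levels) = [exists a, B == level a].
Proof.
rewrite mem_undup; apply/mapP/existsP=> [[a _ ->]|[a /eqP ->]]; exists a => //.
by rewrite mem_sort mem_enum.
Qed.

Fact levels_osp : is_osp levels.
Proof.
rewrite /is_osp undup_uniq /=; apply/and3P; split.
- rewrite eqEsubset subsetT /=; apply/subsetP=> a _; apply/bigcupP.
  exists (level a); last by rewrite inE.
  by rewrite inE mem_levels; apply/existsP; exists a.
- apply/trivIsetP=> A B; rewrite !inE !mem_levels.
  move=> /existsP[a /eqP->] /existsP[b /eqP->] hab.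
  rewrite disjoints_subset; apply/subsetP=> c; rewrite !inE => /eqP hc.
  apply: contra hab => /eqP hc'; apply/eqP/setP=> d.
  by rewrite !inE -hc -hc'.
- rewrite inE mem_levels; apply/existsP=> -[a /eqP/setP/(_ a)].
  by rewrite !inE eqxx.
Qed.

Definition osp_of : osp := Osp (blocks := Bseq size_levels) levels_osp.

End OspOf.

(* A finite multiset is given as a family indexed by a finite type, each index
   being one copy of its value. *)
Section Family.
Variables (I : finType) (C : I -> weightP).

Definition pairwise_compatible : bool :=
  [forall i, forall j, compatible (C i) (C j)].

Definition basic : bool :=
  [forall i, [exists j, root_conjugate (C i) (C j)] ==>
     [forall i', (C i' == C i) ==> (i' == i)]].

Definition rc_class (i : I) : {set I} :=
  [set j | connect (fun x y => root_conjugate (C x) (C y)) i j].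

Definition rc_classes : {set {set I}} := [set rc_class i | i : I].

Definition Pi : option osp :=
  osp_join [set osp_of (\sum_(i in O) C i) | O : {set I} in rc_classes].

Definition ground_set (O : {set I}) : {set 'I_k} :=
  [set a | [exists i in O, exists j in O, exists b,
              (a != b) && (C i - C j == e_ a - e_ b)]].

Definition signed (eps : bool) (l : weightP) : weightP := if eps then l else - l.

(* [O = {nu + eps e_a : a \in B}] as a set of vectors. *)
Definition star_at (O : {set I}) (B : {set 'I_k}) (eps : bool) (nu : weightP) : bool :=
  [&& [forall a in B, forall b in B, coord nu a == coord nu b],
      [forall i in O, exists a in B, C i == nu + signed eps (e_ a)] &
      [forall a in B, exists i in O, C i == nu + signed eps (e_ a)]].

(* A vector [nu] as above is necessarily one of the [C i - eps e_a]. *)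
Definition has_sign (O : {set I}) (B : {set 'I_k}) (eps : bool) : bool :=
  [exists i in O, exists a in B, star_at O B eps (C i - signed eps (e_ a))].

Definition block_sign (B : {set 'I_k}) : option bool :=
  [pick eps : bool | [exists O in rc_classes,
     [&& (2 < #|O|)%N, ground_set O == B & has_sign O B eps]]].

(* The signs are recorded only on the blocks of size at least three; [true]
   is the sign [+]. *)
Definition dosp : option (osp * {ffun {set 'I_k} -> option bool}) :=
  omap (fun p : osp =>
    (p, [ffun B => if (B \in (p : seq _)) && (2 < #|B|)%N then block_sign B
                   else None])) Pi.

End Family.

End WeightLattice.

(* The condition that the weights of the arrows entering and leaving a vertex
   have equal sums is not part of the data: it holds for [initial_seed] below
   and is preserved by [mutate]. *)
Record seed (V : finType) (W : zmodType) := Seed {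
  quiver : V -> V -> int;
  weight : V -> W }.

Section Mutation.
Variables (V : finType) (W : zmodType).
Implicit Type S : seed V W.

Definition posp (z : int) : int := Num.max z 0.

Definition mutate (x : V) S : seed V W := {|
  quiver := fun u v =>
    if (u == x) || (v == x) then - quiver S u v
    else quiver S u v
         + posp (quiver S u x) * posp (quiver S x v)
         - posp (quiver S v x) * posp (quiver S x u);
  weight := fun v =>
    if v == x then - weight S x + \sum_u weight S u *~ posp (quiver S u x)
    else weight S v |}.

Definition adjacent S S' : Prop := exists x, S' = mutate x S.

End Mutation.

Section GoodPart.
Variables (k : nat) (M : moduli) (D : triangulation).

Definition P_seed :=
  seed (mutable_vertex k M D) {ffun puncture D -> weightP k}.

Definition node_weight_at (x : node k D) (p : puncture D) : weightP k :=
  if x.2 is Some d then \sum_(i < 3 | (x.1, i) \in val p) omega k (d i) else 0.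

Definition node_weight (x : node k D) : {ffun puncture D -> weightP k} :=
  [ffun p => node_weight_at x p].

Definition initial_seed : P_seed := {|
  quiver := fun u v => surface_quiver (val u) (val v);
  weight := fun v => node_weight (val (val v)) |}.

(* The projection to [p] of the P-cluster of [S]. *)
Definition cluster_at (S : P_seed) (p : puncture D) :
  mutable_vertex k M D -> weightP k := fun v => weight S v p.

Definition good (S : P_seed) : bool :=
  [forall p, pairwise_compatible (cluster_at S p) && basic (cluster_at S p)].

(* The underlying P-seeds of the vertices of E_good: those reached from the
   initial seed by mutations passing only through good seeds. *)
Inductive in_good_part : P_seed -> Prop :=
| good_part_initial : good initial_seed -> in_good_part initial_seed
| good_part_mutate S S' :
    in_good_part S -> adjacent S S' -> good S' -> in_good_part S'.

Definition dosp_at (S : P_seed) (p : puncture D) := dosp (cluster_at S p).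

End GoodPart.

(* Main.v *)
(* Let [x] be the mutated vertex.  If the decorated osp at [p] changes, then
   before or after the mutation [x] belongs to a pair of root-conjugate vectors
   at [p], [x] and [y] say, and the root [e_a - e_b] vanishes at [p] on all
   other vertices.  It suffices to show that the weights of [x] and [y] agree
   at all punctures other than [p]: then a root-conjugate pair containing [x] at
   another puncture can only be [x] and [y] again, taken on the other side of
   the mutation, and both vertices are isolated in the quiver.  Such a pair is
   preserved by mutations and does not exist in the initial seed.

   The locality of root-conjugate pairs comes from the Goncharov-Shen
   potentials.  For consecutive [a, b], the sum of the [t^s] over the arrows of
   a ring around [p] is a Laurent polynomial which stays Laurent in the upper
   bound of every seed met along the good part, is irreducible there, and has
   weight [e_b - e_a] at [p] and 0 at the other punctures.  When the root
   [e_a - e_b] is supported on two vertices [x] and [y], one exchange binomial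
   divides the potential; by irreducibility it is all of it, so that after the
   mutation at [x] the difference of the two weights is the weight of the
   potential.  Reflections in root-conjugate pairs give the potentials of the
   other covering relations. *)

From HB Require Import structures.
From mathcomp Require Import all_boot all_order all_fingroup all_algebra finmap zify.
From mathcomp Require Import generic_quotient ring_quotient.
From mathcomp.multinomials Require Import monalg.
From Stdlib Require Import FunctionalExtensionality Classical.
Require Import Defs.
Set Implicit Arguments.
Unset Strict Implicit.
Unset Printing Implicit Defensive.
Import Order.TTheory GRing.Theory Num.Theory.
Local Open Scope ring_scope.

(** * Gradings of group algebras *)

(** The potentials live in formal upper bounds. An element is thought of as [x^u f(t)]: [x] are the
    cluster variables, [t^(e v)] is the y-hat variable of [v], and [u v + d v n] is the exponent of
    [x_v] in [x^u t^n]. Upper bounds are compatible with mutation when the binomials involved are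
    coprime, but the quiver may have proportional columns. The exchange vectors are therefore
    generic up to one relation, which makes the sum over a ring close up; its coefficients are the
    values of the root on the weights. Coprimality can then fail only for a root supported on two
    vertices, and this is harmless as long as the root is nonnegative before and after the mutation.
    Where twins of the root are dissolved, the potential is rebuilt as a sum of two terms.
    Irreducibility of the initial potential needs a triangle with exactly one corner at the
    puncture. One of any two punctures has such a triangle, and controlling that puncture is enough.
    The initial argument also needs an arrow of the ring none of whose opposite nodes represents a
    given vertex; its failure forces k = 2 and the thrice-punctured sphere. *)

(* The library defines the product on [{malg F[G]}] for a multiplicative monoid
   [G] only; here [G] is an additive group. *)
Definition galg (F : fieldType) (G : zmodType) : Type := {malg F[G]}.

Lemma sum_pred1_seq (V : nmodType) (T : eqType) (s : seq T) (x : T) (E : T -> V) :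
  uniq s -> \sum_(y <- s | y == x) E y = if x \in s then E x else 0.
Proof.
move=> us; rewrite -big_filter; case: ifP => xs.
  by rewrite (eq_filter (a2 := pred1 x)) // filter_pred1_uniq // big_seq1.
by rewrite big_filter big_seq_cond big1 // => y /andP[ys /eqP E1]; rewrite -E1 ys in xs.
Qed.

Section GroupAlgebra.
Variables (F : fieldType) (G : zmodType).
Local Notation R := (galg F G).

HB.instance Definition _ := GRing.Zmodule.on R.

Definition gcoef (n : G) (f : R) : F := mcoeff n (f : {malg F[G]}).
Definition gsupp (f : R) : seq G := msupp (f : {malg F[G]}).
Definition gmono (n : G) (c : F) : R := mkmalgU n c.

Lemma galgP (f g : R) : (forall n, gcoef n f = gcoef n g) -> f = g.
Proof. by move=> h; apply/malgP. Qed.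

Lemma gcoef_is_additive n : {morph gcoef n : f g / f - g}.
Proof. exact: mcoeffB. Qed.

HB.instance Definition _ n := GRing.isZmodMorphism.Build R F (gcoef n) (gcoef_is_additive n).

Lemma gcoef_mono c n m : gcoef m (gmono n c) = c *+ (n == m).
Proof. exact: mcoeffU. Qed.

Lemma gmono_is_additive n : {morph gmono n : c d / c - d}.
Proof. by move=> c d; apply: monalgUB. Qed.

HB.instance Definition _ n := GRing.isZmodMorphism.Build F R (gmono n) (gmono_is_additive n).

Lemma gsuppE f n : (n \in gsupp f) = (gcoef n f != 0).
Proof. by rewrite /gsupp -mcoeff_neq0. Qed.

Lemma galgE f : f = \sum_(n <- gsupp f) gmono n (gcoef n f).
Proof. exact: monalgE. Qed.

Lemma galg_eq0 f : (f == 0) = (gsupp f == [::]).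
Proof.
apply/eqP/eqP=> [->|h]; last by rewrite [f]galgE h big_nil.
case E: (gsupp 0) => [//|n s].
have : n \in gsupp 0 by rewrite E mem_head.
by rewrite gsuppE raddf0 eqxx.
Qed.

Lemma galg_ind (P : R -> Prop) : P 0 -> (forall f g, P f -> P g -> P (f + g)) ->
  (forall c n, P (gmono n c)) -> forall f, P f.
Proof.
move=> P0 PD Pm f; rewrite [f]galgE.
by elim/big_ind: _ => // n _; apply: Pm.
Qed.

(* The operations below are sealed behind opaque existence proofs: unfolding
   them makes the unifier diverge. *)
Fact gmul_sig : {h : R -> R -> R | forall f g, h f g =
  \sum_(n <- gsupp f) \sum_(m <- gsupp g) gmono (n + m) (gcoef n f * gcoef m g)}.
Proof. by exists (fun f g => \sum_(n <- gsupp f) \sum_(m <- gsupp g) gmono (n + m) (gcoef n f * gcoef m g)). Qed.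

Definition gmul := sval gmul_sig.

Lemma gmulE f g : gmul f g =
  \sum_(n <- gsupp f) \sum_(m <- gsupp g) gmono (n + m) (gcoef n f * gcoef m g).
Proof. exact: (svalP gmul_sig). Qed.

Lemma gcoef_gmul f g n :
  gcoef n (gmul f g) = \sum_(a <- gsupp f) gcoef a f * gcoef (n - a) g.
Proof.
rewrite gmulE raddf_sum; apply: eq_bigr => a _; rewrite raddf_sum /=.
under eq_bigr => b _ do rewrite gcoef_mono.
transitivity (\sum_(b <- gsupp g | b == n - a) gcoef a f * gcoef b g).
  rewrite [RHS]big_mkcond; apply: eq_bigr => b _.
  by rewrite -[b == _](inj_eq (addrI a)) addrCA subrr addr0; case: (_ == _).
rewrite sum_pred1_seq ?fset_uniq //.
case: ifP => // /negbT; rewrite gsuppE negbK => /eqP ->.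
by rewrite mulr0.
Qed.

Lemma gcoef_gmul_sub (s : seq G) f g n : uniq s -> {subset gsupp f <= s} ->
  gcoef n (gmul f g) = \sum_(a <- s) gcoef a f * gcoef (n - a) g.
Proof.
move=> us sub; rewrite gcoef_gmul [RHS](bigID (mem (gsupp f))) /= [X in _ + X]big1 ?addr0.
  rewrite -[RHS]big_filter; apply: perm_big; apply: uniq_perm.
  - by rewrite /gsupp fset_uniq.
  - by rewrite filter_uniq.
  by move=> a; rewrite mem_filter; case E: (a \in gsupp f) => //=; rewrite sub.
by move=> a; rewrite gsuppE negbK => /eqP ->; rewrite mul0r.
Qed.

Lemma gmulDl : left_distributive gmul +%R.
Proof.
move=> f g h; apply: galgP => n; rewrite raddfD /=.
pose s := undup (gsupp (f + g) ++ gsupp f ++ gsupp g).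
have us : uniq s by rewrite undup_uniq.
rewrite !(@gcoef_gmul_sub s) //; first last.
- by move=> a; rewrite mem_undup !mem_cat => ->.
- by move=> a; rewrite mem_undup !mem_cat => ->; rewrite orbT.
- by move=> a; rewrite mem_undup !mem_cat => ->; rewrite !orbT.
by rewrite -big_split; apply: eq_bigr => a _; rewrite raddfD mulrDl.
Qed.

Lemma gmulC : commutative gmul.
Proof.
move=> f g; rewrite !gmulE exchange_big; apply: eq_bigr => a _.
by apply: eq_bigr => b _; rewrite mulrC addrC.
Qed.

Lemma gmulDr : right_distributive gmul +%R.
Proof. by move=> f g h; rewrite gmulC gmulDl !(gmulC f). Qed.

Lemma gmul0 : left_zero 0 gmul.
Proof. by move=> f; apply: (addIr (gmul 0 f)); rewrite -gmulDl !add0r. Qed.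

Lemma gmulr0 : right_zero 0 gmul.
Proof. by move=> f; rewrite gmulC gmul0. Qed.

Lemma gmul_mono n m c d : gmul (gmono n c) (gmono m d) = gmono (n + m) (c * d).
Proof.
apply: galgP => a; rewrite (@gcoef_gmul_sub [:: n]) //.
  rewrite big_seq1 !gcoef_mono eqxx mulr1n -mulrnAr.
  by rewrite -[m == _](inj_eq (addrI n)) addrCA subrr addr0.
by move=> b; rewrite gsuppE gcoef_mono inE [_ == b]eq_sym; case: (b == _); rewrite ?eqxx.
Qed.

Lemma gmulA : associative gmul.
Proof.
move=> f g h; elim/galg_ind: f => [|f1 f2 h1 h2|c n]; first by rewrite !gmul0.
  by rewrite !gmulDl h1 h2.
elim/galg_ind: g => [|g1 g2 h1 h2|d m].
- by rewrite !(gmulr0, gmul0).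
- by rewrite !(gmulDl, gmulDr) h1 h2.
elim/galg_ind: h => [|g1 g2 h1 h2|e l]; first by rewrite !(gmulr0, gmul0).
  by rewrite !(gmulDl, gmulDr) h1 h2.
by rewrite !gmul_mono mulrA addrA.
Qed.

Lemma gmul1 : left_id (gmono 0 1) gmul.
Proof.
move=> f; apply: galgP => n; rewrite (@gcoef_gmul_sub [:: 0]) //.
  by rewrite big_seq1 gcoef_mono eqxx mul1r subr0.
by move=> b; rewrite gsuppE gcoef_mono inE [_ == b]eq_sym; case: (b == _); rewrite ?eqxx.
Qed.

Lemma gone_neq0 : gmono 0 1 != 0 :> R.
Proof. by apply/eqP=> /(congr1 (gcoef 0)); rewrite gcoef_mono eqxx raddf0 => /eqP; rewrite oner_eq0. Qed.

HB.instance Definition _ := GRing.Zmodule_isComNzRing.Build R gmulA gmulC gmul1 gmulDl gone_neq0.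

Lemma gmonoM n m c d : gmono n c * gmono m d = gmono (n + m) (c * d).
Proof. exact: gmul_mono. Qed.

Definition gt (n : G) : R := gmono n 1.

Lemma gt0 : gt 0 = 1. Proof. by []. Qed.
Lemma gtD n m : gt (n + m) = gt n * gt m.
Proof. by rewrite gmonoM mulr1. Qed.
Lemma gtK n : gt n * gt (- n) = 1.
Proof. by rewrite -gtD subrr. Qed.

Lemma gmono_eq0 n c : (gmono n c == 0) = (c == 0).
Proof. exact: monalgU_eq0. Qed.

Definition gdvd (f g : R) := exists q, g = f * q.

Lemma gdvd0 f : gdvd f 0. Proof. by exists 0; rewrite mulr0. Qed.
Lemma gdvd1 f : gdvd 1 f. Proof. by exists f; rewrite mul1r. Qed.
Lemma gdvdD f g h : gdvd f g -> gdvd f h -> gdvd f (g + h).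
Proof. by move=> [a ->] [b ->]; exists (a + b); rewrite mulrDr. Qed.
Lemma gdvdN f g : gdvd f g -> gdvd f (- g).
Proof. by move=> [a ->]; exists (- a); rewrite mulrN. Qed.
Lemma gdvdB f g h : gdvd f g -> gdvd f h -> gdvd f (g - h).
Proof. by move=> fg fh; apply: gdvdD => //; apply: gdvdN. Qed.
Lemma gdvd_mull f g h : gdvd f g -> gdvd f (h * g).
Proof. by move=> [a ->]; exists (h * a); rewrite mulrCA. Qed.
Lemma gdvd_mulr f g h : gdvd f g -> gdvd f (g * h).
Proof. by move=> fg; rewrite mulrC; apply: gdvd_mull. Qed.
Lemma gdvd_refl f : gdvd f f. Proof. by exists 1; rewrite mulr1. Qed.
Lemma gdvd_mul f g f' g' : gdvd f g -> gdvd f' g' -> gdvd (f * f') (g * g').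
Proof. by move=> [a ->] [b ->]; exists (a * b); rewrite mulrACA. Qed.
Lemma gdvd_exp f n m g : (n <= m)%N -> gdvd (f ^+ m) g -> gdvd (f ^+ n) g.
Proof. by move=> nm [a ->]; rewrite -(subnKC nm) exprD -mulrA; exists (f ^+ (m - n) * a). Qed.
Lemma gdvd_sum (I : Type) (r : seq I) (P : pred I) (E : I -> R) f :
  (forall i, P i -> gdvd f (E i)) -> gdvd f (\sum_(i <- r | P i) E i).
Proof. by move=> h; elim/big_ind: _ => //; [exact: gdvd0|exact: gdvdD]. Qed.
Lemma gdvd_gt f n g : gdvd f (gt n * g) -> gdvd f g.
Proof.
move=> h; rewrite -[g]mul1r -(gtK (- n)) opprK -mulrA.
exact: gdvd_mull.
Qed.

Fact gres_sig : {h : pred G -> R -> R | forall P f, h P f = \sum_(n <- gsupp f | P n) gmono n (gcoef n f)}.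
Proof. by exists (fun P f => \sum_(n <- gsupp f | P n) gmono n (gcoef n f)). Qed.

Definition gres := sval gres_sig.

Lemma gcoef_gres P f n : gcoef n (gres P f) = if P n then gcoef n f else 0.
Proof.
rewrite [gres P f](svalP gres_sig) raddf_sum /=; under eq_bigr => a _ do rewrite gcoef_mono.
rewrite (eq_bigr (fun a => if a == n then gcoef a f else 0)); last by move=> a _; case: eqP.
rewrite -big_mkcondr /=.
case: ifP => Pn; last by rewrite big1 // => a /andP[Pa /eqP E]; rewrite -E Pa in Pn.
rewrite (eq_bigl (fun a => a == n)) => [|a]; last first.
  by case: eqP => [->|]; rewrite ?andbT ?andbF.
rewrite sum_pred1_seq; last by rewrite /gsupp fset_uniq.
by case: ifP => // /negbT; rewrite gsuppE negbK => /eqP.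
Qed.

Lemma gres_is_additive P : {morph gres P : f g / f - g}.
Proof.
move=> f g; apply: galgP => n; rewrite !(gcoef_gres, raddfB) /=.
by rewrite !gcoef_gres; case: (P n); rewrite ?subr0.
Qed.
HB.instance Definition _ P := GRing.isZmodMorphism.Build R R (gres P) (gres_is_additive P).

Lemma gres_mono P n c : gres P (gmono n c) = if P n then gmono n c else 0.
Proof.
apply: galgP => m; rewrite gcoef_gres (fun_if (gcoef m)) raddf0 gcoef_mono.
by case: eqP => [->//|_]; rewrite !if_same.
Qed.

Lemma eq_gres P Q f : P =1 Q -> gres P f = gres Q f.
Proof. by move=> h; apply: galgP => n; rewrite !gcoef_gres h. Qed.

End GroupAlgebra.

(** * Homogeneous components for an additive degree *)

Definition additive_map (G : zmodType) (d : G -> int) := {morph d : n m / n + m}.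

Section AdditiveMap.
Variables (G : zmodType) (d : G -> int).
Hypothesis ad : additive_map d.

Lemma am0 : d 0 = 0.
Proof. by apply: (addrI (d 0)); rewrite -ad !addr0. Qed.
Lemma amN n : d (- n) = - d n.
Proof. by apply: (addrI (d n)); rewrite -ad !subrr am0. Qed.
Lemma amB n m : d (n - m) = d n - d m.
Proof. by rewrite ad amN. Qed.
Lemma amMn n k : d (n *+ k) = d n *+ k.
Proof. by elim: k => [|k IH]; rewrite ?mulr0n ?am0 // !mulrS ad IH. Qed.
Lemma amMz n k : d (n *~ k) = d n *~ k.
Proof.
case: k => k; first exact: amMn.
by rewrite NegzE !mulrNz amN -!pmulrn amMn.
Qed.
Lemma am_sum (I : Type) (r : seq I) (P : pred I) E :
  d (\sum_(i <- r | P i) E i) = \sum_(i <- r | P i) d (E i).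
Proof. exact: (big_morph d ad am0). Qed.
End AdditiveMap.

Section Homogeneous.
Variables (F : fieldType) (G : zmodType).
Local Notation R := (galg F G).
Implicit Types (d : G -> int) (f g h : R) (k l : int).

Definition hcomp d k f : R := gres (fun n => d n == k) f.
Definition homog d k f := hcomp d k f = f.

Lemma hcomp_is_additive d k : {morph hcomp d k : f g / f - g}.
Proof. exact: raddfB. Qed.
HB.instance Definition _ d k :=
  GRing.isZmodMorphism.Build R R (hcomp d k) (hcomp_is_additive d k).

Lemma hcomp0 d k : hcomp d k 0 = 0. Proof. exact: raddf0. Qed.
Lemma hcompD d k f g : hcomp d k (f + g) = hcomp d k f + hcomp d k g.
Proof. exact: raddfD. Qed.

Lemma gcoef_hcomp d k f n : gcoef n (hcomp d k f) = if d n == k then gcoef n f else 0.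
Proof. exact: gcoef_gres. Qed.

Lemma hcomp_hcomp d k l f : hcomp d k (hcomp d l f) = if k == l then hcomp d k f else 0.
Proof.
apply: galgP => n; rewrite (fun_if (gcoef n)) !gcoef_hcomp raddf0.
case: eqP => [->|_]; first by case: (k == l).
by rewrite if_same.
Qed.

Lemma hcompK d k f : homog d k (hcomp d k f).
Proof. by rewrite /homog hcomp_hcomp eqxx. Qed.

Lemma homog_supp d k f n : homog d k f -> gcoef n f != 0 -> d n = k.
Proof. by move=> <-; rewrite gcoef_hcomp; case: ifP => [/eqP//|]; rewrite eqxx. Qed.

Lemma homogP d k f : (forall n, gcoef n f != 0 -> d n = k) -> homog d k f.
Proof.
move=> h; apply: galgP => n; rewrite gcoef_hcomp; case: eqP => // dn.
by case: (eqVneq (gcoef n f) 0) => [->//|/h/dn].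
Qed.

Lemma homog_neq d k l f : homog d l f -> k != l -> hcomp d k f = 0.
Proof. by move=> <- kl; rewrite hcomp_hcomp (negbTE kl). Qed.

Lemma hcomp_ext d f g : (forall k, hcomp d k f = hcomp d k g) -> f = g.
Proof.
move=> h; apply: galgP => n; have := congr1 (gcoef n) (h (d n)).
by rewrite !gcoef_hcomp eqxx.
Qed.

Definition hdegs d f : seq int := undup [seq d n | n <- gsupp f].

Lemma hcomp_out d k f : k \notin hdegs d f -> hcomp d k f = 0.
Proof.
rewrite mem_undup => h; apply: galgP => n; rewrite gcoef_hcomp raddf0.
case: eqP => // dn; apply/eqP; apply: contraR h => nf.
by apply/mapP; exists n; rewrite ?gsuppE.
Qed.

Lemma hcomp_sum d f (s : seq int) : uniq s -> {subset hdegs d f <= s} ->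
  f = \sum_(k <- s) hcomp d k f.
Proof.
move=> us sub; apply: (@hcomp_ext d) => k; rewrite raddf_sum /=.
rewrite (eq_bigr (fun l => if l == k then hcomp d k f else 0)); last first.
  by move=> l _; rewrite hcomp_hcomp eq_sym.
rewrite -big_mkcond sum_pred1_seq //; case: ifP => // /negbT ks.
by apply: hcomp_out; apply: contra ks => /sub.
Qed.

Lemma homogM d k l f g : additive_map d -> homog d k f -> homog d l g ->
  homog d (k + l) (f * g).
Proof.
move=> ad hf hg; apply: homogP => n.
rewrite -[f * g]/(gmul f g) gcoef_gmul => nz.
case: (altP (@eqP _ (d n) (k + l))) => // neq; case/eqP: nz; apply: big1 => a _.
apply/eqP; rewrite mulf_eq0; apply: contraR neq; rewrite negb_or => /andP[fa ga].
by rewrite -[n](subrK a) ad (homog_supp hf fa) (homog_supp hg ga) addrC.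
Qed.

Lemma homog_mono d n c : homog d (d n) (gmono n c : R).
Proof.
apply: homogP => m; rewrite gcoef_mono.
by case: (eqVneq n m) => [->//|_]; rewrite eqxx.
Qed.

Lemma homog1 d : additive_map d -> homog d 0 (1 : R).
Proof. by move=> ad; rewrite -[X in homog d X _](am0 ad); apply: homog_mono. Qed.

Lemma homogD d k f g : homog d k f -> homog d k g -> homog d k (f + g).
Proof. by rewrite /homog => hf hg; rewrite raddfD /= hf hg. Qed.

Lemma homog0X d f n : additive_map d -> homog d 0 f -> homog d 0 (f ^+ n).
Proof.
move=> ad hf; elim: n => [|n IH]; first by rewrite expr0; apply: homog1.
by rewrite exprS -[0](addr0 0); apply: homogM.
Qed.

Lemma hcompM d k l f g : additive_map d -> homog d k f ->
  hcomp d l (f * g) = f * hcomp d (l - k) g.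
Proof.
move=> ad hf.
pose s := hdegs d g; rewrite {1}(@hcomp_sum d g s) ?undup_uniq //.
rewrite mulr_sumr raddf_sum /=.
rewrite (eq_bigr (fun m => if m == l - k then f * hcomp d (l - k) g else 0)); last first.
  move=> m _; have h := homogM ad hf (hcompK d m g).
  case: eqP => [->|ne].
    by have := homogM ad hf (hcompK d (l - k) g); rewrite addrC subrK.
  by rewrite (homog_neq h) //; apply/eqP => e; apply: ne; rewrite e addrC addKr.
rewrite -big_mkcond sum_pred1_seq ?undup_uniq //; case: ifP => // /negbT h.
by rewrite hcomp_out // mulr0.
Qed.

Lemma hcomp_gt d l n g : additive_map d -> hcomp d l (gt F n * g) = gt F n * hcomp d (l - d n) g.
Proof. by move=> ad; apply: hcompM => //; apply: homog_mono. Qed.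

Lemma hdegs_max d f : f != 0 -> exists k, hcomp d k f != 0 /\
  forall l, k < l -> hcomp d l f = 0.
Proof.
move=> f0; have [n nf] : exists n, n \in gsupp f.
  move: f0; rewrite galg_eq0; case: (gsupp f) => [|n s] // _.
  by exists n; rewrite mem_head.
pose s := hdegs d f; have sn : d n \in s by rewrite mem_undup map_f.
have [m ms hm] : exists2 m, m \in s & forall l, l \in s -> l <= m.
  case: s sn => // a s _; elim: s a => [|b s IH] a.
    by exists a; rewrite ?mem_head // => l; rewrite inE => /eqP->.
  have [m ms hm] := IH b.
  case: (leP a m) => am.
    by exists m => [|l]; rewrite in_cons ?ms ?orbT // => /orP[/eqP->//|/hm].
  exists a => [|l]; rewrite ?mem_head // in_cons => /orP[/eqP->//|/hm lm].
  exact: le_trans lm (ltW am).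
exists m; split; last first.
  by move=> l ml; apply: hcomp_out; apply/negP => /hm; rewrite leNgt ml.
move: ms; rewrite mem_undup => /mapP[a af ->]; apply/eqP => /(congr1 (gcoef a)).
by rewrite gcoef_hcomp eqxx raddf0; apply/eqP; rewrite -gsuppE.
Qed.

Lemma hcomp_opp d k f : hcomp (fun n => - d n) k f = hcomp d (- k) f.
Proof. by apply: eq_gres => n; rewrite eqr_oppLR. Qed.

Lemma hcompM_top d a b f g : additive_map d ->
  (forall l, a < l -> hcomp d l f = 0) -> (forall l, b < l -> hcomp d l g = 0) ->
  hcomp d (a + b) (f * g) = hcomp d a f * hcomp d b g /\
  forall l, a + b < l -> hcomp d l (f * g) = 0.
Proof.
move=> ad ha hb.
have E l : hcomp d l (f * g) = \sum_(k <- hdegs d f) hcomp d k f * hcomp d (l - k) g.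
  rewrite {1}(@hcomp_sum d f (hdegs d f)) ?undup_uniq // mulr_suml raddf_sum /=.
  by apply: eq_bigr => k _; rewrite (hcompM _ _ ad (hcompK d k f)).
split=> [|l hl]; rewrite E.
  rewrite (eq_bigr (fun k => if k == a then hcomp d a f * hcomp d b g else 0)).
    rewrite -big_mkcond sum_pred1_seq ?undup_uniq //; case: ifP => // /negbT h.
    by rewrite (hcomp_out h) mul0r.
  move=> k _; case: eqP => [->|/eqP ka]; first by rewrite addrC addKr.
  case: (ltP a k) => [/ha->|ak]; rewrite ?mul0r // hb ?mulr0 //; lia.
apply: big1 => k _; case: (ltP a k) => [/ha->|ak]; rewrite ?mul0r // hb ?mulr0 //; lia.
Qed.

End Homogeneous.

(** * Laurent polynomials: no zero divisors, factors of monomials *)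

Section Laurent.
Variables (F : fieldType) (V : finType).
Local Notation G := {ffun V -> int}.
Local Notation R := (galg F G).
Implicit Types (d : G -> int) (f g h : R) (k l : int) (n m y z : G).

Lemma additive_coord (v : V) : additive_map (fun n : G => n v).
Proof. by move=> n m; rewrite ffunE. Qed.

Lemma supp1_mono f n : gcoef n f != 0 -> (forall m, gcoef m f != 0 -> m = n) ->
  f = gmono n (gcoef n f).
Proof.
move=> nf h; apply: galgP => m; rewrite gcoef_mono.
case: (eqVneq n m) => [->//|nm]; apply/eqP; apply: contraNT nm => /h ->.
by rewrite eqxx.
Qed.

Lemma galg_neq0 f : f != 0 -> exists n, gcoef n f != 0.
Proof.
rewrite galg_eq0; case E: (gsupp f) => [|n s] // _.
by exists n; rewrite -gsuppE E mem_head.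
Qed.

(** Induction on a list of coordinates that suffices to tell the exponents apart: passing to the
    component of top degree in one coordinate makes that coordinate constant, and with no coordinate
    left both factors are monomials. *)
Lemma galg_mul_neq0 f g : f != 0 -> g != 0 -> f * g != 0.
Proof.
pose sep (vs : seq V) (f : R) := forall n m, gcoef n f != 0 -> gcoef m f != 0 ->
  (forall v, v \in vs -> n v = m v) -> n = m.
suff H vs : forall f g, sep vs f -> sep vs g -> f != 0 -> g != 0 -> f * g != 0.
  apply: (H (enum V)) => n m _ _ e; apply/ffunP => v; apply: e; exact: mem_enum.
elim: vs => [|v vs IH] {}f {}g sf sg f0 g0.
  have [n nf] := galg_neq0 f0; have [m mg] := galg_neq0 g0.
  rewrite (supp1_mono nf) => [|a af]; last exact: sf.
  rewrite (supp1_mono mg) => [|a ag]; last exact: sg.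
  by rewrite gmonoM gmono_eq0 mulf_neq0.
pose d n := n v; have ad : additive_map d by apply: additive_coord.
have [a [fa ha]] := hdegs_max d f0; have [b [gb hb]] := hdegs_max d g0.
have [E _] := hcompM_top ad ha hb.
have S c h : sep (v :: vs) h -> sep vs (hcomp d c h).
  move=> sh n m; rewrite !gcoef_hcomp; case: ifP => [/eqP dn|]; last by rewrite eqxx.
  move=> nh; case: ifP => [/eqP dm|]; last by rewrite eqxx.
  move=> mh e; apply: sh => // w; rewrite inE => /orP[/eqP->|/e//].
  by rewrite -/(d n) dn.
have := IH _ _ (S a _ sf) (S b _ sg) fa gb; rewrite -E.
by apply: contraNN => /eqP ->; rewrite raddf0.
Qed.

Lemma galg_mulI f g h : f != 0 -> f * g = f * h -> g = h.
Proof.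
move=> f0 /eqP; rewrite -subr_eq0 -mulrBr => e; apply/eqP; rewrite -subr_eq0.
by apply: contraTT e => gh; apply: galg_mul_neq0.
Qed.

Definition htop d k f := hcomp d k f != 0 /\ forall l, k < l -> hcomp d l f = 0.

Lemma htop_exists d f : f != 0 -> exists k, htop d k f.
Proof. exact: hdegs_max. Qed.

Lemma htopM d a b f g : additive_map d -> htop d a f -> htop d b g -> htop d (a + b) (f * g).
Proof.
move=> ad [fa ha] [gb hb]; have [E h] := hcompM_top ad ha hb.
split; last exact: h.
rewrite E; exact: galg_mul_neq0 fa gb.
Qed.

Lemma htop_uniq d a b f : htop d a f -> htop d b f -> a = b.
Proof.
move=> [fa ha] [fb hb]; case: (ltgtP a b) => // [/ha|/hb] e.
  by rewrite e eqxx in fb.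
by rewrite e eqxx in fa.
Qed.

Lemma htop_homog d k f : f != 0 -> homog d k f -> htop d k f.
Proof.
move=> f0 hf; split; first by rewrite hf.
by move=> l kl; rewrite (homog_neq hf) // gt_eqF.
Qed.

Lemma additive_opp d : additive_map d -> additive_map (fun n => - d n).
Proof. by move=> ad n m; rewrite ad opprD. Qed.

Lemma homog_opp d k f : homog d k f -> homog (fun n => - d n) (- k) f.
Proof. by move=> hf; rewrite /homog hcomp_opp opprK. Qed.

Lemma htop_bot d a b f : htop d a f -> htop (fun n => - d n) b f -> - b <= a.
Proof.
move=> [fa ha] [fb hb]; rewrite hcomp_opp in fb.
by rewrite leNgt; apply/negP => /ha e; rewrite e eqxx in fb.
Qed.

Lemma htop_bot_homog d a f : htop d a f -> htop (fun n => - d n) (- a) f -> homog d a f.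
Proof.
move=> [fa ha] [fb hb]; apply: homogP => n nf.
have nz : hcomp d (d n) f != 0.
  apply/eqP => /(congr1 (gcoef n)); rewrite gcoef_hcomp eqxx raddf0.
  by apply/eqP.
case: (ltgtP (d n) a) => // h; last by rewrite ha ?eqxx in nz.
have := hb (- d n); rewrite hcomp_opp opprK ltrN2 => /(_ h) e.
by rewrite e eqxx in nz.
Qed.

(** Top degrees add up under multiplication, and so do bottom degrees; if the two agree for the
    product, they agree for each factor. *)
Lemma homog_factor d k f g : additive_map d -> f * g != 0 -> homog d k (f * g) ->
  exists l, homog d l f.
Proof.
move=> ad fg0 hfg.
have f0 : f != 0 by apply: contraNN fg0 => /eqP ->; rewrite mul0r.
have g0 : g != 0 by apply: contraNN fg0 => /eqP ->; rewrite mulr0.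
have [a fa] := htop_exists d f0; have [b gb] := htop_exists d g0.
have [a' fa'] := htop_exists (fun n => - d n) f0.
have [b' gb'] := htop_exists (fun n => - d n) g0.
have e1 := htop_uniq (htopM ad fa gb) (htop_homog fg0 hfg).
have e2 := htop_uniq (htopM (additive_opp ad) fa' gb') (htop_homog fg0 (homog_opp hfg)).
have h1 := htop_bot fa fa'; have h2 := htop_bot gb gb'.
exists a; apply: htop_bot_homog => //.
by have <- : a' = - a by lia.
Qed.

(** By [homog_factor], a factor of a monomial is homogeneous in every coordinate. *)
Lemma factor_mono f g n c : c != 0 -> f * g = gmono n c ->
  exists m c', c' != 0 /\ f = gmono m c'.
Proof.
move=> c0 e; have fg0 : f * g != 0 by rewrite e gmono_eq0.
have f0 : f != 0 by apply: contraNN fg0 => /eqP ->; rewrite mul0r.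
have [m mf] := galg_neq0 f0; exists m, (gcoef m f); split=> //.
apply: supp1_mono => // m' m'f; apply/ffunP => v.
have [l hl] : exists l, homog (fun n : G => n v) l f.
  apply: (@homog_factor _ (n v) f g) => //; first exact: additive_coord.
  rewrite e; exact: homog_mono (fun n : G => n v) n c.
by rewrite (homog_supp hl mf) (homog_supp hl m'f).
Qed.

Lemma binomial_neq0 z : z != 0 -> 1 + gt F z != 0.
Proof.
move=> z0; apply/eqP => /(congr1 (gcoef 0)).
rewrite raddfD /= -[1]gt0 !gcoef_mono eqxx (negbTE z0) addr0 raddf0.
by move/eqP; rewrite oner_eq0.
Qed.

Lemma galg_exp_neq0 f (i : nat) : f != 0 -> f ^+ i != 0.
Proof.
move=> f0; elim: i => [|i IH]; last by rewrite exprS galg_mul_neq0.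
by rewrite expr0 oner_neq0.
Qed.

Lemma binomial_not_mono z n c : z != 0 -> 1 + gt F z <> gmono n c.
Proof.
move=> z0 e; have := congr1 (gcoef 0) e; have := congr1 (gcoef z) e.
rewrite !raddfD /= -[1]gt0 !gcoef_mono !eqxx [z == 0](negbTE z0) [0 == z]eq_sym (negbTE z0).
rewrite add0r addr0 !mulr1n => e1 e2.
case: (eqVneq n z) => nz; last first.
  by move: e1; rewrite (negbTE nz) => /eqP; rewrite oner_eq0.
by move: e2; rewrite nz (negbTE z0) => /eqP; rewrite oner_eq0.
Qed.

Lemma binomial_ndvd_mono z n c j : z != 0 -> (0 < j)%N -> c != 0 ->
  ~ gdvd ((1 + gt F z) ^+ j) (gmono n c).
Proof.
move=> z0; case: j => // j _ c0 [q e].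
have [m [c' [_ e']]] : exists m c', c' != 0 /\ 1 + gt F z = gmono m c'.
  apply: (@factor_mono _ ((1 + gt F z) ^+ j * q) n c) => //.
  by rewrite mulrA -exprS.
exact: binomial_not_mono z0 e'.
Qed.

Lemma gdvd_cancel f g h : f != 0 -> gdvd (f * g) (f * h) -> gdvd g h.
Proof. by move=> f0 [q e]; exists q; apply: (galg_mulI f0); rewrite e mulrA. Qed.

End Laurent.

(** * Scaling the components by powers of a binomial *)

Definition pz (i : int) : nat := if i is Posz n then n else 0%N.
Definition nz (i : int) : nat := pz (- i).

Lemma pzE i : (pz i)%:Z = Num.max i 0.
Proof. by case: i => i //=; lia. Qed.

Lemma nzE i : (nz i)%:Z = Num.max (- i) 0.
Proof. exact: pzE. Qed.

Section Scaling.
Variables (F : fieldType) (V : finType).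
Local Notation G := {ffun V -> int}.
Local Notation R := (galg F G).
Implicit Types (d : G -> int) (f g h q : R) (k l u w : int) (n m y z : G) (P : int -> R).

Fact gscale_sig : {h : (G -> int) -> (int -> R) -> R -> R |
  forall d P f, h d P f = \sum_(k <- hdegs d f) P k * hcomp d k f}.
Proof. by exists (fun d P f => \sum_(k <- hdegs d f) P k * hcomp d k f). Qed.

Definition gscale := sval gscale_sig.

Lemma gscale_def d P f : gscale d P f = \sum_(k <- hdegs d f) P k * hcomp d k f.
Proof. exact: (svalP gscale_sig). Qed.

Lemma gscaleE d P f (s : seq int) : uniq s -> {subset hdegs d f <= s} ->
  gscale d P f = \sum_(k <- s) P k * hcomp d k f.
Proof.
move=> us sub; rewrite gscale_def [RHS](bigID (mem (hdegs d f))) /= [X in _ + X]big1 ?addr0.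
  rewrite -[RHS]big_filter; apply: perm_big; apply: uniq_perm.
  - exact: undup_uniq.
  - by rewrite filter_uniq.
  by move=> a; rewrite mem_filter; case E: (a \in hdegs d f) => //=; rewrite sub.
by move=> k /hcomp_out ->; rewrite mulr0.
Qed.

Section Fixed.
Variables (d : G -> int) (P : int -> R).
Hypotheses (ad : additive_map d) (hP : forall k, homog d 0 (P k)).

Lemma hcomp_gscale k f : hcomp d k (gscale d P f) = P k * hcomp d k f.
Proof.
rewrite gscale_def raddf_sum /=.
rewrite (eq_bigr (fun l => if l == k then P k * hcomp d k f else 0)); last first.
  move=> l _; rewrite (hcompM _ _ ad (hP l)) subr0 hcomp_hcomp [k == l]eq_sym.
  by case: eqP => [->|_]; rewrite ?mulr0.
rewrite -big_mkcond sum_pred1_seq ?undup_uniq //; case: ifP => // /negbT h.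
by rewrite hcomp_out // mulr0.
Qed.

Lemma gscale_is_additive : {morph gscale d P : f g / f - g}.
Proof.
move=> f g; apply: (@hcomp_ext _ _ d) => k.
by rewrite [LHS]hcomp_gscale !hcomp_is_additive !hcomp_gscale mulrBr.
Qed.

Lemma gscale0 : gscale d P 0 = 0.
Proof. by rewrite -[0 in LHS](subrr 0) gscale_is_additive subrr. Qed.

Lemma gscaleD f g : gscale d P (f + g) = gscale d P f + gscale d P g.
Proof. by rewrite -{1}[g]opprK gscale_is_additive -[- g]add0r gscale_is_additive gscale0 sub0r opprK. Qed.

Lemma gscale_sum (I : Type) (r : seq I) (Q : pred I) E :
  gscale d P (\sum_(i <- r | Q i) E i) = \sum_(i <- r | Q i) gscale d P (E i).
Proof. exact: (big_morph _ gscaleD gscale0). Qed.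

Lemma gscale_homog k f : homog d k f -> gscale d P f = P k * f.
Proof.
move=> hf; apply: (@hcomp_ext _ _ d) => l; rewrite hcomp_gscale (hcompM _ _ ad (hP k)) subr0.
case: (eqVneq l k) => [->//|lk].
by rewrite (homog_neq hf lk) !mulr0.
Qed.

Lemma gscale_gt n f : gscale d P (gt F n * f) = gt F n * gscale d (fun k => P (k + d n)) f.
Proof.
have hP' k : homog d 0 (P (k + d n)) by [].
rewrite {1}(@hcomp_sum _ _ d f (hdegs d f)) ?undup_uniq // mulr_sumr gscale_sum gscale_def mulr_sumr.
apply: eq_bigr => k _; rewrite (@gscale_homog (k + d n)).
  by rewrite mulrCA.
by rewrite addrC; apply: homogM => //; [exact: homog_mono|exact: hcompK].
Qed.

Lemma hcomp_gscale_degree d' l (c : int -> int) f :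
  additive_map d' -> (forall k, homog d' (c k) (P k)) -> (forall n, c (d n) = l) ->
  forall k, hcomp d' k (gscale d P f) = gscale d P (hcomp d' (k - l) f).
Proof.
move=> ad' hc cl k; rewrite {1}gscale_def raddf_sum /=.
rewrite (@gscaleE d P _ (hdegs d f)) ?undup_uniq //.
  rewrite [LHS]big_seq [RHS]big_seq; apply: eq_bigr => j; rewrite mem_undup => /mapP[n _ ->].
  rewrite (hcompM _ _ ad' (hc (d n))) cl; congr (_ * _).
  by apply: galgP => m; rewrite !gcoef_hcomp; case: ifP; case: ifP.
move=> j; rewrite !mem_undup => /mapP[n nf ->]; apply/mapP; exists n => //.
move: nf; rewrite !gsuppE gcoef_hcomp; by case: ifP; rewrite ?eqxx.
Qed.

End Fixed.

Lemma homog_gt0 d z : additive_map d -> d z = 0 -> homog d 0 (gt F z : R).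
Proof. by move=> ad dz; rewrite -dz; apply: homog_mono. Qed.

Lemma homog_binomial d z : additive_map d -> d z = 0 -> homog d 0 (1 + gt F z : R).
Proof. by move=> ad dz; apply: homogD; [exact: homog1|exact: homog_gt0]. Qed.

(** For [w = N + u] this is the exchange of shift [u], multiplied through by [(1 + t^z)^N]. When [N]
    is large, all exponents [w + k] that occur are nonnegative, so the truncation [pz] is harmless
    and no division is left. *)
Definition escale d z w f := gscale d (fun k => (1 + gt F z) ^+ pz (w + k)) f.

Section EScale.
Variables (d : G -> int) (z : G).
Hypotheses (ad : additive_map d) (dz : d z = 0).

Lemma homog_binomialX i : homog d 0 ((1 + gt F z) ^+ i : R).
Proof. by apply: homog0X => //; apply: homog_binomial. Qed.

Lemma hcomp_escale w k f :
  hcomp d k (escale d z w f) = (1 + gt F z) ^+ pz (w + k) * hcomp d k f.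
Proof. by apply: hcomp_gscale => // l; apply: homog_binomialX. Qed.

Lemma escaleD w f g : escale d z w (f + g) = escale d z w f + escale d z w g.
Proof. by apply: gscaleD => // l; apply: homog_binomialX. Qed.

Lemma escale_sum w (I : Type) (r : seq I) (Q : pred I) E :
  escale d z w (\sum_(i <- r | Q i) E i) = \sum_(i <- r | Q i) escale d z w (E i).
Proof. by apply: gscale_sum => // l; apply: homog_binomialX. Qed.

Lemma escale_homog w k f : homog d k f -> escale d z w f = (1 + gt F z) ^+ pz (w + k) * f.
Proof. by apply: gscale_homog => // l; apply: homog_binomialX. Qed.

Lemma escale_gt w n f : escale d z w (gt F n * f) = gt F n * escale d z (w + d n) f.
Proof.
rewrite /escale gscale_gt // => [|l]; last exact: homog_binomialX.
congr (_ * _); rewrite !gscale_def; apply: eq_bigr => k _.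
by congr (_ ^+ pz _ * _); rewrite -addrA [d n + _]addrC.
Qed.

Lemma escale_shift w (l : nat) f : (forall k, hcomp d k f != 0 -> 0 <= w + k) ->
  escale d z (w + l%:Z) f = (1 + gt F z) ^+ l * escale d z w f.
Proof.
move=> h; apply: (@hcomp_ext _ _ d) => k.
rewrite hcomp_escale (hcompM _ _ ad (homog_binomialX l)) subr0 hcomp_escale mulrA -exprD.
case: (eqVneq (hcomp d k f) 0) => [->|/h wk]; first by rewrite !mulr0.
congr (_ ^+ _ * _); have := pzE (w + k); have := pzE (w + l%:Z + k); lia.
Qed.

Lemma escaleM w1 w2 f g : (forall k, hcomp d k f != 0 -> 0 <= w1 + k) ->
  (forall k, hcomp d k g != 0 -> 0 <= w2 + k) ->
  escale d z (w1 + w2) (f * g) = escale d z w1 f * escale d z w2 g.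
Proof.
move=> hf hg.
rewrite {1}(@hcomp_sum _ _ d f (hdegs d f)) ?undup_uniq //.
rewrite {1}(@hcomp_sum _ _ d g (hdegs d g)) ?undup_uniq //.
rewrite mulr_suml escale_sum [escale d z w1 f]gscale_def mulr_suml; apply: eq_bigr => a _.
rewrite mulr_sumr escale_sum [escale d z w2 g]gscale_def mulr_sumr; apply: eq_bigr => b _.
rewrite (@escale_homog _ (a + b)); last first.
  by apply: homogM => //; apply: hcompK.
rewrite mulrACA -exprD.
case: (eqVneq (hcomp d a f) 0) => [->|/hf wa]; first by rewrite !(mul0r, mulr0).
case: (eqVneq (hcomp d b g) 0) => [->|/hg wb]; first by rewrite !(mul0r, mulr0).
congr (_ ^+ _ * _); have := pzE (w1 + a); have := pzE (w2 + b).
have := pzE (w1 + w2 + (a + b)); lia.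
Qed.

End EScale.

(* The exchange at a vertex multiplies the component of degree [k] by
   [(1 + t^z)^(u + k)].  [vgood] says that no denominator appears, and [mutrel]
   that [f'] is the image of [f], both sides being multiplied by the
   denominator. *)
Definition vgood u d z f := forall k, gdvd ((1 + gt F z) ^+ nz (u + k)) (hcomp d k f).

Definition mutrel u d z f f' := forall k,
  (1 + gt F z) ^+ nz (u + k) * hcomp d k f' = (1 + gt F z) ^+ pz (u + k) * hcomp d k f.

Lemma mutrel_sym u d z f f' : mutrel u d z f f' ->
  mutrel (- u) (fun n => - d n) z f' f.
Proof.
move=> h k; rewrite !hcomp_opp; have := h (- k).
by rewrite /nz !opprD !opprK => ->.
Qed.

Lemma vgood_mutrel u d z f : additive_map d -> d z = 0 -> vgood u d z f ->
  exists f', mutrel u d z f f'.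
Proof.
move=> ad dz vg.
(* The exchanged element is assembled one degree at a time. *)
suff H s : uniq s -> exists f', forall k, if k \in s
    then (1 + gt F z) ^+ nz (u + k) * hcomp d k f' = (1 + gt F z) ^+ pz (u + k) * hcomp d k f
    else hcomp d k f' = 0.
  have [f' h] := H (hdegs d f) (undup_uniq _); exists f' => k; have := h k.
  case: ifP => // /negbT ks ->; rewrite mulr0 hcomp_out ?mulr0 //.
elim: s => [|k s IH] /=; first by exists 0 => k; rewrite hcomp0.
move=> /andP[ks /IH[f' h]]; have [q e] := vg k.
exists (f' + (1 + gt F z) ^+ pz (u + k) * hcomp d k q) => l.
rewrite hcompD (hcompM _ _ ad (homog_binomialX ad dz _)) subr0 hcomp_hcomp inE.
case: (eqVneq l k) => [->|lk] /=.
  have := h k; rewrite (negbTE ks) => ->; rewrite add0r mulrCA; congr (_ * _).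
  have := congr1 (hcomp d k) e.
  by rewrite (hcompM _ _ ad (homog_binomialX ad dz _)) subr0 hcomp_hcomp eqxx => ->.
by rewrite mulr0 addr0; apply: h.
Qed.

Lemma mutrel_vgood u d z f f' : mutrel u d z f f' -> vgood u d z f.
Proof.
move=> h k; have := h k; have := nzE (u + k); have := pzE (u + k).
case: (leP 0 (u + k)) => uk e1 e2.
  have -> : nz (u + k) = 0%N by lia.
  by move=> _; exact: gdvd1.
have -> : pz (u + k) = 0%N by lia.
by rewrite expr0 mul1r => <-; exists (hcomp d k f').
Qed.

Lemma mutrel_vgood' u d z f f' : mutrel u d z f f' -> vgood (- u) (fun n => - d n) z f'.
Proof. by move=> /mutrel_sym; apply: mutrel_vgood. Qed.

(** [1 + t^z] and [1 + t^(-z)] differ by the unit [t^z]. *)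
Lemma vgoodN u d z f : vgood u d z f -> vgood u d (- z) f.
Proof.
move=> h k; have [q ->] := h k.
have e : 1 + gt F z = gt F z * (1 + gt F (- z)) by rewrite mulrDr mulr1 gtK addrC.
rewrite e exprMn; exists (gt F z ^+ nz (u + k) * q).
by rewrite [RHS]mulrCA mulrA.
Qed.

Lemma hcomp_bound d f : exists N : nat, forall k, hcomp d k f != 0 -> - N%:Z <= k <= N%:Z.
Proof.
case: (eqVneq f 0) => [->|f0]; first by exists 0%N => k; rewrite hcomp0 eqxx.
have [a [_ ha]] := hdegs_max d f0; have [b [_ hb]] := hdegs_max (fun n => - d n) f0.
exists (`|a|%N + `|b|%N)%N => k nk; apply/andP; split.
  rewrite leNgt; apply/negP => h; move/eqP: nk; apply.
  have := hb (- k); rewrite hcomp_opp opprK; apply; lia.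
rewrite leNgt; apply/negP => h; move/eqP: nk; apply; apply: ha; lia.
Qed.

Lemma mutrel_escale u d z f f' : additive_map d -> d z = 0 -> mutrel u d z f f' ->
  exists N0 : nat, forall N : nat, (N0 <= N)%N ->
  (1 + gt F z) ^+ N * f' = escale d z (N%:Z + u) f.
Proof.
move=> ad dz h; have [A hA] := hcomp_bound d f; have [B hB] := hcomp_bound d f'.
exists (A + B + `|u|)%N => N hN; apply: (@hcomp_ext _ _ d) => k.
rewrite (hcompM _ _ ad (homog_binomialX ad dz _)) subr0 (hcomp_escale ad dz).
case: (boolP ((hcomp d k f' == 0) && (hcomp d k f == 0))) => [/andP[/eqP-> /eqP->]|nk].
  by rewrite !mulr0.
have kb : - N%:Z <= u + k.
  move: nk; rewrite negb_and => /orP[/hB|/hA]; lia.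
have e1 : N = (N - nz (u + k) + nz (u + k))%N by have := nzE (u + k); lia.
rewrite {1}e1 exprD -mulrA h mulrA -exprD; congr (_ ^+ _ * _).
have := nzE (u + k); have := pzE (u + k); have := pzE (N%:Z + u + k); lia.
Qed.

Lemma mutrel_uniq u d z f f1 f2 : z != 0 -> mutrel u d z f f1 -> mutrel u d z f f2 -> f1 = f2.
Proof.
move=> z0 h1 h2; apply: (@hcomp_ext _ _ d) => k.
apply: (@galg_mulI _ _ ((1 + gt F z) ^+ nz (u + k))).
  by apply: galg_exp_neq0; apply: binomial_neq0.
by rewrite h1 h2.
Qed.

(** After multiplication by a large power of [1 + t^z], this is the multiplicativity of [escale]. *)
Lemma mutrelM u1 u2 d z f g f' g' h : additive_map d -> d z = 0 -> z != 0 ->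
  mutrel u1 d z f f' -> mutrel u2 d z g g' -> mutrel (u1 + u2) d z (f * g) h -> h = f' * g'.
Proof.
move=> ad dz z0 hf hg hh.
have [N1 e1] := mutrel_escale ad dz hf; have [N2 e2] := mutrel_escale ad dz hg.
have [N3 e3] := mutrel_escale ad dz hh.
have [A hA] := hcomp_bound d f; have [B hB] := hcomp_bound d g.
pose N := (N1 + N2 + N3 + A + B + `|u1| + `|u2|)%N.
apply: (@galg_mulI _ _ ((1 + gt F z) ^+ (N + N))).
  by apply: galg_exp_neq0; apply: binomial_neq0.
rewrite e3; last by lia.
rewrite exprD mulrACA e1; last by lia.
rewrite e2; last by lia.
rewrite -escaleM //.
- by congr (escale _ _ _ _); rewrite PoszD addrACA.
- by move=> k /hA; lia.
- by move=> k /hB; lia.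
Qed.

End Scaling.

Arguments homog_gt0 {F V d z}.
Arguments homog_binomial {F V d z}.
Arguments homog_binomialX {F V d z}.
Arguments homog_mono {F G} d n c.
Arguments homog1 {F G d}.

(** * Exchanges of Laurent polynomials *)

Section Transport.
Variables (F : fieldType) (V : finType).
Local Notation G := {ffun V -> int}.
Local Notation R := (galg F G).
Implicit Types (d : G -> int) (f g h q : R) (k l u w : int) (n m y z : G).

Definition low d j f := forall k, k < j -> hcomp d k f = 0.

Lemma low_exists d f : exists j, low d j f.
Proof.
have [N hN] := hcomp_bound d f; exists (- N%:Z) => k kN.
by apply/eqP; apply: contraTT kN => /hN; lia.
Qed.

Lemma low_le d j j' f : j' <= j -> low d j f -> low d j' f.
Proof. by move=> le h k kj; apply: h; apply: lt_le_trans le. Qed.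

Lemma lowD d j f g : low d j f -> low d j g -> low d j (f + g).
Proof. by move=> hf hg k kj; rewrite hcompD hf // hg // addr0. Qed.

Lemma low_sum d j (I : Type) (r : seq I) (P : pred I) E :
  (forall i, P i -> low d j (E i)) -> low d j (\sum_(i <- r | P i) E i).
Proof.
move=> h; elim/big_ind: _ => //; first by move=> k _; rewrite hcomp0.
by move=> f g; apply: lowD.
Qed.

Lemma lowM d i j f g : additive_map d -> low d i f -> low d j g -> low d (i + j) (f * g).
Proof.
move=> ad hf hg k kij.
rewrite (@hcomp_sum _ _ d f (hdegs d f)) ?undup_uniq // mulr_suml.
rewrite (big_morph _ (hcompD d k) (hcomp0 _ d k)) big1 // => a _.
rewrite (hcompM _ _ ad (hcompK d a f)).
case: (ltP a i) => ai; first by rewrite hf ?mul0r.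
by rewrite hg ?mulr0 //; lia.
Qed.

Lemma homog_low d j f : homog d j f -> low d j f.
Proof. by move=> hf k kj; rewrite (homog_neq hf) // lt_eqF. Qed.

Lemma vgoodD u d y f g : vgood u d y f -> vgood u d y g -> vgood u d y (f + g).
Proof. by move=> hf hg k; rewrite hcompD; apply: gdvdD. Qed.

Lemma vgood0 u d y : vgood u d y (0 : R).
Proof. by move=> k; rewrite hcomp0; apply: gdvd0. Qed.

Lemma vgood_sum u d y (I : Type) (r : seq I) (P : pred I) (E : I -> R) :
  (forall i, P i -> vgood u d y (E i)) -> vgood u d y (\sum_(i <- r | P i) E i).
Proof. by move=> h; elim/big_ind: _ => //; [exact: vgood0|exact: vgoodD]. Qed.

Lemma vgood_low u d y j f : low d j f -> 0 <= u + j -> vgood u d y f.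
Proof.
move=> hf uj k; case: (ltP k j) => kj; first by rewrite hf //; apply: gdvd0.
have -> : nz (u + k) = 0%N by have := nzE (u + k); lia.
exact: gdvd1.
Qed.

Lemma vgoodS u d y f : additive_map d -> d y = 0 ->
  vgood (u + 1) d y f -> vgood u d y ((1 + gt F y) * f).
Proof.
move=> ad dy h k; rewrite (hcompM _ _ ad (homog_binomial ad dy)) subr0.
apply: (@gdvd_exp _ _ _ _ (nz (u + 1 + k)).+1); last by rewrite exprS; apply: gdvd_mul (gdvd_refl _) (h k).
by have := nzE (u + 1 + k); have := nzE (u + k); lia.
Qed.

Lemma vgood_twist u d y n f : additive_map d ->
  vgood u d y (gt F n * f) <-> vgood (u + d n) d y f.
Proof.
move=> ad; split=> h k.
  by have := h (k + d n); rewrite hcomp_gt // addrK addrA addrAC => /gdvd_gt.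
by rewrite hcomp_gt //; have := h (k - d n); rewrite addrAC addrA subrK => H; apply: gdvd_mull.
Qed.

Definition independent y z := forall i j : int, y *~ i + z *~ j = 0 -> i = 0 /\ j = 0.

Lemma ffun_mulrz (n : G) (i : int) v : (n *~ i) v = n v * i.
Proof. by have /= -> := amMz (additive_coord v) n i; rewrite mulrzz. Qed.

Lemma independent_separated y z : independent y z ->
  exists2 d, additive_map d & d y = 0 /\ d z <> 0.
Proof.
move=> ind.
have y0 : y != 0 by apply/eqP => e; have [|//] := ind 1 0; rewrite e mul0rz mulr0z addr0.
have [v yv] : exists v, y v != 0.
  apply/existsP; apply: contraR y0; rewrite negb_exists => /forallP h.
  by apply/eqP/ffunP => v; rewrite ffunE; apply/eqP; have := h v; rewrite negbK.
have [v' zw] : exists v', y v * z v' != y v' * z v.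
  apply/existsP; apply: contraT; rewrite negb_exists => /forallP h.
  have [|_ e] := ind (- z v) (y v); last by rewrite e eqxx in yv.
  apply/ffunP => v'; have /eqP := negbNE (h v'); rewrite ffunE !ffun_mulrz ffunE; lia.
(* The form is the 2 by 2 minor against [y]; it vanishes on [y], and on [z] it is the nonzero minor
   just found. *)
exists (fun n : G => y v * n v' - y v' * n v).
  by move=> n m; rewrite !ffunE !mulrDr opprD addrACA.
split; first by rewrite mulrC subrr.
by move=> /subr0_eq e; rewrite e eqxx in zw.
Qed.

(* Dividing by [1 + t^z] one degree at a time, from the bottom. *)
Lemma gdvd_binomial_coprime d p z f : additive_map d -> homog d 0 p -> d z <> 0 ->
  gdvd p ((1 + gt F z) * f) -> gdvd p f.
Proof.
move=> ad hp dz0 dv.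
wlog dz : d ad hp dz0 / 0 < d z.
  move=> H; case: (ltrgtP (d z) 0) => // dz; last by apply: (H d).
  apply: (H (fun n => - d n)); rewrite ?oppr_gt0 //; first exact: additive_opp.
  - by rewrite -oppr0; apply: homog_opp.
  - by move/eqP; rewrite oppr_eq0 => /eqP.
have dvc g k : gdvd p g -> gdvd p (hcomp d k g).
  by move=> [q ->]; rewrite (hcompM _ _ ad hp); exists (hcomp d (k - 0) q).
have [L hL] := low_exists d f.
have H (n : nat) : forall k, k < L + n%:Z -> gdvd p (hcomp d k f).
  elim: n => [|n IH] k kn; first by rewrite hL ?addr0 //; [exact: gdvd0|lia].
  have e : hcomp d k f = hcomp d k ((1 + gt F z) * f) - gt F z * hcomp d (k - d z) f.
    by rewrite mulrDl mul1r hcompD hcomp_gt // addrK.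
  rewrite e; apply: gdvdB; first exact: dvc.
  by apply: gdvd_mull; apply: IH; lia.
rewrite (@hcomp_sum _ _ d f (hdegs d f)) ?undup_uniq //.
apply: gdvd_sum => k _; apply: (H (`|k - L|%N.+1)); lia.
Qed.

(** If [d z = 0], the two binomials are coprime by independence. If [d z > 0], the quotient is
    computed from the bottom degree upwards: the component of degree [k - d z] is divisible by at
    least the power required in degree [k], since [nz (u + k)] decreases with [k]. *)
Lemma vgood_div u d y z f : additive_map d -> d y = 0 -> 0 <= d z ->
  (d z = 0 -> independent y z) ->
  vgood u d y ((1 + gt F z) * f) -> vgood u d y f.
Proof.
move=> ad dy dz ind vg.
case: (eqVneq (d z) 0) => [dz0|dz0].
  have [l al [ly lz]] := independent_separated (ind dz0).
  move=> k; apply: (@gdvd_binomial_coprime l _ z) => //.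
    exact: homog_binomialX.
  by have := vg k; rewrite (hcompM _ _ ad (homog_binomial ad dz0)) subr0.
have [L hL] := low_exists d f.
have H (n : nat) : forall k, k < L + n%:Z -> gdvd ((1 + gt F y) ^+ nz (u + k)) (hcomp d k f).
  elim: n => [|n IH] k kn; first by rewrite hL ?addr0 //; [exact: gdvd0|lia].
  have e : hcomp d k f = hcomp d k ((1 + gt F z) * f) - gt F z * hcomp d (k - d z) f.
    by rewrite mulrDl mul1r hcompD hcomp_gt // addrK.
  rewrite e; apply: gdvdB; first exact: vg.
  apply: gdvd_mull; apply: gdvd_exp (IH (k - d z) _); last by lia.
  by have := nzE (u + k); have := nzE (u + (k - d z)); lia.
by move=> k; apply: (H (`|k - L|%N.+1)); lia.
Qed.

(** Each of the [r] factors offers two choices. The term [1 + t^y] pays for one missing power of the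
    binomial; the term [t^z S] raises the degree by at least [d z > 0], hence lowers the required
    power by at least one. *)
Lemma vgood_binomial_power d y z S w r : additive_map d -> d y = 0 -> 0 < d z -> low d 0 S ->
  forall B j, low d j B -> - r%:Z <= w + j ->
  vgood w d y (((1 + gt F y) + gt F z * S) ^+ r * B).
Proof.
move=> ad dy dz hS; elim: r w => [|r IH] w B j hB wj.
  by rewrite expr0 mul1r; apply: vgood_low hB _; lia.
rewrite exprS -mulrA mulrDl; apply: vgoodD.
  by apply: vgoodS => //; apply: (IH _ _ j) => //; lia.
rewrite mulrCA -[gt F z * S * _]mulrA; apply: (IH _ _ (d z + (0 + j))).
  apply: lowM => //; first by apply: homog_low; exact: homog_mono.
  exact: lowM.
by lia.
Qed.

Lemma binomialX_expand d z (i : nat) : additive_map d -> 0 <= d z ->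
  exists2 S : R, low d 0 S & (1 + gt F z) ^+ i = 1 + gt F z * S.
Proof.
move=> ad dz; elim: i => [|i [S hS e]].
  by exists 0 => [k _|]; rewrite ?hcomp0 // mulr0 addr0 expr0.
exists (S + (1 + gt F z * S)).
  apply: lowD => //; apply: lowD; first by apply: homog_low; exact: homog1.
  apply: (@low_le _ (d z + 0)); first by rewrite addr0.
  by apply: lowM => //; apply: homog_low; exact: homog_mono.
by rewrite exprS e mulrDl mul1r [gt F z * (S + _)]mulrDr addrA.
Qed.

Lemma low_escale d' d z w j f : additive_map d' -> additive_map d -> 0 <= d z -> d' z = 0 ->
  low d j f -> low d j (escale d' z w f).
Proof.
move=> ad' ad dz dz' hf; rewrite /escale gscale_def; apply: low_sum => k _.
rewrite -[j]add0r; apply: lowM => //.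
  have [S hS ->] := binomialX_expand (pz (w + k)) ad dz.
  apply: lowD; first by apply: homog_low; exact: homog1.
  apply: (@low_le _ (d z + 0)); first by rewrite addr0.
  by apply: lowM => //; apply: homog_low; exact: homog_mono.
move=> l lj; apply: galgP => n; rewrite gcoef_hcomp raddf0; case: ifP => // dn.
rewrite gcoef_hcomp; case: ifP => // _.
by have := congr1 (gcoef n) (hf l lj); rewrite gcoef_hcomp dn raddf0.
Qed.

Section Exchange.
Variables (dx dv : G -> int) (y z : G).
Hypotheses (ax : additive_map dx) (av : additive_map dv).
Hypotheses (xz : dx z = 0) (vy : dv y = 0).

(** The monomial [t^y] has degree [dx y], so scaling multiplies it by an additional
    [(1 + t^z)^(dx y)] compared with the term 1. If this exponent is negative, the power is moved to
    the term 1 and the scaling of the cofactor is shifted. Either way the deviation from [1 + t^y]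
    is [t^z] times an element of nonnegative degrees. *)
Lemma escale_binomial_power q r : 0 < dv z -> exists S : R, exists N0 : nat,
  low dv 0 S /\ forall W : int, N0%:Z <= W -> exists W' : int,
  escale dx z W ((1 + gt F y) ^+ r * q) = ((1 + gt F y) + gt F z * S) ^+ r * escale dx z W' q.
Proof.
move=> vz.
have [S0 hS0 eS0] := binomialX_expand `|dx y| av (ltW vz).
have B : exists S : R, exists s : int, low dv 0 S /\
    forall Q, exists N0 : nat, forall W : int, N0%:Z <= W ->
    escale dx z W ((1 + gt F y) * Q) = ((1 + gt F y) + gt F z * S) * escale dx z (W + s) Q.
  case: (leP 0 (dx y)) => xy.
    exists (gt F y * S0), 0; split.
      by rewrite -[0]addr0; apply: lowM => //; rewrite -{1}vy; apply: homog_low; exact: homog_mono.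
    move=> Q; have [N hN] := hcomp_bound dx Q; exists N => W hW.
    rewrite mulrDl mul1r (escaleD ax xz) (escale_gt ax xz) addr0.
    have -> : W + dx y = W + `|dx y|%N%:Z by lia.
    rewrite (escale_shift ax xz) => [|k /hN]; last by lia.
    rewrite eS0 mulrA -{1}[escale dx z W Q]mul1r -mulrDl; congr (_ * _).
    by rewrite mulrDr mulr1 addrA [gt F y * (_ * _)]mulrCA.
  exists S0, (dx y); split=> // Q; have [N hN] := hcomp_bound dx Q.
  exists (N + `|dx y|)%N => W hW.
  rewrite mulrDl mul1r (escaleD ax xz) (escale_gt ax xz).
  have {1}-> : W = W + dx y + `|dx y|%N%:Z by lia.
  rewrite (escale_shift ax xz) => [|k /hN]; last by lia.
  by rewrite eS0 -mulrDl addrAC.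
have [S [s [hS hB]]] := B; exists S.
elim: r => [|r [N0 [_ IH]]].
  by exists 0%N; split=> // W _; exists W; rewrite !expr0 !mul1r.
have [N hN] := hB ((1 + gt F y) ^+ r * q).
exists (N + N0 + `|s|)%N; split=> // W hW.
have [|W' e] := IH (W + s); first by lia.
by exists W'; rewrite !exprS -!mulrA hN ?e //; lia.
Qed.

(** The power of [1 + t^y] guaranteed in degree [j] turns into the power treated in
    [vgood_binomial_power]. For [dv z = 0], the hypothesis [dx y = 0] lets [1 + t^y] pass through
    the scaling unchanged. *)
Lemma vgood_escale uv f : 0 <= dv z -> (dv z = 0 -> dx y = 0) -> vgood uv dv y f ->
  exists N0 : nat, forall W : int, N0%:Z <= W -> vgood uv dv y (escale dx z W f).
Proof.
move=> vz vz0 vg.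
have piece j : exists N0 : nat, forall W : int, N0%:Z <= W ->
    vgood uv dv y (escale dx z W (hcomp dv j f)).
  have [q0 e0] := vg j; pose q := hcomp dv j q0.
  have e : hcomp dv j f = (1 + gt F y) ^+ nz (uv + j) * q.
    have := congr1 (hcomp dv j) e0.
    by rewrite (hcompM _ _ av (homog_binomialX av vy _)) subr0 hcomp_hcomp eqxx.
  rewrite e; have hq : homog dv j q by exact: hcompK.
  case: (eqVneq (dv z) 0) => [vz'|vz'].
    have xy := vz0 vz'; exists 0%N => W _ k.
    have -> : escale dx z W ((1 + gt F y) ^+ nz (uv + j) * q)
            = (1 + gt F y) ^+ nz (uv + j) * escale dx z W q.
      elim: (nz _) => [|r IH]; first by rewrite !expr0 !mul1r.
      by rewrite !exprS -!mulrA mulrDl mul1r (escaleD ax xz) (escale_gt ax xz) xy addr0 IH mulrDl mul1r.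
    rewrite (hcompM _ _ av (homog_binomialX av vy _)) subr0.
    have hE : homog dv j (escale dx z W q).
      rewrite /homog /escale (hcomp_gscale_degree (l := 0) (c := fun=> 0)) //.
      - by rewrite subr0 hq.
      - by move=> l; exact: homog_binomialX.
    case: (eqVneq k j) => [->|kj]; first by exists (hcomp dv j (escale dx z W q)).
    by rewrite (homog_neq hE) // mulr0; apply: gdvd0.
  have [|S [N0 [hS h]]] := escale_binomial_power q (nz (uv + j)).
    by rewrite lt_neqAle eq_sym vz'.
  exists N0 => W hW; have [W' ->] := h W hW.
  have vz1 : 0 < dv z by rewrite lt_neqAle eq_sym vz'.
  apply: (vgood_binomial_power av vy vz1 hS (low_escale _ ax av vz xz (homog_low hq))).
  by have := nzE (uv + j); lia.
have [N0 h] : exists N0 : nat, forall W : int, N0%:Z <= W -> forall j, j \in hdegs dv f ->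
    vgood uv dv y (escale dx z W (hcomp dv j f)).
  elim: (hdegs dv f) => [|j s [N1 h1]]; first by exists 0%N.
  have [N2 h2] := piece j; exists (N1 + N2)%N => W hW i.
  by rewrite inE => /orP[/eqP->|]; [apply: h2|apply: h1]; lia.
exists N0 => W hW.
rewrite (@hcomp_sum _ _ dv f (hdegs dv f)) ?undup_uniq // (escale_sum ax xz) big_seq.
by apply: vgood_sum => j; apply: h.
Qed.

(** Denominators are cleared, [vgood_escale] applies, and the powers of [1 + t^z] are divided off
    again; independence enters in this division. *)
Lemma vgood_exchange ux uv f f' : 0 <= dv z -> (dv z = 0 -> dx y = 0) ->
  (dv z = 0 -> independent y z) -> mutrel ux dx z f f' ->
  vgood uv dv y f -> vgood uv dv y f'.
Proof.
move=> vz vz0 ind hm vg.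
have [N1 h1] := mutrel_escale ax xz hm; have [N2 h2] := vgood_escale vz vz0 vg.
have : vgood uv dv y ((1 + gt F z) ^+ (N1 + N2 + `|ux|) * f').
  by rewrite h1; [apply: h2|]; lia.
elim: (N1 + N2 + _)%N => [|r IH]; first by rewrite expr0 mul1r.
by rewrite exprS -mulrA => /(vgood_div av vy vz ind).
Qed.

End Exchange.

(* For a negative degree of [z], exchange along [- z] and shear. *)
Lemma vgood_exchange_neg dx dv y z ux uv f f' :
  additive_map dx -> additive_map dv -> dx z = 0 -> dv y = 0 -> dv z < 0 ->
  mutrel ux dx z f f' -> vgood uv dv y f ->
  vgood (uv - dv z * ux) (fun n => dv n - dv z * dx n) (y + z *~ dx y) f'.
Proof.
move=> ax av xz vy vz hm vg.
have xzn : dx (- z) = 0 by rewrite amN // xz oppr0.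
have vzn : 0 < dv (- z) by rewrite amN // oppr_gt0.
have [fm hfm] := vgood_mutrel ax xzn (vgoodN (mutrel_vgood hm)).
have vgm : vgood uv dv y fm.
  apply: (vgood_exchange ax av xzn vy _ _ _ hfm vg); first exact: ltW.
  - by move=> e; rewrite e in vzn.
  - by move=> e; rewrite e in vzn.
pose P k : R := gt F (z *~ (ux + k)).
have hP k : homog dx 0 (P k).
  by have := homog_mono (F := F) dx (z *~ (ux + k)) 1; rewrite amMz // xz mul0rz.
have z0 : z != 0 by apply/eqP => e; rewrite e am0 // ltxx in vz.
have ef : f' = gscale dx P fm.
  apply: (@hcomp_ext _ _ dx) => k; rewrite (hcomp_gscale ax hP).
  apply: (@galg_mulI _ _ ((1 + gt F z) ^+ nz (ux + k))).
    by apply: galg_exp_neq0; apply: binomial_neq0.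
  rewrite hm; have := hfm k; have e : 1 + gt F z = gt F z * (1 + gt F (- z)).
    by rewrite mulrDr mulr1 gtK addrC.
  rewrite e !exprMn => ek; rewrite mulrACA ek mulrA; congr (_ * _); congr (_ * _).
  have tX (i : nat) : gt F z ^+ i = gt F (z *~ i%:Z).
    elim: i => [|i IH]; first by rewrite expr0 mulr0z gt0.
    by rewrite exprS IH -gtD -{1}[z]mulr1z -mulrzDr.
  rewrite !tX /P -gtD -mulrzDr; congr (gt F (z *~ _)).
  by have := nzE (ux + k); have := pzE (ux + k); lia.
pose D n := dv n - dv z * dx n.
have aD : additive_map D by move=> n m; rewrite /D ax av; lia.
have DP k : homog D (dv z * (ux + k)) (P k).
  have := homog_mono (F := F) D (z *~ (ux + k)) 1.
  by rewrite amMz // /D xz mulr0 subr0 -mulrzz.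
move=> K.
have eH : hcomp D K f' = gscale dx P (hcomp dv (K - dv z * ux) fm).
  rewrite ef; apply: (@hcomp_ext _ _ dx) => k.
  have comm (g : R) (a b : int) : hcomp dx a (hcomp D b g) = hcomp D b (hcomp dx a g).
    by apply: galgP => n; rewrite !gcoef_hcomp; case: ifP; case: ifP.
  rewrite comm !(hcomp_gscale ax hP) (hcompM _ _ aD (DP k)); congr (_ * _).
  apply: galgP => n; rewrite !gcoef_hcomp; case: (eqVneq (dx n) k) => [e|]; last by rewrite !if_same.
  by congr (if _ then _ else _); rewrite /D e; apply/eqP/eqP; lia.
rewrite -/D eH; have [q ->] := vgm (K - dv z * ux).
have -> : uv + (K - dv z * ux) = uv - dv z * ux + K by lia.
elim: (nz _) => [|r IH]; first by rewrite expr0; apply: gdvd1.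
rewrite !exprS -!mulrA [(1 + gt F y) * _]mulrDl mul1r (gscaleD ax hP) (gscale_gt ax hP).
set Q := _ * q in IH *.
have -> : gscale dx (fun k => P (k + dx y)) Q = gt F (z *~ dx y) * gscale dx P Q.
  rewrite !gscale_def mulr_sumr; apply: eq_bigr => k _.
  by rewrite mulrA -gtD -mulrzDr; congr (gt F (z *~ _) * _); lia.
rewrite mulrA -gtD -{1}[gscale dx P Q]mul1r -mulrDl.
exact: gdvd_mul (gdvd_refl _) IH.
Qed.

End Transport.

(** * Mutation of seeds and of their lattices *)

Lemma pospN (b : int) : posp b - posp (- b) = b.
Proof. rewrite /posp; lia. Qed.

Lemma posp_ge0 (b : int) : 0 <= posp b.
Proof. rewrite /posp; lia. Qed.

Lemma pospE (b : int) : posp b = if 0 <= b then b else 0.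
Proof. rewrite /posp; case: leP; lia. Qed.

Section Seeds.
Variables (V : finType) (W : zmodType).
Local Notation seed := (seed V W).
Implicit Types (S : seed) (x y v : V).

Definition skew S := forall u v, quiver S u v = - quiver S v u.
Definition balanced S := forall v, \sum_u weight S u *~ quiver S u v = 0.

Lemma skew_diag S v : skew S -> quiver S v v = 0.
Proof. by move=> sk; have := sk v v; lia. Qed.

Lemma balanced_out S v : skew S -> balanced S -> \sum_u weight S u *~ quiver S v u = 0.
Proof.
move=> sk ba; have := ba v; rewrite (eq_bigr (fun u => - (weight S u *~ quiver S v u))).
  by rewrite sumrN => /eqP; rewrite oppr_eq0 => /eqP.
by move=> u _; rewrite sk mulrNz.
Qed.

Lemma balanced_in_out S x : skew S -> balanced S ->
  \sum_u weight S u *~ posp (quiver S u x) = \sum_u weight S u *~ posp (quiver S x u).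
Proof.
move=> sk ba; apply/eqP; rewrite -subr_eq0 -sumrB; apply/eqP.
rewrite -[RHS](ba x); apply: eq_bigr => u _.
by rewrite -mulrzBr (sk x u) pospN.
Qed.

Lemma mutate_weight S x : weight (mutate x S) x =
  - weight S x + \sum_u weight S u *~ posp (quiver S u x).
Proof. by rewrite /= eqxx. Qed.

Lemma mutate_weight_neq S x v : v != x -> weight (mutate x S) v = weight S v.
Proof. by move=> /negbTE h; rewrite /= h. Qed.

Lemma mutate_quiver_l S x v : quiver (mutate x S) x v = - quiver S x v.
Proof. by rewrite /= eqxx. Qed.

Lemma mutate_quiver_r S x v : quiver (mutate x S) v x = - quiver S v x.
Proof. by rewrite /= eqxx orbT. Qed.

Lemma mutate_skew S x : skew S -> skew (mutate x S).
Proof.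
move=> sk u v; rewrite /= orbC; case: ifP => _; first by rewrite sk.
by rewrite (sk u v) (sk v x) (sk x u) (sk u x) !opprK; lia.
Qed.

(** In this form the new exchange matrix is the old one after the base change [mut_family] in both
    indices. *)
Lemma mutate_quiverE S x u v : skew S -> u != x -> v != x ->
  quiver (mutate x S) u v = quiver S u v
    + posp (quiver S x v) * quiver S u x + posp (quiver S x u) * quiver S x v.
Proof.
move=> sk /negbTE ux /negbTE vx; rewrite /= ux vx /= (sk u x) (sk v x) !pospE.
set a := quiver S x u; set b := quiver S x v.
by case: (leP 0 a); case: (leP 0 b); case: (leP 0 (- a)); case: (leP 0 (- b)); nia.
Qed.

Lemma big_split_at (E : V -> W) x : \sum_u E u = E x + \sum_(u | u != x) E u.
Proof. by rewrite (bigD1 x). Qed.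

Lemma mutate_balanced S x : skew S -> balanced S -> balanced (mutate x S).
Proof.
move=> sk ba v; rewrite (big_split_at _ x) mutate_quiver_l.
have s2 : \sum_(u | u != x) weight S u *~ quiver S u x = 0.
  by have := ba x; rewrite (bigD1 x) //= skew_diag // mulr0z add0r.
case: (eqVneq v x) => [->|vx].
  rewrite skew_diag // oppr0 mulr0z add0r -[RHS]oppr0 -[X in _ = - X]s2 -sumrN.
  by apply: eq_bigr => u ux; rewrite mutate_weight_neq // mutate_quiver_r mulrNz.
have e u : u != x -> (weight (mutate x S) u) *~ quiver (mutate x S) u v =
   weight S u *~ quiver S u v + (weight S u *~ quiver S u x) *~ posp (quiver S x v)
   + (weight S u *~ posp (quiver S x u)) *~ quiver S x v.
  move=> ux; rewrite mutate_weight_neq // mutate_quiverE // !mulrzDr -!mulrzA.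
  by rewrite [posp (quiver S x v) * _]mulrC.
rewrite mutate_weight (eq_bigr _ e) !big_split /= -!mulrz_suml.
have s1 : \sum_(u | u != x) weight S u *~ quiver S u v = - (weight S x *~ quiver S x v).
  by apply/eqP; rewrite -addr_eq0 addrC -(bigD1 x (P := predT)) //= ba.
have s3 : \sum_(u | u != x) weight S u *~ posp (quiver S x u)
    = \sum_u weight S u *~ posp (quiver S u x).
  by rewrite balanced_in_out // [RHS](bigD1 x) //= skew_diag // /posp maxxx mulr0z add0r.
rewrite s1 s2 s3 mul0rz addr0 mulrNz mulrzDl mulNrz opprD opprK.
by rewrite addrACA subrr add0r addNr.
Qed.

Lemma seed_eq S S' : (forall u v, quiver S u v = quiver S' u v) ->
  (forall v, weight S v = weight S' v) -> S = S'.
Proof.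
case: S S' => [q w] [q' w'] /= hq hw; congr Seed.
  by apply: functional_extensionality => u; apply: functional_extensionality => v.
by apply: functional_extensionality => v.
Qed.

(** Weights are mutated with the incoming arrows. The second mutation sees the former outgoing
    arrows as incoming ones, and the balance condition equates the two sums. *)
Lemma mutateK S x : skew S -> balanced S -> mutate x (mutate x S) = S.
Proof.
move=> sk ba; have sk' := mutate_skew x sk; apply: seed_eq => [u v|v].
  case: (eqVneq u x) => [->|ux]; first by rewrite !mutate_quiver_l opprK.
  case: (eqVneq v x) => [->|vx]; first by rewrite !mutate_quiver_r opprK.
  rewrite (mutate_quiverE sk') // (mutate_quiverE sk) // !mutate_quiver_l mutate_quiver_r.
  rewrite (sk u x) !pospE; set a := quiver S x u; set b := quiver S x v.
  by case: (leP 0 a); case: (leP 0 b); case: (leP 0 (- a)); case: (leP 0 (- b)); nia.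
case: (eqVneq v x) => [->|vx]; last by rewrite !mutate_weight_neq.
rewrite !mutate_weight opprD opprK -addrA.
suff -> : \sum_u weight (mutate x S) u *~ posp (quiver (mutate x S) u x)
    = \sum_u weight S u *~ posp (quiver S u x) by rewrite addNr addr0.
rewrite balanced_in_out //; last exact: mutate_balanced.
rewrite (big_split_at _ x) [RHS](big_split_at _ x) mutate_quiver_l !skew_diag // oppr0.
rewrite /posp maxxx !mulr0z !add0r; apply: eq_bigr => u ux.
by rewrite mutate_weight_neq // mutate_quiver_l (sk x u) opprK.
Qed.

End Seeds.

Section MutFamily.
Variables (V : finType) (W : zmodType).
Implicit Types (S : seed V W) (x v : V).

(** The change of basis of the seed lattice under mutation at [x]. It is applied to the exchange
    vectors, to the degrees and to the exponents [u]; with the matrix of [S] kept fixed, it is its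
    own inverse. *)
Definition mut_family S x (A : zmodType) (g : V -> A) v : A :=
  if v == x then - g x else g v + g x *~ posp (quiver S x v).

Lemma mut_family_at S x (A : zmodType) (g : V -> A) : mut_family S x g x = - g x.
Proof. by rewrite /mut_family eqxx. Qed.

Lemma mut_family_neq S x (A : zmodType) (g : V -> A) v : v != x ->
  mut_family S x g v = g v + g x *~ posp (quiver S x v).
Proof. by rewrite /mut_family => /negbTE ->. Qed.

Lemma mut_familyK S x (A : zmodType) (g : V -> A) v :
  mut_family S x (mut_family S x g) v = g v.
Proof.
rewrite {1}/mut_family !mut_family_at; case: eqP => [->|/eqP vx]; first by rewrite opprK.
by rewrite mut_family_neq // mulNrz addrK.
Qed.

Lemma mut_family_sum S x (A : zmodType) (g : V -> A) (n : V -> int) : skew S ->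
  \sum_v mut_family S x g v *~ n v =
  \sum_v g v *~ (if v == x then - n x + \sum_w n w * posp (quiver S x w) else n v).
Proof.
move=> sk; rewrite (bigD1 x) //= [RHS](bigD1 x) //= mut_family_at eqxx.
rewrite (eq_bigr (fun v => g v *~ n v + g x *~ (n v * posp (quiver S x v)))).
  rewrite big_split /= [X in _ = _ + X](eq_bigr (fun v => g v *~ n v)).
    rewrite mulrzDr mulrNz mulNrz -addrA; congr (_ + _); rewrite addrC; congr (_ + _).
    rewrite [in RHS](bigD1 x) //= skew_diag // /posp maxxx mulr0 add0r.
    by rewrite mulrz_sumr.
  by move=> v /negbTE ->.
move=> v vx; rewrite mut_family_neq // mulrzDl; congr (_ + _).
by rewrite -mulrzA mulrC.
Qed.

(** Weights transform contragrediently to families, so the total weight of a monomial does not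
    change. *)
Lemma mut_family_pair S x (n : V -> int) : skew S -> balanced S ->
  \sum_v weight (mutate x S) v *~ mut_family S x n v = \sum_v weight S v *~ n v.
Proof.
move=> sk ba; rewrite (big_split_at _ x) [RHS](big_split_at _ x) mut_family_at mutate_weight.
rewrite balanced_in_out // [X in _ + X = _](eq_bigr (fun v =>
    weight S v *~ n v + weight S v *~ posp (quiver S x v) *~ n x)); last first.
  move=> v vx; rewrite mut_family_neq // mutate_weight_neq // mulrzDr; congr (_ + _).
  by rewrite mulrzz mulrC mulrzA.
rewrite big_split /= mulrNz mulrzDl mulNrz opprD opprK -addrA; congr (_ + _).
rewrite (big_split_at _ x) skew_diag // /posp maxxx mulr0z add0r mulrz_suml addrCA.
by rewrite addNr addr0.
Qed.

End MutFamily.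

Lemma eq_vgood (F : fieldType) (V : finType) u u' (d d' : {ffun V -> int} -> int) y y' (f : galg F _) :
  u = u' -> d =1 d' -> y = y' -> vgood u d y f -> vgood u' d' y' f.
Proof.
move=> <- ed <- h k; rewrite (_ : hcomp d' k f = hcomp d k f); first exact: h.
by apply: eq_gres => n; rewrite ed.
Qed.

(** * Potentials of a seed *)

Section Potential.
Variables (F : fieldType) (V : finType) (W : zmodType).
Local Notation G := {ffun V -> int}.
Local Notation R := (galg F G).
Implicit Types (S : seed V W) (phi : W -> int) (alpha : W).
Implicit Types (e : V -> G) (d : V -> G -> int) (u : V -> int) (f g h : R).

(* The exchange binomial at [v] is [1 + t^(e v)], and [d v] is the grading that
   decides the exponent of this binomial in the exchange at [v].  The only
   relations between the vectors [e v] are the multiples of [phi] of the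
   weights. *)
Record frame S phi e d : Prop := {
  frame_additive : forall v, additive_map (d v);
  frame_quiver : forall v w, d v (e w) = quiver S v w;
  frame_balanced : forall n, \sum_v weight S v *~ d v n = 0;
  frame_rel : \sum_v e v *~ phi (weight S v) = 0;
  frame_ker : forall n : V -> int, \sum_v e v *~ n v = 0 ->
    exists c, forall v, n v = c * phi (weight S v) }.

Definition vregular e d u f := forall v, vgood (u v) (d v) (e v) f.

(** Since [u v + d v n] is the exponent of the cluster variable of [v] in [x^u t^n], a unit is a
    scalar multiple of a monomial that involves no cluster variable. *)
Definition vunit d u f := exists n c, [/\ c != 0, f = gmono n c & forall v, u v + d v n = 0].

(* A potential is an element which stays polynomial after one exchange in every
   direction.  It is semi-invariant of weight [- alpha], and irreducible among
   such elements.  Since only one exchange in each direction is involved, these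
   properties can be transported along a mutation. *)
Record potential_data S phi alpha e d u f : Prop := {
  pot_frame : frame S phi e d;
  pot_neq0 : f != 0;
  pot_weight : \sum_v weight S v *~ u v = - alpha;
  pot_regular : vregular e d u f;
  pot_irreducible : forall u1 u2 g h, vregular e d u1 g -> vregular e d u2 h ->
    (forall v, u1 v + u2 v = u v) -> g * h = f -> vunit d u1 g \/ vunit d u2 h }.

Definition potential S phi alpha := exists e d u f, potential_data S phi alpha e d u f.

Definition unsupported phi S := forall v, ~ forall w, w != v -> phi (weight S w) = 0.

Definition mut_degree S x d v : G -> int := fun n => mut_family S x (fun v => d v n) v.

Lemma phi_mutate S phi x : additive_map phi -> skew S -> balanced S -> 
  phi (weight (mutate x S) x) = - phi (weight S x)
    + \sum_w phi (weight S w) * posp (quiver S x w).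
Proof.
move=> ap sk ba; rewrite mutate_weight balanced_in_out // ap amN // am_sum //.
by congr (_ + _); apply: eq_bigr => w _; rewrite amMz // mulrzz.
Qed.

(** The relation between the exchange vectors transforms by the transpose of the base change, which
    is the mutation rule for the values [phi (weight S v)]; its uniqueness is carried over in the
    same way. *)
Lemma frame_mutate S phi e d x : additive_map phi -> skew S -> balanced S ->
  frame S phi e d -> frame (mutate x S) phi (mut_family S x e) (mut_degree S x d).
Proof.
move=> ap sk ba fr; have [ad qu fb rel ker] := fr.
have aux (n : V -> int) : \sum_v mut_family S x e v *~ n v = \sum_v e v *~
    (if v == x then - n x + \sum_w n w * posp (quiver S x w) else n v).
  exact: mut_family_sum.
split.
- move=> v n m; rewrite /mut_degree /mut_family; case: eqP => _.
    by rewrite ad opprD.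
  by rewrite !ad mulrzDl addrACA.
- move=> v w; rewrite /mut_degree.
  case: (eqVneq v x) => [->|vx].
    rewrite mut_family_at mutate_quiver_l; case: (eqVneq w x) => [->|wx].
      by rewrite mut_family_at (amN (ad _)) qu skew_diag.
    by rewrite mut_family_neq // ad (amMz (ad _)) !qu (skew_diag x sk) mul0rz addr0.
  rewrite (mut_family_neq _ _ vx); case: (eqVneq w x) => [->|wx].
    by rewrite mut_family_at !(amN (ad _)) !qu mutate_quiver_r (skew_diag x sk) oppr0 mul0rz addr0. 
  rewrite mut_family_neq // !ad !(amMz (ad _)) !qu (skew_diag x sk) mul0rz addr0 !mulrzz.
  by rewrite mutate_quiverE // (mulrC (posp (quiver S x v))) (mulrC (posp (quiver S x w))).
- by move=> n; rewrite /mut_degree mut_family_pair.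
- rewrite aux -[RHS]rel; apply: eq_bigr => v _; congr (_ *~ _).
  case: eqP => [->|/eqP vx]; last by rewrite mutate_weight_neq.
  rewrite phi_mutate // opprD opprK -addrA -[RHS]addr0; congr (_ + _); apply/eqP.
  rewrite addrC subr_eq0; apply/eqP.
  rewrite (bigD1 x) // [RHS](bigD1 x) // skew_diag // /posp maxxx !mulr0; congr (_ + _).
  by apply: eq_bigr => w wx; rewrite mutate_weight_neq.
- move=> n; rewrite aux => /ker[c hc]; exists c => v.
  have hv w : w != x -> n w = c * phi (weight S w) by move=> wx; rewrite -hc (negbTE wx).
  case: (eqVneq v x) => [->|vx]; last by rewrite mutate_weight_neq // hv.
  have := hc x; rewrite eqxx phi_mutate // => hx.
  have e1 : \sum_w n w * posp (quiver S x w) =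
      c * \sum_w phi (weight S w) * posp (quiver S x w).
    rewrite mulr_sumr; apply: eq_bigr => w _; case: (eqVneq w x) => [->|wx].
      by rewrite skew_diag // /posp maxxx !mulr0.
    by rewrite hv // mulrA.
  by move: hx; rewrite e1 mulrDr; lia.
Qed.

Section Step.
Variables (S : seed V W) (phi : W -> int) (x : V) (e : V -> G) (d : V -> G -> int).
Hypotheses (sk : skew S) (fr : frame S phi e d).
Hypothesis ind : forall v, v != x -> quiver S v x = 0 -> independent (e v) (e x).

Let ad := frame_additive fr.
Let qu := frame_quiver fr.

Lemma frame_diag v : d v (e v) = 0.
Proof. by rewrite qu skew_diag. Qed.

(** The sign of [d v (e x)] decides between a plain exchange and an exchange along [- e x] followed
    by a shear. The shear is exactly what [mut_family] does to the data of [v]. *)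
Lemma vregular_mutate u f f' : mutrel (u x) (d x) (e x) f f' -> vregular e d u f ->
  vregular (mut_family S x e) (mut_degree S x d) (mut_family S x u) f'.
Proof.
move=> hm hf v; case: (eqVneq v x) => [->|vx].
  apply: (eq_vgood _ _ _ (vgoodN (mutrel_vgood' hm))); rewrite ?mut_family_at //.
  by move=> n; rewrite /mut_degree mut_family_at.
case: (leP 0 (d v (e x))) => hv.
  have p0 : posp (quiver S x v) = 0 by rewrite sk -qu /posp; lia.
  apply: (eq_vgood _ _ _ (vgood_exchange (ad x) (ad v) (frame_diag x) (frame_diag v) hv _ _ hm (hf v))).
  - by rewrite mut_family_neq // p0 mulr0z addr0.
  - by move=> n; rewrite /mut_degree mut_family_neq // p0 mulr0z addr0.
  - by rewrite mut_family_neq // p0 mulr0z addr0.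
  - by rewrite !qu sk; lia.
  - by rewrite qu => q0; apply: ind.
have p0 : posp (quiver S x v) = - d v (e x) by rewrite sk -qu /posp; lia.
apply: (eq_vgood _ _ _ (vgood_exchange_neg (ad x) (ad v) (frame_diag x) (frame_diag v) hv hm (hf v))).
- by rewrite mut_family_neq // p0 mulrzz; lia.
- by move=> n; rewrite /mut_degree mut_family_neq // p0 mulrzz; lia.
- by rewrite mut_family_neq // p0 !qu sk.
Qed.

Lemma vregular_unmutate u f f' : mutrel (u x) (d x) (e x) f f' ->
  vregular (mut_family S x e) (mut_degree S x d) (mut_family S x u) f' -> vregular e d u f.
Proof.
move=> hm hf v; case: (eqVneq v x) => [->|vx]; first exact: mutrel_vgood hm.
have hms := mutrel_sym hm.
have ax : additive_map (fun n => - d x n) by apply: additive_opp.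
have av : additive_map (mut_degree S x d v).
  by move=> n m; rewrite /mut_degree !mut_family_neq // !ad mulrzDl addrACA.
have xz : - d x (e x) = 0 by rewrite frame_diag oppr0.
have ez : mut_degree S x d v (e x) = quiver S v x.
  by rewrite /mut_degree mut_family_neq // !qu (skew_diag x sk) mul0rz addr0.
have ey : mut_family S x e v = e v + e x *~ posp (quiver S x v) by rewrite mut_family_neq.
have xy : d x (mut_family S x e v) = quiver S x v.
  by rewrite ey ad (amMz (ad _)) frame_diag mul0rz addr0 qu.
have vy : mut_degree S x d v (mut_family S x e v) = 0.
  rewrite /mut_degree mut_family_neq // xy ey !ad (amMz (ad _)) frame_diag add0r qu.
  by rewrite (sk v x) mulNrz addNr.
case: (leP 0 (mut_degree S x d v (e x))) => hv.
  have p0 : posp (quiver S x v) = 0 by move: hv; rewrite ez sk /posp; lia.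
  apply: (eq_vgood _ _ _ (vgood_exchange ax av xz vy hv _ _ hms (hf v))).
  - by rewrite mut_family_neq // p0 mulr0z addr0.
  - by move=> n; rewrite /mut_degree mut_family_neq // p0 mulr0z addr0.
  - by rewrite mut_family_neq // p0 mulr0z addr0.
  - by rewrite ez xy => q; rewrite sk q.
  - by rewrite ez ey p0 mulr0z addr0 => q0; apply: ind.
have p0 : posp (quiver S x v) = - quiver S v x by move: hv; rewrite ez sk /posp; lia.
apply: (eq_vgood _ _ _ (vgood_exchange_neg ax av xz vy hv hms (hf v))).
- by rewrite mut_family_neq // p0 ez mulrzz; lia.
- by move=> n; rewrite ez /mut_degree mut_family_neq // p0 mulrzz; lia.
- by rewrite xy ey p0 (sk x v) opprK -addrA -mulrzDr addNr mulr0z addr0.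
Qed.

End Step.

(** A relation between two exchange vectors is a multiple of the only relation, whose coefficients
    are the values of [phi]. *)
Lemma frame_dependent S phi e d v x (i j : int) : frame S phi e d -> v != x ->
  e v *~ i + e x *~ j = 0 -> ~ (i = 0 /\ j = 0) ->
  forall w, w != v -> w != x -> phi (weight S w) = 0.
Proof.
move=> fr vx ez nz w wv wx; have xv : (x == v) = false by rewrite eq_sym (negbTE vx).
have [|c hc] := frame_ker fr (n := fun w => i *+ (w == v) + j *+ (w == x)).
  rewrite (bigD1 v) //= (bigD1 x) /= ?xv // big1 => [|y /andP[/negbTE -> /negbTE ->]].
    by rewrite !eqxx (negbTE vx) !mulr1n !mulr0n !addr0 add0r.
  by rewrite !mulr0n addr0 mulr0z.
have := hc w; rewrite (negbTE wv) (negbTE wx) addr0 => /esym/eqP; rewrite mulf_eq0.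
case/orP => [/eqP c0|/eqP //]; case: nz; move: (hc v) (hc x).
by rewrite c0 !mul0r !eqxx (negbTE vx) xv addr0 add0r.
Qed.

Lemma frame_neq0 S phi e d x : frame S phi e d -> unsupported phi S -> e x != 0.
Proof.
move=> fr ns; apply/eqP => ex0; apply: (ns x) => w wx.
have [|c hc] := frame_ker fr (n := fun w => (w == x)%:R).
  rewrite (bigD1 x) //= eqxx mulr1z ex0 add0r big1 // => y /negbTE ->.
  by rewrite mulr0z.
have := hc w; rewrite (negbTE wx) => /esym/eqP; rewrite mulf_eq0.
case/orP => [/eqP c0|/eqP //]; have := hc x; rewrite c0 mul0r eqxx; lia.
Qed.

(** Dependence would confine [phi] to [v] and [x]. As no arrow joins them, mutation at [x] changes
    the sign of the value at [x]; being nonnegative before and after, this value is 0, and [phi]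
    would live on [v] alone. *)
Lemma frame_independent S phi e d v x : additive_map phi -> skew S -> balanced S ->
  frame S phi e d -> unsupported phi S ->
  (forall w, 0 <= phi (weight S w)) -> (forall w, 0 <= phi (weight (mutate x S) w)) ->
  v != x -> quiver S v x = 0 -> independent (e v) (e x).
Proof.
move=> ap sk ba fr ns p0 p1 vx q0 i j ez.
suff : ~ ~ (i = 0 /\ j = 0) by lia.
move=> nz; have h := frame_dependent fr vx ez nz.
have sx : phi (weight S x) = 0.
  have := p1 x; have := p0 x; rewrite phi_mutate // big1; first by lia.
  move=> w _; case: (eqVneq w x) => [->|wx]; first by rewrite skew_diag // /posp maxxx mulr0.
  case: (eqVneq w v) => [->|wv]; last by rewrite h // mul0r.
  by rewrite sk q0 oppr0 /posp maxxx mulr0.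
by apply: (ns v) => w wv; case: (eqVneq w x) => [->|wx] //; apply: h.
Qed.

Lemma mutrel_gmono (i : int) (D : G -> int) (z n : G) (c : F) : z != 0 -> i + D n = 0 -> additive_map D -> D z = 0 ->
  forall g, mutrel i D z (gmono n c) g -> g = gmono n c.
Proof.
move=> z0 un aD dz g hg; apply: (mutrel_uniq z0 hg) => k.
case: (eqVneq k (D n)) => [->|kn]; first by rewrite un.
by rewrite (homog_neq (homog_mono D n c)) // !mulr0.
Qed.

(** A factorization of the exchanged element is pulled back by the inverse exchange, which preserves
    regularity and products. A unit passes through the exchange unchanged, because its exponent at
    [x] is 0. *)
Theorem potential_mutate S phi alpha x : additive_map phi -> skew S -> balanced S ->
  unsupported phi S ->
  (forall w, 0 <= phi (weight S w)) -> (forall w, 0 <= phi (weight (mutate x S) w)) ->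
  potential S phi alpha -> potential (mutate x S) phi alpha.
Proof.
move=> ap sk ba ns p0 p1 [e [d [u [f [fr f0 wt reg irr]]]]].
have ind v : v != x -> quiver S v x = 0 -> independent (e v) (e x).
  exact: (frame_independent ap sk ba fr ns p0 p1).
have ad := frame_additive fr; have ex := frame_neq0 x fr ns; have dx := frame_diag sk fr x.
have [f' hm] := vgood_mutrel (ad x) dx (reg x).
exists (mut_family S x e), (mut_degree S x d), (mut_family S x u), f'; split.
- exact: frame_mutate.
- apply/eqP => f'0; case/eqP: f0; apply: (mutrel_uniq ex (mutrel_sym hm)) => k.
  by rewrite f'0 !hcomp0 !mulr0.
- by rewrite mut_family_pair.
- exact: (vregular_mutate sk fr ind hm reg).
- move=> u1 u2 g' h' rg rh uu gh.
  have back u0 g0 : vregular (mut_family S x e) (mut_degree S x d) u0 g0 ->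
     exists g, mutrel (mut_family S x u0 x) (d x) (e x) g g0.
    move=> /(_ x) r; have [g hg] : exists g, mutrel (u0 x) (fun n => - d x n) (e x) g0 g.
      apply: vgood_mutrel; rewrite ?dx ?oppr0 //; first exact: additive_opp.
      have /vgoodN := r; rewrite mut_family_at opprK; apply: eq_vgood => // n.
      by rewrite /mut_degree mut_family_at.
    exists g => k; have := mutrel_sym hg k; rewrite mut_family_at.
    by rewrite /hcomp; under eq_gres do rewrite opprK; under [in X in _ = X -> _]eq_gres do rewrite opprK.
  have inv u0 v : u0 v = mut_family S x (mut_family S x u0) v by rewrite mut_familyK.
  have reg_back u0 g0 g : vregular (mut_family S x e) (mut_degree S x d) u0 g0 ->
     mutrel (mut_family S x u0 x) (d x) (e x) g g0 ->
     vregular e d (mut_family S x u0) g.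
    move=> r hg; apply: (vregular_unmutate sk fr ind hg) => v; rewrite -inv; exact: r.
  have unit_back u0 g0 g : mutrel (mut_family S x u0 x) (d x) (e x) g g0 ->
     vunit d (mut_family S x u0) g -> vunit (mut_degree S x d) u0 g0.
    move=> hg [n [c [c0 eg hu]]]; exists n, c; split=> //.
      rewrite eg in hg; exact: (mutrel_gmono ex (hu x) (ad x) dx hg).
    move=> v; have hx := hu x; rewrite /mut_degree; case: (eqVneq v x) => [->|vx].
      by move: hx; rewrite !mut_family_at; lia.
    have := hu v; rewrite !(mut_family_neq _ _ vx) (_ : d x n = u0 x); first by lia.
    by move: hx; rewrite mut_family_at; lia.
  have [g hg] := back _ _ rg; have [h hh] := back _ _ rh.
  case: (irr (mut_family S x u1) (mut_family S x u2) g h).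
  + exact: reg_back rg hg.
  + exact: reg_back rh hh.
  + move=> v; have := uu x; rewrite mut_family_at => ux; case: (eqVneq v x) => [->|vx].
      by rewrite !mut_family_at; lia.
    have := uu v; rewrite !(mut_family_neq _ _ vx) !mulrzz (_ : u x = - (u1 x + u2 x)); last lia.
    by rewrite mulNr mulrDl; lia.
  + apply: esym; apply: (mutrelM (additive_opp (ad x)) _ ex (mutrel_sym hg) (mutrel_sym hh)).
      by rewrite dx oppr0.
    rewrite gh; have := mutrel_sym hm; congr (mutrel _ _ _ _ _).
    by rewrite !mut_family_at !opprK uu mut_family_at.
  + by move=> /(unit_back _ _ _ hg); left.
  + by move=> /(unit_back _ _ _ hh); right.
Qed.

End Potential.

Section Potential.
Variables (F : fieldType) (V : finType) (W : zmodType).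
Local Notation G := {ffun V -> int}.
Local Notation R := (galg F G).
Implicit Types (S : seed V W) (phi : W -> int) (alpha : W).
Implicit Types (e : V -> G) (d : V -> G -> int) (u : V -> int) (f g h : R).

Lemma sum_supp2 (A : zmodType) (E : V -> A) x y : x != y ->
  (forall v, v != x -> v != y -> E v = 0) -> \sum_v E v = E x + E y.
Proof.
move=> xy h; rewrite (bigD1 x) //= (bigD1 y) /= 1?eq_sym // big1 ?addr0 //.
by move=> v /andP[vx vy]; apply: h.
Qed.

(** The exchange vectors and the degrees of [x] and [y] are opposite to each other. This forces the
    potential to be divisible by the exchange binomial, so by irreducibility it is, up to a unit,
    the new variable of [x] divided by the variable of [y]; the conclusion compares weights. *)
Lemma potential_exchange S phi alpha x y : additive_map phi -> skew S -> balanced S ->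
  phi alpha = 2 -> x != y -> phi (weight S x) = 1 -> phi (weight S y) = 1 ->
  (forall v, v != x -> v != y -> phi (weight S v) = 0) ->
  potential F S phi alpha -> weight (mutate x S) x - weight S y = - alpha.
Proof.
move=> ap sk ba pa xy px py p0 [e [d [u [f [fr f0 wt reg irr]]]]].
have ad := frame_additive fr.
have ey : e y = - e x.
  have := frame_rel fr; rewrite (sum_supp2 xy) => [|v vx vy]; last by rewrite p0.
  by rewrite px py !mulr1z => /eqP; rewrite addrC addr_eq0 => /eqP.
have dy n : d y n = - d x n.
  have := congr1 phi (frame_balanced fr n); rewrite am_sum // am0 //.
  rewrite (sum_supp2 xy) => [|v vx vy]; last by rewrite (amMz ap) p0 // mul0rz.
  by rewrite !(amMz ap) px py !mulrzz; lia.
have uy : u y = - 2 - u x.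
  have := congr1 phi wt; rewrite am_sum // amN // pa.
  rewrite (sum_supp2 xy) => [|v vx vy]; last by rewrite (amMz ap) p0 // mul0rz.
  by rewrite !(amMz ap) px py !mulrzz; lia.
have dx : d x (e x) = 0 by rewrite (frame_quiver fr) skew_diag.
have nex : e x != 0.
  by apply: (frame_neq0 x fr) => v hv; have := hv x; have := hv y; rewrite px py;
     case: (eqVneq x v) => [<-|xv hy /(_ isT)]; [rewrite eq_sym xy => /(_ isT)|].
have bxy : quiver S x y = 0 by rewrite -(frame_quiver fr) ey amN // dx oppr0.
(* The exponents [u x + k] and [u y - k] add up to -2, so one of them is negative, and regularity at
   [x] or at [y] supplies the factor in degree [k]. *)
have [h ef] : gdvd (1 + gt F (e x)) f.
  rewrite (@hcomp_sum _ _ (d x) f (hdegs (d x) f)) ?undup_uniq //.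
  apply: gdvd_sum => k _; case: (leP (u x + k) (-1)) => uk.
    rewrite -[1 + _]expr1; apply: gdvd_exp (reg x k); have := nzE (u x + k); lia.
  rewrite -[1 + _]expr1; have := vgoodN (reg y) (- k); rewrite ey opprK uy.
  rewrite (_ : hcomp (d y) (- k) f = hcomp (d x) k f).
    apply: gdvd_exp.
    by rewrite -ltz_nat nzE; lia.
  by apply: eq_gres => n; rewrite dy eqr_opp.
have Xneq : 1 + gt F (e x) != 0 by apply: binomial_neq0.
(* The exponents that accompany the binomial in the exchange polynomial of [x], divided by the
   variables of [x] and [y]. *)
pose ua v := posp (quiver S x v) - (v == x)%:Z - (v == y)%:Z.
have homx : homog (d x) 0 (1 + gt F (e x) : R) by apply: homog_binomial.
have hdec k : hcomp (d x) k f = (1 + gt F (e x)) * hcomp (d x) k h.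
  by rewrite ef (hcompM _ _ (ad x) homx) subr0.
have shift w k : gdvd ((1 + gt F (e x)) ^+ nz (w + k)) (hcomp (d x) k f) ->
    gdvd ((1 + gt F (e x)) ^+ nz (w + 1 + k)) (hcomp (d x) k h).
  rewrite hdec => hw; have := nzE (w + k); have := nzE (w + 1 + k) => e1 e2.
  case: (leP 0 (w + k)) => wk.
    have -> : nz (w + 1 + k) = 0%N by lia.
    exact: gdvd1.
  apply: (gdvd_cancel Xneq); rewrite -exprS.
  by apply: gdvd_exp hw; lia.
(* A binomial is not a monomial, so it is the cofactor [h] that is a unit. *)
have [[n [c [_ emono _]]]|] : vunit d ua (1 + gt F (e x)) \/ vunit d (fun v => u v - ua v) h.
  2: by move/(binomial_not_mono nex): emono.
  2: move=> [n [c [_ _ hu]]].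
  apply: (irr _ _ _ _ _ _ _ (esym ef)); last by move=> v; rewrite addrC subrK.
  - move=> v; case: (eqVneq v x) => [->|vx].
      move=> k; rewrite /ua eqxx (negbTE xy) skew_diag // /posp maxxx subr0 add0r.
      case: (eqVneq k 0) => [->|k0]; last by rewrite (homog_neq homx) //; apply: gdvd0.
      by rewrite homx; exact: gdvd_refl.
    case: (eqVneq v y) => [->|vy].
      rewrite ey; apply: vgoodN => k; rewrite /ua eqxx eq_sym (negbTE xy) bxy /posp maxxx !subr0 add0r.
      have homy : homog (d y) 0 (1 + gt F (e x) : R).
        by apply: homog_binomial => //; rewrite dy dx oppr0.
      case: (eqVneq k 0) => [->|k0]; last by rewrite (homog_neq homy) //; apply: gdvd0.
      by rewrite homy; exact: gdvd_refl.
    have hq : d v (e x) = - quiver S x v by rewrite (frame_quiver fr) sk.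
    have uav : ua v = posp (quiver S x v) by rewrite /ua (negbTE vx) (negbTE vy) !subr0.
    apply: vgoodD.
      apply: (vgood_low _ (homog_low (homog1 (ad v)))); rewrite uav addr0; exact: posp_ge0.
    apply: (vgood_low _ (homog_low (homog_mono (d v) (e x) 1))).
    by rewrite uav hq /posp; lia.
  - move=> v; case: (eqVneq v x) => [->|vx].
      move=> k; have := shift _ _ (reg x k).
      by rewrite /ua eqxx (negbTE xy) skew_diag // /posp maxxx subr0 add0r opprK.
    case: (eqVneq v y) => [->|vy].
      rewrite ey; apply: vgoodN => k.
      rewrite /ua eqxx eq_sym (negbTE xy) bxy /posp maxxx !subr0 add0r opprK.
      have eqc q : hcomp (d y) k q = hcomp (d x) (- k) q :> R.
        by apply: eq_gres => n; rewrite dy eqr_oppLR.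
      rewrite eqc; have := vgoodN (reg y) k; rewrite ey opprK eqc => hy.
      have := shift (u y + k + k) (- k); rewrite -!addrA subrr !addr0 [1 + k]addrC !addrA => H.
      rewrite addrAC; have := H hy; rewrite -!addrA; congr (gdvd (_ ^+ nz _) _); lia.
    have uav : ua v = posp (quiver S x v) by rewrite /ua (negbTE vx) (negbTE vy) !subr0.
    have hq : d v (e x) = - quiver S x v by rewrite (frame_quiver fr) sk.
    have dv : d v (e v) = 0 by rewrite (frame_quiver fr) skew_diag.
    have ind : independent (e v) (e x).
      move=> i j ez; suff : ~ ~ (i = 0 /\ j = 0) by lia.
      move=> nz; have := frame_dependent fr vx ez nz (w := y).
      by rewrite eq_sym vy eq_sym xy py => /(_ isT isT).
    rewrite uav; case: (leP 0 (d v (e x))) => hv.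
      have -> : posp (quiver S x v) = 0 by rewrite /posp; lia.
      by rewrite subr0; apply: (vgood_div (ad v) dv hv) => //; rewrite -ef; apply: reg.
    have -> : posp (quiver S x v) = - d v (e x) by rewrite /posp; lia.
    rewrite opprK; apply: (vgood_div (ad v) dv (z := - e x)).
    + by rewrite amN //; lia.
    + by rewrite amN //; lia.
    + apply/(vgood_twist _ _ _ _ (ad v)); rewrite mulrA mulrDr mulr1 gtK addrC -ef.
      exact: reg.
(* A unit has weight 0, so [u] and [ua] have the same total weight. *)
have := frame_balanced fr n => bn.
have : \sum_v weight S v *~ (u v - ua v) = 0.
  rewrite (eq_bigr (fun v => - (weight S v *~ d v n))) ?sumrN ?bn ?oppr0 // => v _.
  by rewrite -mulrNz; congr (_ *~ _); have := hu v; lia.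
have eua : \sum_v weight S v *~ ua v =
    \sum_v weight S v *~ posp (quiver S x v) - weight S x - weight S y.
  rewrite /ua; under eq_bigr => v _ do rewrite !mulrzBr.
  rewrite !sumrB; congr (_ - _ - _).
    by rewrite (bigD1 x) //= eqxx big1 ?addr0 // => v /negbTE ->.
  by rewrite (bigD1 y) //= eqxx big1 ?addr0 // => v /negbTE ->.
under eq_bigr => v _ do rewrite mulrzBr.
rewrite sumrB wt eua mutate_weight balanced_in_out // => /eqP.
by rewrite subr_eq0 => /eqP ->; rewrite [- weight S x + _]addrC.
Qed.

Lemma potential_symmetry S phi alpha (s : W -> W) (tau : V -> V) :
  {morph s : v w / v + w} -> involutive tau ->
  (forall v, weight S (tau v) = s (weight S v)) ->
  (forall v w, quiver S (tau v) (tau w) = quiver S v w) ->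
  potential F S phi alpha -> potential F S (phi \o s) (s alpha).
Proof.
move=> sD tK hw hB [e [d [u [f [fr f0 wt reg irr]]]]].
have s0 : s 0 = 0 by apply: (addrI (s 0)); rewrite -sD !addr0.
have sN v : s (- v) = - s v by apply/eqP; rewrite -addr_eq0 -sD addNr s0.
have sMn v (i : nat) : s (v *+ i) = s v *+ i.
  by elim: i => [|i IH]; rewrite ?mulr0n // !mulrS sD IH.
have sMz v (i : int) : s (v *~ i) = s v *~ i.
  by case: i => i; rewrite ?NegzE ?mulrNz ?sN -!pmulrn sMn.
have ssum (n : V -> int) : s (\sum_v weight S v *~ n v) = \sum_v weight S v *~ n (tau v).
  rewrite (big_morph s sD s0) (reindex_inj (inv_inj tK)) /=; apply: eq_bigr => v _.
  by rewrite sMz -hw tK.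
have ph v : phi (s (weight S (tau v))) = phi (weight S v) by rewrite -hw tK.
exists (e \o tau), (d \o tau), (u \o tau), f; split=> //.
- split => [v|v w|n||n].
  + exact: frame_additive fr _.
  + by rewrite /= (frame_quiver fr) hB.
  + by rewrite -[LHS](ssum (d^~ n)) (frame_balanced fr).
  + rewrite -[RHS](frame_rel fr) (reindex_inj (inv_inj tK)) /=; apply: eq_bigr => v _.
    by rewrite tK ph.
  + move=> h; have [|c hc] := frame_ker fr (n := n \o tau).
      rewrite -[RHS]h [RHS](reindex_inj (inv_inj tK)) /=; apply: eq_bigr => v _.
      by rewrite tK.
    by exists c => v; have := hc (tau v); rewrite /= tK hw.
- by rewrite -[LHS](ssum u) wt sN.
- by move=> v; apply: reg.
- move=> u1 u2 g h r1 r2 uu gh.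
  have tr u0 (q : R) : vregular (e \o tau) (d \o tau) u0 q -> vregular e d (u0 \o tau) q.
    by move=> r v; have := r (tau v); rewrite /= tK.
  have un u0 (q : R) : vunit d (u0 \o tau) q -> vunit (d \o tau) u0 q.
    move=> [n [c [c0 -> hu]]]; exists n, c; split=> // v.
    by have := hu (tau v); rewrite /= tK.
  case: (irr (u1 \o tau) (u2 \o tau) g h (tr _ _ r1) (tr _ _ r2) _ gh).
  + by move=> v; rewrite /= uu /= tK.
  + by move/un; left.
  + by move/un; right.
Qed.

End Potential.

Lemma gdvd_hcomp (F : fieldType) (G : zmodType) (d : G -> int) k (p f : galg F G) :
  additive_map d -> homog d 0 p -> gdvd p f -> gdvd p (hcomp d k f).
Proof. by move=> ad hp [q ->]; exists (hcomp d k q); rewrite (hcompM _ _ ad hp) subr0. Qed.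

(* The sum of the [t^(s i)], for [i <= M], where [s i.+1] and [s i] differ by the
   exchange vector at [tgt i]: the word [tgt] closes up to the relation given
   by [phi], and [T i v] is the exponent of the binomial of [v] in the exchange
   at [v] of the [i]-th monomial. *)
Section Word.
Variables (V : finType) (W : zmodType).
Local Notation G := {ffun V -> int}.
Local Notation R := (galg rat G).
Variables (S : seed V W) (phi : W -> int) (alpha : W).
Variables (M : nat) (tgt : nat -> V) (T : nat -> V -> int).
Hypotheses (ap : additive_map phi) (sk : skew S) (ba : balanced S).
Hypothesis phi_tgt : forall v, phi (weight S v) = (\sum_(i < M.+1) (tgt i == v))%:Z.
Hypothesis tgt_last : tgt M.+1 = tgt 0.
Hypothesis T_step : forall i v, (i <= M)%N -> T i.+1 v = T i v + quiver S v (tgt i).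
Hypothesis T_ge : forall i v, (i <= M)%N -> -1 <= T i.+1 v.
Hypothesis T_eqN1 : forall i v, (i <= M)%N ->
  (T i.+1 v == -1 : nat) = ((tgt i.+1 == v) + (tgt i == v))%N.
Hypothesis T_weight : \sum_v weight S v *~ T 0 v = - alpha.
Hypotheses (phi_first : phi (weight S (tgt 0)) = 1) (phi_last : phi (weight S (tgt M)) = 1).
Hypothesis first_last : tgt 0 != tgt M.
Hypothesis T_ring : forall v, v != tgt 0 -> v != tgt M -> phi (weight S v) != 0 -> T 0 v <= 0.
Hypothesis T_off : forall v, phi (weight S v) = 0 -> exists2 i, (i <= M)%N & T i.+1 v <= 0.

(** The relation is solved for the vector of [tgt M], where [phi] is 1; all other vectors are
    standard basis vectors. *)
Definition can_vec v : G := [ffun w => (w == v)%:Z - (v == tgt M)%:Z * phi (weight S w)].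
Definition can_deg v (n : G) : int := \sum_w quiver S v w * n w.

Lemma phi_out v : \sum_w quiver S v w * phi (weight S w) = 0.
Proof.
have := congr1 phi (balanced_out v sk ba); rewrite am0 // am_sum // => h.
by rewrite -[RHS]h; apply: eq_bigr => w _; rewrite (amMz ap) mulrzz mulrC.
Qed.

Lemma sum_delta (A : zmodType) (E : V -> A) w : \sum_v E v *~ (v == w)%:Z = E w.
Proof. by rewrite (bigD1 w) //= eqxx big1 ?addr0 // => v /negbTE ->. Qed.

Lemma can_deg_vec v w : can_deg v (can_vec w) = quiver S v w.
Proof.
rewrite /can_deg; under eq_bigr => t _ do rewrite ffunE mulrBr mulrCA.
rewrite sumrB -mulr_sumr phi_out mulr0 subr0 -[RHS](sum_delta (fun t => quiver S v t)).
by apply: eq_bigr => t _; rewrite mulrzz.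
Qed.

Lemma additive_can_deg v : additive_map (can_deg v).
Proof. by move=> n m; rewrite /can_deg -big_split; apply: eq_bigr => w _; rewrite ffunE mulrDr. Qed.

Lemma can_vec_sum (n : V -> int) w :
  (\sum_v can_vec v *~ n v) w = n w - n (tgt M) * phi (weight S w).
Proof.
rewrite sum_ffunE; under eq_bigr => v _ do rewrite ffun_mulrz ffunE mulrBl.
rewrite sumrB; congr (_ - _).
  by rewrite -[RHS](sum_delta n); apply: eq_bigr => v _; rewrite mulrC mulrzz eq_sym.
rewrite -[n (tgt M)](sum_delta n) mulr_suml; apply: eq_bigr => v _.
by rewrite mulrzz mulrAC [_ * n v]mulrC.
Qed.

Lemma can_frame : frame S phi can_vec can_deg.
Proof.
split.
- exact: additive_can_deg.
- exact: can_deg_vec.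
- move=> n; under eq_bigr => v _ do rewrite mulrz_sumr.
  rewrite exchange_big big1 // => w _; under eq_bigr => v _ do rewrite mulrzA.
  by rewrite -mulrz_suml ba mul0rz.
- by apply/ffunP => w; rewrite can_vec_sum phi_last mul1r subrr ffunE.
- move=> n h; exists (n (tgt M)) => v; have /ffunP/(_ v) := h.
  by rewrite can_vec_sum ffunE => /eqP; rewrite subr_eq0 => /eqP.
Qed.

Definition word_exp i : G := \sum_(j < i) can_vec (tgt j).

Lemma word_expS i : word_exp i.+1 = word_exp i + can_vec (tgt i).
Proof. exact: big_ord_recr. Qed.

Lemma word_exp0 : word_exp 0 = 0. Proof. exact: big_ord0. Qed.

Lemma tgt_uniq i j : (i <= M)%N -> (j <= M)%N -> phi (weight S (tgt j)) = 1 ->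
  tgt i = tgt j -> i = j.
Proof.
move=> iM jM; rewrite phi_tgt => -[h1] e; apply/eqP/negP => /negP ij; move: h1.
rewrite (bigD1 (Ordinal (jM : (j < M.+1)%N))) //=.
rewrite (bigD1 (Ordinal (iM : (i < M.+1)%N))) //= e eqxx; lia.
Qed.

Lemma tgt_off i v : phi (weight S v) = 0 -> (i <= M)%N -> tgt i <> v.
Proof.
rewrite phi_tgt => -[h1] iM e; move: h1.
by rewrite (bigD1 (Ordinal (iM : (i < M.+1)%N))) //= e eqxx; lia.
Qed.

Lemma word_exp_coord i w : (i <= M)%N -> word_exp i w = (\sum_(j < i) (tgt j == w))%:Z.
Proof.
move=> iM; rewrite /word_exp sum_ffunE (big_morph Posz PoszD (erefl (0%:Z))); apply: eq_bigr => j _.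
have jM : (j < M)%N by apply: leq_trans (ltn_ord j) iM.
rewrite ffunE; case: (eqVneq (tgt j) (tgt M)) => [e|_].
  by have := tgt_uniq (ltnW jM) (leqnn M) phi_last e; lia.
by rewrite mul0r subr0 eq_sym.
Qed.

Lemma word_exp_last : word_exp M.+1 = 0.
Proof.
rewrite word_expS; apply/ffunP => w; rewrite !ffunE word_exp_coord // eqxx mul1r phi_tgt.
by rewrite big_ord_recr PoszD eq_sym /=; lia.
Qed.

Lemma word_exp_first i : (i <= M)%N -> word_exp i (tgt 0) = (0 < i)%:Z.
Proof.
move=> iM; rewrite word_exp_coord //; case: i iM => [|i] iM; first by rewrite big_ord0.
rewrite big_ord_recl eqxx big1 // => j _; apply/eqP; rewrite eqb0; apply/eqP => e.
have jM : (lift ord0 j <= M)%N by have := ltn_ord (lift ord0 j); lia.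
by have := tgt_uniq jM (leq0n M) phi_first e.
Qed.

Lemma can_deg_word i v : (i <= M.+1)%N -> can_deg v (word_exp i) = T i v - T 0 v.
Proof.
elim: i => [|i IH] iM; first by rewrite word_exp0 (am0 (additive_can_deg v)) subrr.
rewrite word_expS additive_can_deg can_deg_vec IH ?T_step // ?(ltnW iM) //; lia.
Qed.

Lemma T_last v : T M.+1 v = T 0 v.
Proof.
have := can_deg_word v (leqnn M.+1).
by rewrite word_exp_last (am0 (additive_can_deg v)); lia.
Qed.

Definition word_sum : R := \sum_(i < M.+1) gt _ (word_exp i.+1).

Lemma hcomp_word D k (P : pred nat) :
  hcomp D k (\sum_(i < M.+1 | P i) gt rat (word_exp i.+1)) =
  \sum_(i < M.+1 | P i && (D (word_exp i.+1) == k)) gt rat (word_exp i.+1).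
Proof.
rewrite (big_morph _ (@hcompD _ _ D k) (@hcomp0 _ _ D k)) big_mkcondr; apply: eq_bigr => i _.
by rewrite /hcomp /gt gres_mono.
Qed.

Lemma hcomp_word_deg v k : hcomp (can_deg v) k word_sum =
  \sum_(i < M.+1 | T i.+1 v == T 0 v + k) gt rat (word_exp i.+1).
Proof.
rewrite (hcomp_word _ _ predT); apply: eq_bigl => i.
by rewrite can_deg_word ?ltn_ord //=; apply/eqP/eqP; lia.
Qed.

(** The exponent of [v] is -1 in the terms just before and just after an occurrence of the letter
    [v], and these two differ by the exchange vector of [v]. The term before the first letter is the
    closing term, by the relation. *)
Lemma hcomp_word_N1 v : hcomp (can_deg v) (- 1 - T 0 v) word_sum =
  (1 + gt rat (can_vec v)) * \sum_(i < M.+1 | tgt i == v) gt rat (word_exp i).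
Proof.
rewrite hcomp_word_deg (eq_bigl (fun i : 'I_M.+1 => T i.+1 v == -1)); last first.
  by move=> i; apply/eqP/eqP; lia.
have -> : \sum_(i < M.+1 | T i.+1 v == -1) gt rat (word_exp i.+1) =
   \sum_(i < M.+1 | tgt i.+1 == v) gt rat (word_exp i.+1) +
   \sum_(i < M.+1 | tgt i == v) gt rat (word_exp i.+1).
  rewrite !(big_mkcond (fun i : 'I_M.+1 => _ == _)) -big_split; apply: eq_bigr => i _ /=.
  have := T_eqN1 v (ltn_ord i : (i <= M)%N).
  by case: (_ == -1); case: (tgt i.+1 == v); case: (tgt i == v); rewrite ?addr0 ?add0r.
rewrite mulrDl mul1r; congr (_ + _).
  rewrite big_mkcond [RHS]big_mkcond big_ord_recr big_ord_recl /=.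
  by rewrite tgt_last word_exp_last word_exp0 addrC.
rewrite mulr_sumr; apply: eq_bigr => i /eqP e.
by rewrite word_expS -e -gtD addrC.
Qed.

(** The first letter occurs only once, so the closing term is the only one of degree 0 in its
    coordinate. *)
Lemma hcomp_word_first (P : pred nat) : P M ->
  hcomp (fun n : G => n (tgt 0)) 0 (\sum_(i < M.+1 | P i) gt rat (word_exp i.+1)) = 1.
Proof.
move=> PM; rewrite hcomp_word (big_pred1 ord_max) /= ?word_exp_last ?gt0 // => i /=.
case: (ltnP i M) => iM.
  rewrite word_exp_first // andbF; apply/esym/eqP => e; move: iM; rewrite e /= ltnn //.
have -> : i = ord_max by apply/val_inj/eqP; rewrite eqn_leq iM -ltnS ltn_ord.
by rewrite PM word_exp_last ffunE !eqxx.
Qed.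

Lemma word_sum_neq0 : word_sum != 0.
Proof.
apply/eqP => e; have := hcomp_word_first (P := predT) isT; rewrite -/word_sum e hcomp0.
by move/esym/eqP; rewrite oner_eq0.
Qed.

Lemma word_regular : vregular can_vec can_deg (T 0) word_sum.
Proof.
move=> v k; have := nzE (T 0 v + k).
case: (leP 0 (T 0 v + k)) => hk.
  by move=> h; rewrite (_ : nz (T 0 v + k) = 0%N); [apply: gdvd1|lia].
case: (eqVneq (T 0 v + k) (-1)) => [e|ne].
  rewrite e => h; have -> : nz (-1) = 1%N by lia.
  have -> : k = -1 - T 0 v by lia.
  by rewrite expr1 hcomp_word_N1; apply: gdvd_mulr; apply: gdvd_refl.
move=> _; rewrite hcomp_word_deg big1 => [|i /eqP h]; first exact: gdvd0.
by have := T_ge v (ltn_ord i : (i <= M)%N); move: hk ne; rewrite -h; lia.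
Qed.

Lemma can_vec_neq0 v : can_vec v != 0.
Proof.
case: (eqVneq v (tgt M)) => [->|vM]; apply/eqP => /ffunP h.
  have := h (tgt 0); rewrite !ffunE (negbTE first_last) eqxx phi_first; lia.
by have := h v; rewrite !ffunE eqxx (negbTE vM); lia.
Qed.

Lemma can_vec_off v w : v != tgt M -> w != v -> can_vec v w = 0.
Proof. by move=> /negbTE h1 /negbTE h2; rewrite ffunE h1 h2 mul0r subr0. Qed.

(** The exponent [T 0 v] cannot be lowered. For the first and the last letter, the component of
    exponent -1 is the binomial times a monomial, which no square of the binomial divides. For
    another letter, the binomial would divide the component of exponent [T 0 v <= 0], and with it
    the closing term 1. For [v] off the word, it would divide a nonzero component that does not
    involve the coordinate of [v], while the binomial does. *)
Lemma word_sharp v (mu : int) : 0 <= mu ->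
  vgood (T 0 v - mu) (can_deg v) (can_vec v) word_sum -> mu = 0.
Proof.
move=> mu0 vg; apply/eqP/negP => /negP mun; have {mu0 mun} mu1 : 0 < mu by lia.
have zn := can_vec_neq0 v.
have one m : word_exp m = word_exp m by [].
have bad i0 : (i0 <= M)%N -> tgt i0 = v -> phi (weight S v) = 1 -> False.
  move=> i0M e p1; have := vg (-1 - T 0 v); rewrite hcomp_word_N1.
  rewrite (big_pred1 (Ordinal (i0M : (i0 < M.+1)%N))) => [|i /=]; last first.
    apply/eqP/eqP => [ei|->//]; apply/val_inj/(tgt_uniq _ i0M); rewrite ?e //.
    exact: (ltn_ord i).
  have -> : nz (T 0 v - mu + (-1 - T 0 v)) = (nz (- mu)).+1.
    by apply/eqP; rewrite -eqz_nat -addn1 PoszD !nzE; lia.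
  rewrite exprS => /(gdvd_cancel (binomial_neq0 _ zn)).
  by apply: (binomial_ndvd_mono zn); [rewrite -ltz_nat nzE; lia|exact: oner_neq0].
case: (eqVneq v (tgt 0)) => [e|v0]; first by apply: (bad 0%N); rewrite // e.
case: (eqVneq v (tgt M)) => [e|vM]; first by apply: (bad M); rewrite // e.
case: (eqVneq (phi (weight S v)) 0) => [p0|pn]; last first.
  have hr := T_ring v0 vM pn.
  have := vg 0; rewrite hcomp_word_deg => /(gdvd_hcomp 0 (additive_coord (tgt 0))) h.
  have {}h := h (homog_binomialX (additive_coord (tgt 0)) _ _).
  rewrite (@hcomp_word_first (fun i => T i.+1 v == T 0 v + 0)) in h; last first.
    by rewrite T_last addr0.
  have ct : can_vec v (tgt 0) = 0 by apply: can_vec_off; rewrite // eq_sym.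
  by apply: (@binomial_ndvd_mono _ _ _ 0 1 _ zn _ _ (h ct)); [rewrite -ltz_nat nzE; lia|exact: oner_neq0].
have [i iM Ti] := T_off p0.
have [q] := vg (T i.+1 v - T 0 v).
have -> : nz (T 0 v - mu + (T i.+1 v - T 0 v)) = (nz (T i.+1 v - mu + 1)).+1.
  by apply/eqP; rewrite -eqz_nat -[(nz _).+1]addn1 PoszD !nzE; lia.
rewrite exprS -mulrA hcomp_word_deg; set C := \sum_(_ < _ | _) _ => eC.
(* Coefficients are nonnegative rationals, so nothing cancels. *)
have C0 : C != 0.
  apply/eqP => /(congr1 (gcoef (word_exp i.+1))); rewrite /C raddf_sum raddf0.
  rewrite (bigD1 (Ordinal (iM : (i < M.+1)%N))) /=; last by apply/eqP; lia.
  rewrite gcoef_mono eqxx => /eqP; rewrite gt_eqF // ltr_pwDl // sumr_ge0 // => j _.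
  by rewrite gcoef_mono mulrn_wge0.
have hC : homog (fun n : G => n v) 0 C.
  rewrite /C; elim/big_ind: _ => [|f g|j _]; first exact: hcomp0.
    exact: homogD.
  have -> : 0 = word_exp j.+1 v; last exact: homog_mono.
  have := ltn_ord j; rewrite ltnS leq_eqVlt => /orP[/eqP ->|jM].
    by rewrite word_exp_last ffunE.
  rewrite word_exp_coord // big1 // => l _; apply/eqP; rewrite eqb0; apply/eqP.
  by apply: (tgt_off p0); have := ltn_ord l; lia.
have [l hl] : exists l, homog (fun n : G => n v) l (1 + gt rat (can_vec v)).
  apply: (@homog_factor _ _ _ 0 _ ((1 + gt rat (can_vec v)) ^+ nz (T i.+1 v - mu + 1) * q)).
  - exact: additive_coord.
  - by rewrite -eC.
  - by rewrite -eC.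
have h0 : (0 : G) v = l.
  apply: (homog_supp hl); rewrite raddfD /= -[1]gt0 !gcoef_mono eqxx.
  by rewrite (negbTE zn) addr0 oner_eq0.
have hv : can_vec v v = l.
  apply: (homog_supp hl); rewrite raddfD /= -[1]gt0 !gcoef_mono eqxx.
  by rewrite [0 == _]eq_sym (negbTE zn) add0r oner_eq0.
by move: h0; rewrite -hv !ffunE eqxx (negbTE vM) mul0r.
Qed.

Lemma word_unit u1 u2 (g h : R) m c : vregular can_vec can_deg u1 g ->
  vregular can_vec can_deg u2 h -> (forall v, u1 v + u2 v = T 0 v) -> g * h = word_sum ->
  c != 0 -> g = gmono m c -> vunit can_deg u1 g.
Proof.
move=> r1 r2 uu gh c0 eg; exists m, c; split=> // v.
apply: (@word_sharp v).
  have := r1 v (can_deg v m); rewrite eg homog_mono.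
  case: (leP 0 (u1 v + can_deg v m)) => // h0 /(binomial_ndvd_mono (can_vec_neq0 v)) [] //.
  by rewrite -ltz_nat nzE; lia.
move=> k; rewrite -gh eg (hcompM _ _ (additive_can_deg v) (homog_mono _ m c)).
apply: gdvd_mull; have := r2 v (k - can_deg v m); congr (gdvd (_ ^+ nz _) _).
by have := uu v; lia.
Qed.

Lemma word_factor_mono (g h : R) l : g * h = word_sum -> homog (fun n : G => n (tgt 0)) l g ->
  exists m c, c != 0 /\ g = gmono m c.
Proof.
move=> gh hg; have := hcomp_word_first (P := predT) isT; rewrite -/word_sum -gh.
rewrite (hcompM _ _ (additive_coord _) hg) => e.
exact: (@factor_mono _ _ g _ 0 1 (oner_neq0 _) e).
Qed.

(** In the coordinate of the first letter the sum has degrees 0 and 1 only, so one of the factors is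
    homogeneous there. It divides the component of degree 0, which is 1; hence it is a monomial, and
    [word_sharp] makes it a unit. *)
Lemma word_irreducible u1 u2 (g h : R) : vregular can_vec can_deg u1 g ->
  vregular can_vec can_deg u2 h -> (forall v, u1 v + u2 v = T 0 v) -> g * h = word_sum ->
  vunit can_deg u1 g \/ vunit can_deg u2 h.
Proof.
move=> r1 r2 uu gh; set ca := fun n : G => n (tgt 0).
have aca : additive_map ca by apply: additive_coord.
have w0 := word_sum_neq0.
have g0 : g != 0 by apply: contraNN w0 => /eqP e; rewrite -gh e mul0r.
have h0 : h != 0 by apply: contraNN w0 => /eqP e; rewrite -gh e mulr0.
have range k : hcomp ca k word_sum != 0 -> 0 <= k <= 1.
  apply: contraNT => hk; rewrite (hcomp_word _ _ predT) big_pred0 // => i /=.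
  apply/negbTE; apply: contraNN hk => /eqP <-; rewrite /ca.
  have := ltn_ord i; rewrite ltnS leq_eqVlt => /orP[/eqP ->|iM].
    by rewrite word_exp_last ffunE.
  by rewrite word_exp_first.
have [p hp] := htop_exists ca g0; have [q hq] := htop_exists ca h0.
have [p' hp'] := htop_exists (fun n => - ca n) g0.
have [q' hq'] := htop_exists (fun n => - ca n) h0.
have [t1 _] := htopM aca hp hq; have [t2 _] := htopM (additive_opp aca) hp' hq'.
move: t1 t2; rewrite gh hcomp_opp => /range t1 /range t2.
have b1 := htop_bot hp hp'; have b2 := htop_bot hq hq'.
have [e|e] : - p = p' \/ - q = q' by lia.
  have [m [c [c0 eg]]] := word_factor_mono gh (htop_bot_homog hp (eq_ind_r (htop _ ^~ _) hp' e)).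
  by left; apply: word_unit r1 r2 uu gh c0 eg.
rewrite mulrC in gh.
have [m [c [c0 eg]]] := word_factor_mono gh (htop_bot_homog hq (eq_ind_r (htop _ ^~ _) hq' e)).
right; apply: word_unit r2 r1 _ gh c0 eg.
by move=> v; rewrite addrC.
Qed.

Theorem word_potential : potential rat S phi alpha.
Proof.
exists can_vec, can_deg, (T 0), word_sum; split.
- exact: can_frame.
- exact: word_sum_neq0.
- exact: T_weight.
- exact: word_regular.
- exact: word_irreducible.
Qed.

End Word.

(** * Potentials of two terms *)

Section Twin.
Variables (V : finType) (W : zmodType).
Implicit Types (S : seed V W) (phi : W -> int) (alpha : W).

(** The old variable of [x] divided by the variable of [o] has weight [- alpha]. In the new seed it
    is the exchange polynomial over the variables of [x] and [o], a word with the two letters [x]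
    and [o]; [T] lists the exponents of its two terms. *)
Lemma potential_of_twin S phi alpha x o : additive_map phi -> skew S -> balanced S -> x != o ->
  phi (weight S x) = -1 -> phi (weight S o) = 1 ->
  (forall v, v != x -> v != o -> phi (weight S v) = 0) ->
  weight S o - weight S x = alpha -> potential rat (mutate x S) phi alpha.
Proof.
move=> ap sk ba xo px po p0 ea.
have ox : o != x by rewrite eq_sym.
have sk' := mutate_skew x sk; have ba' := mutate_balanced x sk ba.
have two (S0 : seed V W) : skew S0 -> balanced S0 ->
    (forall v, v != x -> v != o -> phi (weight S0 v) = 0) ->
    forall v, quiver S0 v x * phi (weight S0 x) + quiver S0 v o * phi (weight S0 o) = 0.
  move=> sk0 ba0 p00 v; rewrite -[RHS](phi_out ap sk0 ba0 v) (sum_supp2 xo) // => w wx wo.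
  by rewrite p00 // mulr0.
have bxo : quiver S x o = 0.
  by have := two S sk ba p0 x; rewrite px po skew_diag // mul0r add0r mulr1.
have p0' v : v != x -> v != o -> phi (weight (mutate x S) v) = 0.
  by move=> vx vo; rewrite mutate_weight_neq // p0.
have po' : phi (weight (mutate x S) o) = 1 by rewrite mutate_weight_neq.
have px' : phi (weight (mutate x S) x) = 1.
  rewrite phi_mutate // px (sum_supp2 xo) => [|v vx vo]; last by rewrite p0 // mul0r.
  by rewrite skew_diag // bxo /posp maxxx !mulr0.
have bp : \sum_v weight (mutate x S) v *~ posp (quiver (mutate x S) x v) =
    weight (mutate x S) x + weight S x.
  have e : weight (mutate x (mutate x S)) x = weight S x by rewrite mutateK.
  by rewrite -e [weight (mutate x (mutate x S)) x]mutate_weight addrA subrr add0r balanced_in_out.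
have wo : weight (mutate x S) o = weight S o by rewrite mutate_weight_neq.
move: (mutate x S) sk' ba' p0' po' px' bp wo => S' sk' ba' p0' po' px' bp wo.
have b2 v : quiver S' v o = - quiver S' v x.
  by have := two S' sk' ba' p0' v; rewrite px' po' !mulr1; lia.
have bxo' : quiver S' x o = 0 by rewrite b2 skew_diag // oppr0.
pose U v := (v == x) || (v == o).
pose T (i : nat) v := if U v then -1 else
   if odd i then posp (quiver S' v x) else posp (quiver S' x v).
pose tgt (i : nat) := if odd i then o else x.
apply: (@word_potential _ _ S' phi alpha 1 tgt T ap sk' ba') => //.
- move=> v; rewrite !big_ord_recl big_ord0 /tgt /=.
  case: (eqVneq v x) => [->|vx]; first by rewrite px' ?eqxx ?(negbTE ox).
  case: (eqVneq v o) => [->|vo]; first by rewrite po' ?eqxx.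
  by rewrite p0'.
- move=> i v i1; rewrite /T /U; case: (eqVneq v x) => [->|vx] /=.
    by rewrite /tgt; case: ifP => _; rewrite ?bxo' ?skew_diag // addr0.
  case: (eqVneq v o) => [->|vo] /=.
    by rewrite /tgt; case: ifP => _; rewrite ?skew_diag // sk' ?bxo' ?oppr0 addr0.
  by rewrite /tgt (sk' x v) /posp; case: odd => /=; rewrite ?b2; lia.
- by move=> i v i1; rewrite /T; case: (U v) => //; case: ifP => _; apply: le_trans (posp_ge0 _).
- move=> i v i1; rewrite /T /U /tgt /=.
  have pn b : (posp b == -1) = false by apply/eqP; rewrite /posp; lia.
  by case: (odd i) => /=; case: (eqVneq v x) => [->|vx] /=; rewrite ?eqxx ?(negbTE ox) ?(negbTE xo) //;
     case: (eqVneq v o) => //= _; rewrite pn.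
- rewrite (eq_bigr (fun v => weight S' v *~ posp (quiver S' x v) - weight S' v *~ (v == x)%:Z
     - weight S' v *~ (v == o)%:Z)).
    rewrite !sumrB bp !sum_delta wo -ea opprB [weight S' x + _]addrC addrK.
    by [].
  move=> v _; rewrite -!mulrzBr /T /U; congr (_ *~ _).
  case: (eqVneq v x) => [->|vx] /=; first by rewrite skew_diag // (negbTE xo) /posp maxxx.
  case: (eqVneq v o) => [->|vo] /=; first by rewrite bxo' /posp maxxx.
  by rewrite !subr0.
- by move=> v vx vo; rewrite p0' // eqxx.
- move=> v pv; rewrite /T /U; case: (eqVneq v x) => [e|vx]; first by rewrite e px' in pv.
  case: (eqVneq v o) => [e|vo]; first by rewrite e po' in pv.
  case: (leP (quiver S' v x) 0) => h; [exists 0%N|exists 1%N] => //=.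
    by rewrite /posp; lia.
  by rewrite sk' /posp; lia.
Qed.

End Twin.

Local Open Scope quotient_scope.

(** * Compatible families of weights *)

Section Roots.
Variable k : nat.
Implicit Types (l m : weightP k) (a b c d : 'I_k).

Definition rt a b l : int := coord l a - coord l b.
Definition alpha a b : weightP k := e_ a - e_ b.

Fact subr_cross (x y z t : int) : x - y = z - t -> x - z = y - t.
Proof. lia. Qed.

Lemma coord_pi (v : 'rV[int]_k) a b : rt a b (P_of v) = v 0 a - v 0 b.
Proof.
have : repr (P_of v) == v %[mod weightP k] by rewrite reprK.
rewrite -Quotient.idealrBE => /forallP/(_ a)/forallP/(_ b).
by rewrite !mxE => /eqP; apply: subr_cross.
Qed.

Lemma P_of_repr l : P_of (repr l) = l. Proof. exact: reprK. Qed.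

Lemma P_ofD u v : P_of (u + v) = P_of u + P_of v :> weightP k.
Proof. exact: (raddfD (\pi_(weightP k))). Qed.

Lemma additive_rt a b : additive_map (rt a b).
Proof.
by move=> l m; rewrite -(P_of_repr l) -(P_of_repr m) -P_ofD !coord_pi !mxE opprD addrACA.
Qed.

Lemma rtE a b c : rt a b (e_ c) = (a == c)%:Z - (b == c)%:Z.
Proof. by rewrite coord_pi !mxE !eqxx /=; case: eqP; case: eqP. Qed.

Lemma rt_ext l m : (forall a b, rt a b l = rt a b m) -> l = m.
Proof.
move=> h; rewrite -(P_of_repr l) -(P_of_repr m); apply/eqP.
rewrite -Quotient.idealrBE; apply/forallP => a; apply/forallP => b.
by rewrite !mxE; apply/eqP/subr_cross/h.
Qed.

Lemma rt_trans a b c l : rt a b l + rt b c l = rt a c l.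
Proof. rewrite /rt; lia. Qed.

Lemma rt_opp a b l : rt b a l = - rt a b l.
Proof. rewrite /rt; lia. Qed.

Lemma rt_alpha a b c d : rt c d (alpha a b) =
  (c == a)%:Z - (c == b)%:Z - (d == a)%:Z + (d == b)%:Z.
Proof. by rewrite (amB (additive_rt c d)) !rtE; lia. Qed.

Lemma rt_alpha_self a b : a != b -> rt a b (alpha a b) = 2.
Proof. by move=> ab; rewrite rt_alpha !eqxx [b == a]eq_sym (negbTE ab). Qed.

Lemma alpha_opp a b : alpha b a = - alpha a b.
Proof. by rewrite opprB. Qed.

Lemma rt_swap a b c d l : rt c d (swap a b l) = rt (tperm a b c) (tperm a b d) l.
Proof. by rewrite coord_pi !mxE. Qed.

Lemma swapE a b l : a != b -> swap a b l = l - alpha a b *~ rt a b l.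
Proof.
move=> ab; apply: rt_ext => c d; rewrite rt_swap (amB (additive_rt c d)) (amMz (additive_rt c d)).
rewrite rt_alpha mulrzz /rt.
case: tpermP => [->|->|/eqP ca /eqP cb]; case: tpermP => [->|->|/eqP da /eqP db];
  rewrite ?eqxx ?(negbTE ab) ?[b == a]eq_sym ?(negbTE ab) ?(negbTE ca) ?(negbTE cb)
   ?(negbTE da) ?(negbTE db); lia.
Qed.

Lemma W_sortable_rt l m a b : W_sortable l m -> ~ (0 < rt a b l /\ rt a b m < 0).
Proof.
move=> /existsP[w /forallP h].
have {}h (i j : 'I_k) : (i <= j)%N -> coord l (w j) <= coord l (w i) /\ coord m (w j) <= coord m (w i).
  by move=> ij; have /forallP/(_ j)/implyP/(_ ij)/andP[] := h i.
rewrite /rt -(permKV w a) -(permKV w b).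
by case: (leqP ((w^-1)%g a) ((w^-1)%g b)) => [/h|/ltnW/h]; lia.
Qed.

Lemma root_conjugateP l m : root_conjugate l m ->
  exists a b, [/\ a != b, l - m = alpha a b & rt a b l = 1].
Proof.
move=> /existsP[a /existsP[b /and3P[ab /eqP e /eqP es]]]; exists a, b; split=> //.
have : rt a b (alpha a b) = rt a b (alpha a b) * rt a b l.
  rewrite -{1}/(alpha a b) -[alpha a b in LHS]e es swapE // opprB addrC subrK.
  by rewrite (amMz (additive_rt a b)) mulrzz.
by rewrite rt_alpha_self //; lia.
Qed.

Section Family.
Variables (I : finType) (C : I -> weightP k).

Definition dominates a b := [forall v, 0 <= rt a b (C v)].

Definition twins a b (y z : I) := [/\ rt a b (C y) = 1, rt a b (C z) = -1,
  C y - C z = alpha a b & forall v, v != y -> v != z -> rt a b (C v) = 0].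

(** Since a mutation changes one vector only, such a root keeps a nonzero value at some unchanged
    vector. *)
Definition spread a b := forall x, exists2 v, v != x & rt a b (C v) != 0.

Lemma twins_opp a b y z : twins a b y z -> twins b a z y.
Proof.
move=> [h1 h2 h3 h4]; split; rewrite ?(rt_opp a b) ?h1 ?h2 ?opprK //.
  by rewrite alpha_opp -h3 opprB.
by move=> v vz vy; rewrite rt_opp h4 ?oppr0.
Qed.

Lemma twins_neq a b y z : twins a b y z -> y != z.
Proof. by move=> [h1 h2 _ _]; apply/eqP => e; move: h1; rewrite e h2. Qed.

Hypotheses (cC : pairwise_compatible C) (bC : basic C).

Lemma opposed_root_conjugate a b y z : 0 < rt a b (C y) -> rt a b (C z) < 0 ->
  [/\ root_conjugate (C y) (C z), root_conjugate (C z) (C y), rt a b (C y) = 1,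
      rt a b (C z) = -1 & C y - C z = alpha a b].
Proof.
move=> py nz.
have /orP[/W_sortable_rt ws|r1] := forallP (forallP cC y) z.
  by case: (ws a b).
have /orP[/W_sortable_rt ws|r2] := forallP (forallP cC z) y.
  by case: (ws b a); rewrite !(rt_opp a b); lia.
have [c [d [cd e _]]] := root_conjugateP r1.
have := congr1 (rt a b) e; rewrite (amB (additive_rt a b)) rt_alpha => h.
have ca : a == c by move: h; case: (a == c) => //; case: (b == d); lia.
have db : b == d by move: h; case: (b == d) => //; case: (a == c); lia.
move/eqP: ca => ca; move/eqP: db => db; subst c d.
move: h; rewrite !eqxx [b == a]eq_sym (negbTE cd) => h.
split=> //; first by lia.
  by lia.
Qed.

Lemma basic_uniq y z v : root_conjugate (C y) (C z) -> C v = C y -> v = y.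
Proof.
move=> r e; have /implyP h := forallP bC y.
have /forallP/(_ v)/implyP := h (introT existsP (ex_intro _ z r)).
by rewrite e eqxx => /(_ isT)/eqP.
Qed.

(** A third vector with nonzero value would differ from one of the two by the same root, hence equal
    the other, against multiplicity one. *)
Lemma opposed_twins a b y z : 0 < rt a b (C y) -> rt a b (C z) < 0 -> twins a b y z.
Proof.
move=> py nz; have [r1 r2 ey ez e] := opposed_root_conjugate py nz; split=> // v vy vz.
case: (ltgtP (rt a b (C v)) 0) => // hv.
  have [_ _ _ _ e'] := opposed_root_conjugate py hv.
  case/eqP: vz; apply: (basic_uniq r2); apply: oppr_inj; apply: (addrI (C y)).
  by rewrite e e'.
have [_ _ _ _ e'] := opposed_root_conjugate hv nz.
case/eqP: vy; apply: (basic_uniq r1); apply: (addIr (- C z)).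
by rewrite e e'.
Qed.

Lemma root_conjugate_twins x y : root_conjugate (C x) (C y) ->
  exists a b, a != b /\ twins a b x y.
Proof.
move=> /root_conjugateP[a [b [ab e h]]]; exists a, b; split=> //.
apply: opposed_twins; rewrite ?h //.
have := congr1 (rt a b) e.
by rewrite (amB (additive_rt a b)) rt_alpha_self // h; lia.
Qed.

Lemma trichotomy a b :
  [\/ dominates a b, dominates b a | exists y z, twins a b y z].
Proof.
case: (boolP (dominates a b)) => [|/forallPn[z]]; first by constructor 1.
rewrite -ltNge => hz.
case: (boolP (dominates b a)) => [|/forallPn[y]]; first by constructor 2.
rewrite -ltNge (rt_opp a b) oppr_lt0 => hy.
by constructor 3; exists y, z; apply: opposed_twins.
Qed.

Lemma dominates_twins a b y z : dominates a b -> ~ twins a b y z.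
Proof. by move=> /forallP/(_ z) h [_ e _ _]; move: h; rewrite e. Qed.

Lemma dominates_trans a b c : dominates a b -> dominates b c -> dominates a c.
Proof.
clear cC bC; move=> /forallP h1 /forallP h2; apply/forallP => v; rewrite -(rt_trans a b c).
by have := h1 v; have := h2 v; lia.
Qed.

Hypothesis sC : forall a b, a != b -> spread a b.

Lemma dominates_anti (x : I) a b : a != b -> dominates a b -> ~~ dominates b a.
Proof.
clear cC bC; move=> ab /forallP h1; apply/negP => /forallP h2.
have [v _ /eqP] := sC ab x; apply; have := h1 v; have := h2 v; rewrite (rt_opp a b); lia.
Qed.

(** If [a] did not dominate [c], the root of [(a, b)] would vanish at every index except [z]. *)
Lemma dominates_twins_r a b c y z : a != b -> b != c -> a != c ->
  dominates a b -> twins b c y z -> dominates a c.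
Proof.
move=> ab bc ac /forallP h [ty tz _ t0]; have [|hca|[y' [z' tac]]] := trichotomy a c => //.
  have [v vz /eqP] := sC ab z; case; have := h v; have := forallP hca v.
  rewrite (rt_opp a c) -(rt_trans a b c); case: (eqVneq v y) => [->|vy]; first by rewrite ty; lia.
  by rewrite t0 //; lia.
have [ty' tz' _ t0'] := tac.
have zz : z' = z.
  apply/eqP; apply/negP => /negP zz; move: tz'; rewrite -(rt_trans a b c).
  have := h z'; case: (eqVneq z' y) => [->|zy]; first by rewrite ty; lia.
  by rewrite t0 //; lia.
subst z'; have yz : y != z by apply/eqP => e; move: ty; rewrite e tz.
have [v vz /eqP] := sC ab z; case; have := h y; rewrite -(rt_trans a c b) (rt_opp b c) ty.
case: (eqVneq y y') => [yy _|yy]; last by rewrite t0' //; lia.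
rewrite -(rt_trans a c b) (rt_opp b c); case: (eqVneq v y) => [->|vy].
  by rewrite ty yy ty'; lia.
by rewrite t0 // t0' // -yy.
Qed.

Lemma dominates_twins_l a b c y z : a != b -> b != c -> a != c ->
  dominates a b -> twins a c y z -> dominates c b.
Proof.
move=> ab bc ac h t; have [//|h'|[y' [z' t']]] := trichotomy c b.
  by case: (dominates_twins (dominates_trans h h') t).
by case: (dominates_twins (dominates_twins_r ab bc ac h (twins_opp t')) t).
Qed.

End Family.
End Roots.

Local Close Scope quotient_scope.

(** * Roots of small support *)

Lemma eq_potential (F : fieldType) (V : finType) (W : zmodType) (S : seed V W) phi phi' alpha alpha' :
  (forall v, phi (weight S v) = phi' (weight S v)) -> alpha = alpha' ->
  potential F S phi alpha -> potential F S phi' alpha'.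
Proof.
move=> ep <- [e [d [u [f [[ad qu fb rel ker] f0 wt reg irr]]]]]; exists e, d, u, f; split=> //.
split=> // [|n /ker[c hc]]; last by exists c => v; rewrite hc ep.
by rewrite -[RHS]rel; apply: eq_bigr => v _; rewrite ep.
Qed.

(** Were the root supported on [y] after the mutation, balance would make its value there 0 or leave
    [y] without arrows; in both cases undoing the mutation creates no value elsewhere. *)
Lemma unsupported_mutate (V : finType) (W : zmodType) (S : seed V W) phi x :
  additive_map phi -> skew S -> balanced S -> unsupported phi S -> unsupported phi (mutate x S).
Proof.
move=> ap sk ba us y h; apply: (us y) => w wy.
have sk' := mutate_skew x sk; have ba' := mutate_balanced x sk ba.
have h0 v : quiver (mutate x S) v y * phi (weight (mutate x S) y) = 0.
  have := phi_out ap sk' ba' v; rewrite (big_split_at _ y) big1 ?addr0 // => u uy.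
  by rewrite h ?mulr0.
case: (eqVneq w x) => [ew|wx]; last by rewrite -(mutate_weight_neq _ wx) h.
subst w; have := phi_mutate x ap sk' ba'; rewrite mutateK // h // oppr0 add0r => ->.
apply: big1 => u _; case: (eqVneq u y) => [->|uy]; last by rewrite h // mul0r.
by have /eqP := h0 x; rewrite mulf_eq0 => /orP[]/eqP ->; rewrite /posp ?maxxx ?mulr0 ?mul0r.
Qed.

(** Balance at [x] leaves no arrow between [x] and [o] unless the root vanishes on [o]; in both
    cases the neighbours contribute nothing to the new value. *)
Lemma phi_mutate_pair (V : finType) (W : zmodType) (S : seed V W) phi x o :
  additive_map phi -> skew S -> balanced S -> x != o ->
  (forall v, v != x -> v != o -> phi (weight S v) = 0) ->
  phi (weight (mutate x S) x) = - phi (weight S x).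
Proof.
move=> ap sk ba xo p0; rewrite phi_mutate // (sum_supp2 xo) => [|v vx vo]; last by rewrite p0 ?mul0r.
have := phi_out ap sk ba x; rewrite (sum_supp2 xo) => [|v vx vo]; last by rewrite p0 ?mulr0.
rewrite skew_diag // mul0r add0r => /eqP; rewrite mulf_eq0 => /orP[]/eqP ->.
  by rewrite /posp maxxx !mulr0 !addr0.
by rewrite /posp maxxx mulr0 mul0r !addr0.
Qed.

Lemma exists_extremal (T : finType) (r : rel T) (X : pred T) x0 : X x0 -> reflexive r -> transitive r ->
  (forall a b, a != b -> r a b -> ~~ r b a) ->
  exists2 m, X m & forall d, X d -> d != m -> ~~ r m d.
Proof.
move=> Xx0 rr rt anti; case: (arg_minnP (fun d => #|r d|) Xx0) => m Xm hm; exists m => // d Xd dm.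
apply/negP => md; have := hm d Xd; rewrite leqNgt => /negP; apply; apply/proper_card/properP.
split; first by apply/subsetP => c; move=> dc; exact: rt md dc.
exists m; first exact: rr.
by apply: (anti m d); rewrite // eq_sym.
Qed.

(** * Twins and potentials along a mutation *)

Section Invariant.
Variables (k : nat) (V P : finType).
Local Notation W := {ffun P -> weightP k}.
Implicit Types (S : seed V W) (p : P) (a b c : 'I_k).

Definition rt_at p a b (w : W) : int := rt a b (w p).
Definition alpha_at p a b : W := [ffun q => if q == p then alpha a b else 0].
Definition cluster S p v : weightP k := weight S v p.

Definition good_seed S := forall p, pairwise_compatible (cluster S p) && basic (cluster S p).

Lemma additive_rt_at p a b : additive_map (rt_at p a b).
Proof. by move=> v w; rewrite /rt_at ffunE additive_rt. Qed.

Definition seed_spread S := forall p a b, a != b -> spread (cluster S p) a b.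

Lemma spread_unsupported S p a b : spread (cluster S p) a b -> unsupported (rt_at p a b) S.
Proof. by move=> sp v h; have [w wv /eqP] := sp v; apply; apply: h. Qed.

Lemma unsupported_spread S p a b : unsupported (rt_at p a b) S -> spread (cluster S p) a b.
Proof.
move=> us x; case: (pickP [pred v | (v != x) && (rt a b (cluster S p v) != 0)]).
  by move=> v /andP[vx vn]; exists v.
move=> none; case: (us x) => v vx; have := none v; rewrite /= vx /=.
by move/negbFE/eqP.
Qed.

Lemma spread_mutate S x : skew S -> balanced S ->
  seed_spread S -> seed_spread (mutate x S).
Proof.
move=> sk ba sp p a b ab; apply: unsupported_spread.
by apply: unsupported_mutate; [exact: additive_rt_at | | | exact/spread_unsupported/sp].
Qed.

Lemma rt_atE S p a b v : rt_at p a b (weight S v) = rt a b (cluster S p v).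
Proof. by []. Qed.

Lemma alpha_at_opp p a b : alpha_at p b a = - alpha_at p a b.
Proof. by apply/ffunP => q; rewrite !ffunE; case: eqP; rewrite ?oppr0 // alpha_opp. Qed.

Lemma swap_alpha a b c d : a != b -> swap a b (alpha c d) = alpha (tperm a b c) (tperm a b d).
Proof.
move=> ab; apply: rt_ext => e f; rewrite rt_swap !rt_alpha.
by rewrite !(can2_eq (tpermK a b) (tpermK a b)).
Qed.

Lemma ffun_mulz (w : W) (i : int) q : (w *~ i) q = w q *~ i.
Proof. by case: i => n; rewrite ?NegzE ?mulrNz ?ffunE -!pmulrn ffunMnE. Qed.

(** As the weights of [y] and [z] differ by the root at [p] alone, exchanging [y] and [z] realizes
    the reflection on all weights. Balance shows that [y] and [z] have the same arrows, so this
    exchange is a symmetry of the seed. *)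
Lemma potential_swap S p a b y z c d : skew S -> balanced S -> a != b ->
  twins (cluster S p) a b y z -> weight S y - weight S z = alpha_at p a b ->
  potential rat S (rt_at p c d) (alpha_at p c d) ->
  potential rat S (rt_at p (tperm a b c) (tperm a b d)) (alpha_at p (tperm a b c) (tperm a b d)).
Proof.
move=> sk ba ab tw e pot; have yz := twins_neq tw; have [ty tz _ t0] := tw.
pose s (w : W) : W := w - alpha_at p a b *~ rt_at p a b w.
have sE w q : s w q = if q == p then swap a b (w q) else w q.
  rewrite /s !ffunE ffun_mulz ffunE; case: eqP => [->|_]; first by rewrite swapE.
  by rewrite mul0rz subr0.
have sD : {morph s : v w / v + w}.
  by move=> v w; rewrite /s additive_rt_at mulrzDr opprD addrACA.
have Brow v : quiver S v y = quiver S v z.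
  have := phi_out (additive_rt_at p a b) sk ba v; rewrite (sum_supp2 yz).
    by rewrite !rt_atE ty tz mulr1 mulrN1 => /eqP; rewrite subr_eq0 => /eqP.
  by move=> w wy wz; rewrite rt_atE t0 // mulr0.
have Bt v w : quiver S v (tperm y z w) = quiver S v w by case: tpermP => // ->.
apply: (eq_potential _ _ (@potential_symmetry rat V W S _ _ s (tperm y z) sD (tpermK y z) _ _ pot)).
- by move=> v; rewrite /= /rt_at sE eqxx rt_swap.
- apply/ffunP => q; rewrite sE !ffunE; case: eqP => // _; exact: swap_alpha.
- move=> v; rewrite /s rt_atE; case: tpermP => [->|->|/eqP vy /eqP vz].
  + by rewrite ty mulr1z -e opprB addrC subrK.
  + by rewrite tz mulrNz mulr1z opprK -e addrC subrK.
  + by rewrite t0 // mulr0z subr0.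
- by move=> v w; rewrite Bt sk Bt -sk.
Qed.

(* Twins are opposite roots at [p], but the difference of their weights could a
   priori be nonzero at other punctures.  The first field excludes this; it
   follows from the second one, by [potential_exchange], when twins are created
   by a mutation. *)
Record invariant S p : Prop := {
  inv_twins : forall a b y z, twins (cluster S p) a b y z ->
    weight S y - weight S z = alpha_at p a b;
  inv_cover : forall a b, a != b -> dominates (cluster S p) a b ->
    (forall d, d != a -> d != b -> ~~ (dominates (cluster S p) a d && dominates (cluster S p) d b)) ->
    potential rat S (rt_at p a b) (alpha_at p a b) }.

Lemma twins_irr (C : V -> weightP k) a b y z : twins C a b y z -> a != b.
Proof. by move=> [h _ _ _]; apply/eqP => e; move: h; rewrite e /rt subrr. Qed.

Section Step.
Variables (S : seed V W) (x : V) (p : P).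
Local Notation S' := (mutate x S).
Hypotheses (sk : skew S) (ba : balanced S) (sp : seed_spread S).
Hypotheses (gS : good_seed S) (gS' : good_seed S') (iS : invariant S p).
Local Notation C := (cluster S p).
Local Notation C' := (cluster S' p).

Let sk' : skew S' := mutate_skew x sk.
Let ba' : balanced S' := mutate_balanced x sk ba.
Let sp' : seed_spread S' := spread_mutate x sk ba sp.

Lemma cluster_neq v : v != x -> C' v = C v.
Proof. by move=> vx; rewrite /cluster mutate_weight_neq. Qed.

Lemma tricho (R : seed V W) : good_seed R -> forall a b,
  [\/ dominates (cluster R p) a b, dominates (cluster R p) b a | exists y z, twins (cluster R p) a b y z].
Proof. by move=> /(_ p)/andP[h1 h2]; apply: trichotomy. Qed.

Lemma dominates_flip a b : a != b -> dominates C a b -> ~ dominates C' b a.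
Proof.
move=> ab /forallP h1 /forallP h2; have [v vx /eqP] := sp p ab x; apply.
have := h1 v; have := h2 v; rewrite cluster_neq // rt_opp; lia.
Qed.

(** The twins are created by this mutation, with [x] as the negative one. Before it, the root was 1
    on [x] and [y] and 0 elsewhere, which is the situation of [potential_exchange]. *)
Lemma dominates_twins_step a b y z : dominates C a b -> twins C' a b y z ->
  weight S' y - weight S' z = alpha_at p a b.
Proof.
move=> dm tw; have [ty tz _ t0] := tw; have yz := twins_neq tw; have ab := twins_irr tw.
have zx : z = x.
  apply/eqP/negP => /negP zx; have := forallP dm z; rewrite -cluster_neq // tz; lia.
subst z; have vx : rt a b (C x) = 1.
  have := phi_mutate_pair (additive_rt_at p a b) sk' ba' (x := x) (o := y).
  rewrite mutateK // !rt_atE tz => -> //; first by rewrite eq_sym.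
  by move=> v vx vy; rewrite rt_atE t0.
have vy : rt a b (C y) = 1 by rewrite -cluster_neq.
have v0 v : v != x -> v != y -> rt a b (C v) = 0.
  by move=> vnx vny; rewrite -cluster_neq // t0.
have pot : potential rat S (rt_at p a b) (alpha_at p a b).
  (* An index strictly between [a] and [b] would split the value 1 at [x] into two positive
     integers, as neither partial root is supported on [y] alone. *)
  apply: (inv_cover iS) => // d da db; apply/negP => /andP[/forallP h1 /forallP h2].
  have z1 v : v != x -> v != y -> rt a d (C v) = 0 /\ rt d b (C v) = 0.
    move=> vnx vny; have := h1 v; have := h2 v; have := v0 v vnx vny.
    by rewrite -(rt_trans a d b); lia.
  have pos c e u w : c != e -> (forall v, v != u -> v != w -> rt c e (C v) = 0) ->
     (forall v, 0 <= rt c e (C v)) -> 0 < rt c e (C u).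
    move=> ce hz hp; have [v vw vn] := sp p ce w.
    case: (eqVneq v u) => [<-|vu]; last by rewrite hz // eqxx in vn.
    by rewrite lt_def vn hp.
  have ad : a != d by rewrite eq_sym.
  have p1 := pos _ _ x y ad (fun v h h' => proj1 (z1 v h h')) h1.
  have p2 := pos _ _ x y db (fun v h h' => proj2 (z1 v h h')) h2.
  by move: vx; rewrite -(rt_trans a d b); lia.
have xy : x != y by rewrite eq_sym.
have pa : rt_at p a b (alpha_at p a b) = 2 by rewrite /rt_at ffunE eqxx rt_alpha_self.
have e := potential_exchange (additive_rt_at p a b) sk ba pa xy vx vy v0 pot.
by rewrite -[RHS]opprK -e opprB mutate_weight_neq.
Qed.

(** If there were twins before, [x] is not one of them, because only its sign would have changed; so
    the pair and its weights have stayed the same. *)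
Lemma twins_step a b y z : twins C' a b y z -> weight S' y - weight S' z = alpha_at p a b.
Proof.
move=> tw; have ab := twins_irr tw; have yz := twins_neq tw.
case: (tricho gS a b) => [dm|dm|[y0 [z0 tw0]]]; first exact: dominates_twins_step.
  have := dominates_twins_step dm (twins_opp tw); rewrite alpha_at_opp => /(congr1 -%R).
  by rewrite opprB opprK.
have yz0 := twins_neq tw0; have [ty tz _ t0] := tw; have [ty0 tz0 _ t00] := tw0.
have z0x : z0 != x.
  apply/eqP => e; subst z0.
  have := phi_mutate_pair (additive_rt_at p a b) sk ba (x := x) (o := y0).
  rewrite !rt_atE tz0 eq_sym => /(_ yz0 (fun v h1 h2 => t00 v h2 h1)) hx.
  case: (eqVneq z x) => [e|zx]; first by move: tz; rewrite e hx.
  move: tz; rewrite cluster_neq //; case: (eqVneq z y0) => [->|zy]; first by rewrite ty0.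
  by rewrite t00.
have y0x : y0 != x.
  apply/eqP => e; subst y0.
  have := phi_mutate_pair (additive_rt_at p a b) sk ba yz0.
  rewrite !rt_atE ty0 => /(_ t00) hx.
  case: (eqVneq y x) => [e|yx]; first by move: ty; rewrite e hx.
  move: ty; rewrite cluster_neq //; case: (eqVneq y z0) => [->|yz']; first by rewrite tz0.
  by rewrite t00.
rewrite -(inv_twins iS tw0) -(mutate_weight_neq S y0x) -(mutate_weight_neq S z0x).
rewrite -(cluster_neq y0x) in ty0; rewrite -(cluster_neq z0x) in tz0.
have -> : y0 = y.
  apply/eqP/negP => /negP n1; case: (eqVneq y0 z) => [e|n2]; first by move: ty0; rewrite e tz.
  by move: ty0; rewrite t0.
have -> // : z0 = z.
apply/eqP/negP => /negP n1; case: (eqVneq z0 y) => [e|n2]; first by move: tz0; rewrite e ty.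
by move: tz0; rewrite t0.
Qed.

(** If the root had twins before, [potential_of_twin] applies. Otherwise [a] dominated [b] already,
    but indices between them may have become tied to [a] or [b] by twins. In the old interval there
    is a cover [(a1, b1)] such that [a1] is [a] or tied to it after the mutation, and likewise [b1]
    and [b]. Its potential passes through the mutation, and the reflections in the twins carry it to
    [(a, b)]. *)
Lemma cover_step a b : a != b -> dominates C' a b ->
  (forall d, d != a -> d != b -> ~~ (dominates C' a d && dominates C' d b)) ->
  potential rat S' (rt_at p a b) (alpha_at p a b).
Proof.
move=> ab dm' adj'; case: (tricho gS a b) => [dm|dm|[y0 [z0 tw0]]]; last first.
- have yz0 := twins_neq tw0; have [ty0 tz0 _ t00] := tw0.
  case: (eqVneq z0 x) => [e|z0x]; last first.
    by have := forallP dm' z0; rewrite cluster_neq // tz0.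
  subst z0; apply: (@potential_of_twin _ _ S _ _ x y0 (additive_rt_at p a b) sk ba) => //.
  + by rewrite eq_sym.
  + by move=> v vx vy; rewrite rt_atE t00.
  + exact: (inv_twins iS tw0).
- by case: (dominates_flip _ dm dm'); rewrite eq_sym.
have refl : reflexive (dominates C) by move=> c; apply/forallP => v; rewrite /rt subrr.
have tr : transitive (dominates C) by move=> c d e h1 h2; exact: dominates_trans h1 h2.
have anti c d : c != d -> dominates C c d -> ~~ dominates C d c.
  by move=> cd; apply: dominates_anti => //; exact: sp.
(* [a1] is as low as possible among the indices of the old interval that become tied to [a], and
   [b1] comes directly below [a1]. *)
pose X d := (d == a) || [&& d != b, dominates C a d, dominates C d b, ~~ dominates C' a d & ~~ dominates C' d a].
have [|a1 Xa1 a1min] := exists_extremal (X := X) (x0 := a) _ refl tr anti; first by rewrite /X eqxx.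
have aa1 : dominates C a a1 by case/orP: Xa1 => [/eqP ->|/and5P[]].
have a1b : dominates C a1 b by case/orP: Xa1 => [/eqP ->|/and5P[]].
have a1nb : a1 != b by case/orP: Xa1 => [/eqP ->|/and5P[]].
pose Y d := [&& d != a1, dominates C a1 d & dominates C d b].
have [||||b1 Yb1 b1max] := @exists_extremal _ (fun c d => dominates C d c) Y b.
- by rewrite /Y eq_sym a1nb a1b refl.
- exact: refl.
- by move=> c d e h1 h2; apply: tr h2 h1.
- by move=> c d cd h; apply: anti; rewrite // eq_sym.
have /and3P[b1a1 a1b1 b1b] := Yb1.
have b1a : b1 != a.
  apply/eqP => e; subst b1; case: (eqVneq a a1) => [e|aa]; first by rewrite e eqxx in b1a1.
  by move: a1b1; apply/negP; apply: anti.
have pot : potential rat S (rt_at p a1 b1) (alpha_at p a1 b1).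
  apply: (inv_cover iS) => //; first by rewrite eq_sym.
  move=> d da db; apply/negP => /andP[h1 h2]; have := b1max d.
  by rewrite /Y da h1 (tr _ _ _ h2 b1b) db h2 => /(_ isT isT).
have [cS' bS'] := andP (gS' p).
have twa : a1 = a \/ exists y z, twins C' a a1 y z.
  case/orP: Xa1 => [/eqP ->|/and5P[_ _ _ /negP n1 /negP n2]]; first by left.
  by right; case: (tricho gS' a a1).
(* By the choice of [a1], the index [b1] is not tied to [a], so [a] dominates it after the mutation;
   as [a] covers [b], the index [b1] no longer dominates [b]. *)
have twb : b1 = b \/ exists y z, twins C' b1 b y z.
  case: (eqVneq b1 b) => [->|nb]; [by left|right].
  have Xb1 : ~~ X b1.
    by apply/negP => Xb; have := a1min _ Xb b1a1; rewrite a1b1.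
  have ab1 := tr _ _ _ aa1 a1b1.
  have nflip : ~ dominates C' b1 a by apply: dominates_flip; rewrite // eq_sym.
  have d1 : dominates C' a b1.
    by move: Xb1; rewrite /X (negbTE b1a) nb ab1 b1b /=; case: (dominates C' a b1) => //= /negPn.
  have := adj' _ b1a nb; rewrite d1 /= => /negP n2.
  by case: (tricho gS' b1 b) => // h; case: (dominates_flip nb b1b h).
have d1 : dominates C' a1 b.
  case: twa => [->//|[y [z tw]]].
  by apply: (dominates_twins_l cS' bS' (sp' p) ab _ (twins_irr tw) dm' tw); rewrite eq_sym.
have d2 : dominates C' a1 b1.
  case: twb => [->//|[y [z tw]]].
  by apply: (dominates_twins_r cS' bS' (sp' p) a1nb _ _ d1 (twins_opp tw)); rewrite eq_sym // (twins_irr tw).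
have pot' : potential rat S' (rt_at p a1 b1) (alpha_at p a1 b1).
  apply: potential_mutate pot => //; first exact: additive_rt_at.
  - by apply/spread_unsupported/sp; rewrite eq_sym.
  - exact/forallP.
  - exact/forallP.
have pot2 : potential rat S' (rt_at p a b1) (alpha_at p a b1).
  case: twa pot' => [->//|[y [z tw]]] pot'.
  have := potential_swap sk' ba' (twins_irr tw) tw (twins_step tw) pot'.
  by rewrite tpermR tpermD // eq_sym.
case: twb pot2 => [->//|[y [z tw]]] pot2.
have := potential_swap sk' ba' (twins_irr tw) tw (twins_step tw) pot2.
by rewrite tpermL tpermD // eq_sym.
Qed.

Lemma invariant_mutate : invariant S' p.
Proof. by split; [apply: twins_step|apply: cover_step]. Qed.

End Step.

End Invariant.

Lemma flatten_filter_sorted (T : Type) (f : T -> nat) (r : seq T) n :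
  sorted (fun x y => (f x <= f y)%N) r ->
  flatten [seq [seq x <- r | f x == j] | j <- iota 0 n] = [seq x <- r | (f x < n)%N].
Proof.
move=> sr; elim: n => [|n IH].
  by rewrite /=; elim: r {sr} => //= x r <-.
rewrite -addn1 iotaD map_cat flatten_cat IH add0n /= cats0 addn1.
have tr : transitive (fun x y => (f x <= f y)%N) by move=> x y z; apply: leq_trans.
elim: r sr {IH} => //= x r IH sx; have sr := path_sorted sx.
case: (ltngtP (f x) n) => h; rewrite ?ltnS.
- by rewrite (ltnW h) /= IH.
- by rewrite leqNgt h /= IH.
rewrite h leqnn /= -IH //.
have -> // : [seq y <- r | (f y < n)%N] = [::].
have := order_path_min tr sx; elim: r {IH sx sr} => //= y r IH /andP[xy hr].
by move: xy; rewrite h ltnNge => -> /=; apply: IH.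
Qed.

(** * Decorated ordered set partitions *)

Section Position.
Variable k : nat.
Implicit Types (r q : osp k) (l : weightP k) (a b : 'I_k).

Definition pos (s : seq {set 'I_k}) a := find (fun B : {set 'I_k} => a \in B) s.

Lemma osp_blocksP r : is_osp r. Proof. by case: r. Qed.

Lemma osp_uniq r : uniq r. Proof. by case/andP: (osp_blocksP r). Qed.

Lemma osp_mem r a : has (fun B : {set 'I_k} => a \in B) r.
Proof.
have /andP[_ /and3P[/eqP cv _ _]] := osp_blocksP r.
have : a \in [set: 'I_k] by rewrite inE.
rewrite -cv => /bigcupP[B]; rewrite inE => Br aB.
by apply/hasP; exists B.
Qed.

Lemma osp_disjoint r A B a : A \in (r : seq _) -> B \in (r : seq _) -> a \in A -> a \in B -> A = B.
Proof.
have /andP[_ /and3P[_ /trivIsetP tr _]] := osp_blocksP r => Ar Br aA aB.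
apply/eqP; apply: contraT => /(tr A B); rewrite !inE => /(_ Ar Br).
by rewrite disjoints_subset => /subsetP/(_ a aA); rewrite inE aB.
Qed.

Lemma osp_nonempty r B : B \in (r : seq _) -> exists a, a \in B.
Proof.
have /andP[_ /and3P[_ _ s0]] := osp_blocksP r => Br; apply/set0Pn.
by apply: contraNneq s0 => <-; rewrite inE.
Qed.

Lemma pos_lt r a : (pos r a < size r)%N.
Proof. by rewrite -has_find osp_mem. Qed.

Lemma mem_nth_pos r a : a \in nth set0 r (pos r a).
Proof. exact: (nth_find set0 (osp_mem r a)). Qed.

Lemma pos_nth r a i : (i < size r)%N -> a \in nth set0 r i -> pos r a = i.
Proof.
move=> ir ai; have pr := pos_lt r a.
apply/eqP; rewrite -(nth_uniq set0 pr ir (osp_uniq r)); apply/eqP.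
apply: (@osp_disjoint r _ _ a); rewrite ?mem_nth //; exact: mem_nth_pos.
Qed.

Lemma pos_levels l a b : rt a b l > 0 -> (pos (osp_of l) a < pos (osp_of l) b)%N.
Proof.
rewrite /rt subr_gt0 => lab; have pa := pos_lt (osp_of l) a; have pb := pos_lt (osp_of l) b.
have ha := mem_nth_pos (osp_of l) a; have hb := mem_nth_pos (osp_of l) b.
rewrite ltnNge leq_eqVlt; apply/negP => /orP[/eqP e|lt].
  rewrite -e in ha; have := mem_nth set0 pb; rewrite mem_levels => /existsP[c /eqP e'].
  by move: ha hb; rewrite e' !inE => /eqP h1 /eqP h2; move: lab; rewrite h1 h2 ltxx.
pose R (A B : {set 'I_k}) := [forall c in A, forall d in B, coord l d <= coord l c].
have : pairwise R (osp_of l).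
  apply: (subseq_pairwise (undup_subseq _)).
  rewrite pairwise_map; apply: (@sub_pairwise _ (fun a b => coord l b <= coord l a)).
    move=> c d cd; apply/forall_inP => c'; rewrite inE => /eqP ->.
    by apply/forall_inP => d'; rewrite inE => /eqP ->.
  rewrite -sorted_pairwise; last by move=> c d e h1 h2; apply: le_trans h2 h1.
  by apply: sort_sorted => c d; apply: le_total.
move=> /(pairwiseP set0)/(_ _ _ pb pa lt)/forall_inP/(_ b hb)/forall_inP/(_ a ha).
by rewrite leNgt lab.
Qed.

Lemma pos_levels_eq l a b : rt a b l = 0 -> pos (osp_of l) a = pos (osp_of l) b.
Proof.
move=> /eqP; rewrite subr_eq0 => /eqP e; apply: pos_nth; first exact: pos_lt.
have := mem_nth_pos (osp_of l) b; have := mem_nth set0 (pos_lt (osp_of l) b).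
by rewrite mem_levels => /existsP[c /eqP ->]; rewrite !inE e.
Qed.

Lemma pos_levels_lt l a b : (pos (osp_of l) a < pos (osp_of l) b)%N -> rt a b l > 0.
Proof.
move=> h; case: (ltgtP (rt a b l) 0) => // [h1|/pos_levels_eq e]; last by rewrite e ltnn in h.
have : 0 < rt b a l by rewrite rt_opp oppr_gt0.
by move/pos_levels; rewrite ltnNge (ltnW h).
Qed.

Lemma bigcup_seq_mem (s : seq {set 'I_k}) a : (a \in \bigcup_(B <- s) B) = has (fun B : {set 'I_k} => a \in B) s.
Proof. by elim: s => [|B s IH]; rewrite ?big_nil ?big_cons inE //= IH. Qed.

(** Refinement is a condition on pairs of indices. For the converse, [f] sends a block of [r] to the
    position of the block of [osp_of l] that contains it; [f] is monotone along [r], and its fibres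
    are the pieces to be united. *)
Lemma refinesP r l : reflect (forall a b, rt a b l > 0 -> (pos r a < pos r b)%N) (refines r (osp_of l)).
Proof.
apply: (iffP idP) => [/existsP[sh /andP[/eqP sz /eqP e]] a b /pos_levels ab|h].
  set sh' := [seq nat_of_ord i | i <- sh] in sz e.
  have fl : flatten (reshape sh' r) = r by apply: reshapeKr; rewrite sz.
  have szq : size (reshape sh' r) = size (osp_of l) by rewrite -[in RHS]e size_map.
  have qa := pos_lt (osp_of l) a; have qb := pos_lt (osp_of l) b.
  set i := pos (osp_of l) a in ab qa; have mem j c : (j < size (osp_of l))%N ->
     has (fun B : {set 'I_k} => c \in B) (nth [::] (reshape sh' r) j) -> pos (osp_of l) c = j.
    move=> jq hc; apply: pos_nth => //; rewrite -e (nth_map [::]) ?szq //.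
    by rewrite bigcup_seq_mem.
  have hai : has (fun B : {set 'I_k} => a \in B) (nth [::] (reshape sh' r) i).
    by have := mem_nth_pos (osp_of l) a; rewrite -{1}e (nth_map [::]) ?szq // bigcup_seq_mem.
  have sp : (r : seq _) = flatten (take i.+1 (reshape sh' r)) ++ flatten (drop i.+1 (reshape sh' r)).
    by rewrite -flatten_cat cat_take_drop fl.
  have ha : has (fun B : {set 'I_k} => a \in B) (flatten (take i.+1 (reshape sh' r))).
    by rewrite (take_nth [::]) ?szq // flatten_rcons has_cat hai orbT.
  have hb : ~~ has (fun B : {set 'I_k} => b \in B) (flatten (take i.+1 (reshape sh' r))).
    apply/negP => /hasP[B /flattenP[s] /(nthP [::])[j]]; rewrite size_take_min leq_min => /andP[ji jr].
    rewrite nth_take // => <- Bs bB; have := mem j b.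
    rewrite -szq => /(_ jr) => hj; have : pos (osp_of l) b = j by apply: hj; apply/hasP; exists B.
    by move=> ej; move: ab; rewrite ej; lia.
  rewrite /pos sp !find_cat ha (negbTE hb); apply: leq_trans (leq_addr _ _).
  by rewrite -has_find.
set q := osp_of l; pose f (B : {set 'I_k}) := if [pick c in B] is Some c then pos q c else 0%N.
have fE B c : B \in (r : seq _) -> c \in B -> f B = pos q c.
  move=> Br cB; rewrite /f; case: pickP => [c' c'B|/(_ c)]; last by rewrite cB.
  have e : pos r c = pos r c'.
    have ib : (index B r < size r)%N by rewrite index_mem.
    by rewrite !(@pos_nth r _ (index B r)) // nth_index.
  by case: (ltngtP (pos q c') (pos q c)) => // /pos_levels_lt/h; rewrite e ltnn.
have sf : sorted (fun A B => (f A <= f B)%N) r.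
  apply: pairwise_sorted; apply/(pairwiseP set0) => i j ir jr ij.
  have [a ha] := osp_nonempty (mem_nth set0 ir); have [b hb] := osp_nonempty (mem_nth set0 jr).
  rewrite (fE _ a) ?mem_nth // (fE _ b) ?mem_nth // leqNgt; apply/negP => /pos_levels_lt/h.
  by rewrite (pos_nth ir ha) (pos_nth jr hb); rewrite ltnNge (ltnW ij).
pose ss := [seq [seq B <- r | f B == j] | j <- iota 0 (size q)].
have fss : flatten ss = r.
  rewrite flatten_filter_sorted //; apply/all_filterP/allP => B Br.
  by have [a aB] := osp_nonempty Br; rewrite (fE _ a) //; exact: pos_lt.
have szr : (size r <= k)%N by case: r h fE sf ss fss => [[s /= hs] ?].
have shb : all (fun n => (n < k.+1)%N) (shape ss).
  apply/allP => n /mapP[s /mapP[j _ ->] ->]; rewrite size_filter ltnS.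
  exact: leq_trans (count_size _ _) szr.
pose sh := [seq inord n : 'I_k.+1 | n <- shape ss].
have szsh : size sh == size q by rewrite !size_map size_iota.
apply/existsP; exists (Tuple szsh).
have -> : [seq nat_of_ord i | i <- Tuple szsh] = shape ss.
  rewrite /= -map_comp; rewrite -[RHS]map_id; apply/eq_in_map => n hn /=.
  by rewrite inordK //; apply: (allP shb).
have e1 : sumn (shape ss) = size r by rewrite -size_flatten fss.
have e2 : reshape (shape ss) r = ss by have := flattenK ss; rewrite fss.
cbv zeta; rewrite e1 eqxx e2; apply/eqP.
apply: (@eq_from_nth _ set0); rewrite ?size_map ?size_iota // => j jq.
rewrite (nth_map [::]) ?size_map ?size_iota // (nth_map 0%N) ?size_iota // nth_iota // add0n.
apply/setP => c; rewrite bigcup_seq_mem; apply/hasP/idP => [[B]|cj].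
  rewrite mem_filter => /andP[/eqP fB Br] cB; rewrite -fB (fE _ c) //; exact: mem_nth_pos.
exists (nth set0 r (pos r c)); last exact: mem_nth_pos.
have Br : nth set0 r (pos r c) \in (r : seq _) by rewrite mem_nth ?pos_lt.
by rewrite mem_filter Br andbT (fE _ c) ?mem_nth_pos // (pos_nth jq cj).
Qed.

End Position.

(** * The dosp away from twins *)

Section Stability.
Variables (k : nat) (I : finType) (x : I).
Implicit Types (C : I -> weightP k).

Definition clustered C := pairwise_compatible C /\ basic C.

Lemma additive_sum (O : {set I}) C a b : rt a b (\sum_(i in O) C i) = \sum_(i in O) rt a b (C i).
Proof. exact: (am_sum (additive_rt a b)). Qed.

Definition upper_bound C r := [forall q in [set osp_of (\sum_(i in O) C i) | O : {set I} in rc_classes C], refines r q].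

Lemma osp_join_eq (A B : {set osp k}) :
  (forall r, [forall q in A, refines r q] = [forall q in B, refines r q]) -> osp_join A = osp_join B.
Proof.
move=> e; rewrite /osp_join; apply: eq_pick => p; rewrite /is_join e; congr (_ && _).
by apply: eq_forallb => r; rewrite e.
Qed.

Lemma rc_class_twins C a b y z i : clustered C -> twins C a b y z ->
  (y \in rc_class C i) = (z \in rc_class C i).
Proof.
move=> [cC bC] [ty tz _ _].
have py : 0 < rt a b (C y) by rewrite ty.
have nz : rt a b (C z) < 0 by rewrite tz.
have [r1 r2 _ _ _] := opposed_root_conjugate cC bC py nz.
by rewrite !inE; apply/idP/idP => h; apply: connect_trans h (connect1 _).
Qed.

(** In the sum over a class, twins cancel, so a root that is positive on a class sum comes from
    domination. Conversely, domination makes all values nonnegative, and [spread] makes some class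
    sum positive. *)
Lemma upper_boundP C r : clustered C -> (forall a b, a != b -> spread C a b) ->
  upper_bound C r <-> forall a b, a != b -> dominates C a b -> (pos r a < pos r b)%N.
Proof.
move=> cl sp; have [cC bC] := cl; split => [/forall_inP h a b ab /forallP dm|h].
  have [v _ vn] := sp a b ab x.
  have /(_ (osp_of (\sum_(i in rc_class C v) C i))) := h.
  have -> : osp_of (\sum_(i in rc_class C v) C i) \in
      [set osp_of (\sum_(i in O) C i) | O : {set I} in rc_classes C].
    by apply/imsetP; exists (rc_class C v) => //; apply/imsetP; exists v.
  move=> /(_ isT)/refinesP; apply; rewrite additive_sum (bigD1 v) /=; last by rewrite inE.
  by rewrite ltr_wpDr ?lt_def ?vn ?dm // sumr_ge0.
apply/forall_inP => q /imsetP[O /imsetP[i _ ->] ->]; apply/refinesP => a b.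
rewrite additive_sum => pos_ab; have ab : a != b.
  by apply: contraTneq pos_ab => ->; rewrite big1 ?ltxx // => j _; rewrite /rt subrr.
apply: h => //; have [//|/forallP h|[y [z tw]]] := trichotomy cC bC a b.
  by move: pos_ab; rewrite ltNge sumr_le0 // => j _; rewrite rt_opp oppr_le0.
have yz := twins_neq tw; have [ty tz _ t0] := tw; have e := rc_class_twins i cl tw.
move: pos_ab; rewrite (eq_bigr (fun j => (j == y)%:Z - (j == z)%:Z)) => [|j _].
  case: (boolP (y \in rc_class C i)) => hy.
    rewrite sumrB (bigD1 y) //= (bigD1 z (P := fun j => j \in _)) -?e //= !eqxx.
    by rewrite !big1 ?ltxx // => j /andP[_ /negbTE ->].
  rewrite big1 ?ltxx // => j jc.
  case: (eqVneq j y) => [ej|_]; first by rewrite -ej jc in hy.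
  by case: (eqVneq j z) => [ej|_]; first by rewrite e -ej jc in hy.
case: (eqVneq j y) => [->|jy]; first by rewrite ty (negbTE yz).
by case: (eqVneq j z) => [->|jz]; [rewrite tz|rewrite t0].
Qed.

Lemma ground_set_eq C C' (O : {set I}) : (forall i, i \in O -> C' i = C i) ->
  ground_set C O = ground_set C' O.
Proof.
move=> e; apply/setP => a; rewrite [LHS]in_set [RHS]in_set.
apply/exists_inP/exists_inP => -[i iO /exists_inP[j jO h]]; exists i => //;
  by apply/exists_inP; exists j => //; move: h; rewrite !e.
Qed.

Lemma star_at_eq C C' (O : {set I}) B eps nu : (forall i, i \in O -> C' i = C i) ->
  star_at C O B eps nu = star_at C' O B eps nu.
Proof.
move=> e; congr [&& _, _ & _].
  by apply/forall_inP/forall_inP => h i iO; have := h i iO; rewrite e.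
apply/forall_inP/forall_inP => h a aB; have /exists_inP[i iO hi] := h a aB;
  by apply/exists_inP; exists i => //; move: hi; rewrite e.
Qed.

Lemma has_sign_eq C C' (O : {set I}) B eps : (forall i, i \in O -> C' i = C i) ->
  has_sign C O B eps = has_sign C' O B eps.
Proof.
move=> e; apply/exists_inP/exists_inP => -[i iO /exists_inP[a aB h]]; exists i => //;
  by apply/exists_inP; exists a => //; move: h; rewrite e // (star_at_eq _ _ _ e).
Qed.

(** Twins away from [x] are read off unchanged vectors, and domination cannot flip, because a root
    is nonzero somewhere off [x]. So the order relation and the osp stay the same; the signs come
    from classes that avoid [x]. *)
Lemma dosp_stable C C' : clustered C -> clustered C' ->
  (forall a b, a != b -> spread C a b) -> (forall a b, a != b -> spread C' a b) ->
  (forall v, v != x -> C' v = C v) ->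
  (forall a b z, ~ twins C a b x z) -> (forall a b z, ~ twins C' a b x z) ->
  dosp C = dosp C'.
Proof.
move=> cl cl' sp sp' eC nt nt'.
have nt2 a b z : ~ twins C a b z x by move/twins_opp/nt.
have nt2' a b z : ~ twins C' a b z x by move/twins_opp/nt'.
have [cC bC] := cl; have [cC' bC'] := cl'.
have tw a b y z : twins C a b y z <-> twins C' a b y z.
  split=> t; have [ty tz _ _] := t.
    have yx : y != x by apply/eqP => e; subst y; case: (nt _ _ _ t).
    have zx : z != x by apply/eqP => e; subst z; case: (nt2 _ _ _ t).
    by apply: opposed_twins; rewrite ?eC ?ty ?tz.
  have yx : y != x by apply/eqP => e; subst y; case: (nt' _ _ _ t).
  have zx : z != x by apply/eqP => e; subst z; case: (nt2' _ _ _ t).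
  by apply: opposed_twins; rewrite -?eC ?ty ?tz.
have flip a b : a != b -> dominates C a b -> dominates C' b a -> False.
  move=> ab /forallP h1 /forallP h2; have [v vx /eqP] := sp a b ab x; apply.
  by have := h1 v; have := h2 v; rewrite eC // (rt_opp a b); lia.
have dm a b : a != b -> dominates C a b = dominates C' a b.
  move=> ab; apply/idP/idP => h.
    have [//|/(flip _ _ ab h)[]|[y [z /tw t]]] := trichotomy cC' bC' a b.
    by case: (dominates_twins h t).
  have [//|h'|[y [z /tw t]]] := trichotomy cC bC a b; last by case: (dominates_twins h t).
  by case: (flip b a); rewrite // eq_sym.
have ePi : Pi C = Pi C'.
  apply: osp_join_eq => r; apply/idP/idP.
    by move/(upper_boundP _ cl sp) => h; apply/upper_boundP => // a b ab; rewrite -dm //; apply: h.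
  by move/(upper_boundP _ cl' sp') => h; apply/upper_boundP => // a b ab; rewrite dm //; apply: h.
have rcx z : ~ root_conjugate (C x) (C z).
  by move/(root_conjugate_twins cC bC) => [a [b [_ /nt]]].
have rcx2 z : ~ root_conjugate (C z) (C x).
  by move/(root_conjugate_twins cC bC) => [a [b [_ /nt2]]].
have rcx' z : ~ root_conjugate (C' x) (C' z).
  by move/(root_conjugate_twins cC' bC') => [a [b [_ /nt']]].
have rcx2' z : ~ root_conjugate (C' z) (C' x).
  by move/(root_conjugate_twins cC' bC') => [a [b [_ /nt2']]].
have rc y z : root_conjugate (C y) (C z) = root_conjugate (C' y) (C' z).
  case: (eqVneq y x) => [->|yx].
    by apply/idP/idP => h; [case: (rcx _ h)|case: (rcx' _ h)].
  case: (eqVneq z x) => [->|zx]; last by rewrite !eC.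
  by apply/idP/idP => h; [case: (rcx2 _ h)|case: (rcx2' _ h)].
have cls i : rc_class C i = rc_class C' i.
  by apply/setP => j; rewrite !inE; apply: eq_connect => y z; apply: rc.
have clss : rc_classes C = rc_classes C' by apply: eq_imset.
(* Without twins, [x] is alone in its class. *)
have small O : O \in rc_classes C -> (2 < #|O|)%N -> forall i, i \in O -> C' i = C i.
  move=> /imsetP[j _ ->] big i ij; apply: eC; apply: contraTneq big => ei; subst i.
  have {}ij : j = x.
    apply/eqP/negP => /negP jx; move: ij; rewrite inE => /connectP[s ps ls].
    case: s ps ls jx => [|y s] /=; first by move=> _ ->; rewrite eqxx.
    move=> ps ls _; case/lastP: s ps ls => [|s z]; rewrite /= ?last_rcons.
      by rewrite andbT => h e; subst y; case: (rcx2 _ h).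
    by rewrite rcons_path => /andP[_ /andP[_ h]] e; subst z; case: (rcx2 _ h).
  subst j; rewrite -leqNgt; have -> : rc_class C x = [set x]; last by rewrite cards1.
  apply/setP => w; rewrite in_set1 inE; apply/idP/eqP => [|->]; last exact: connect0.
  by move=> /connectP[[|u s] /= ]; [move=> _ ->|move=> /andP[h]; case: (rcx _ h)].
have eO O : O \in rc_classes C -> (2 < #|O|)%N -> ground_set C O = ground_set C' O /\
    forall B eps, has_sign C O B eps = has_sign C' O B eps.
  move=> Oc Ob; have eOC := small O Oc Ob.
  by split=> [|B eps]; [apply: ground_set_eq|apply: has_sign_eq] => i /eOC.
have bs B : block_sign C B = block_sign C' B.
  rewrite /block_sign -clss; apply: eq_pick => eps.
  apply/exists_inP/exists_inP => -[O Oc /and3P[Ob h1 h2]]; have [e1 e2] := eO O Oc Ob.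
    by exists O; [exact: Oc|rewrite Ob -e1 -e2 h1 h2].
  by exists O; [exact: Oc|rewrite Ob e1 e2 h1 h2].
unfold dosp; rewrite ePi; apply: (congr1 (fun f => omap f (Pi C'))).
apply: functional_extensionality => p; apply: (congr1 (pair p)).
by apply/ffunP => B; rewrite [LHS]ffunE [RHS]ffunE bs.
Qed.

End Stability.

(** * Two punctures at once *)

Section Main.
Variables (k : nat) (V P : finType).
Local Notation W := {ffun P -> weightP k}.
Implicit Types (S R : seed V W) (p q : P) (a b c d : 'I_k).

Definition supported2 S q a b (x o : V) := forall v, v != x -> v != o -> rt a b (cluster S q v) = 0.

Definition isolated_pair S (x o : V) := forall v, quiver S v x = 0 /\ quiver S v o = 0.

(** Without arrows at [x] and [o], mutations cannot enlarge the support of either root; this makes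
    the property invariant in both directions. *)
Definition entangled S p q := exists x o a b c d,
  [/\ x != o, a != b, c != d, isolated_pair S x o & supported2 S p a b x o /\ supported2 S q c d x o].

Lemma posp0 : posp 0 = 0. Proof. by rewrite /posp maxxx. Qed.

Lemma isolated_mutate S x o w : skew S -> isolated_pair S x o -> isolated_pair (mutate w S) x o.
Proof.
move=> sk h v; have half y : (forall u, quiver S u y = 0) -> quiver (mutate w S) v y = 0.
  move=> hy; have hy' u : quiver S y u = 0 by rewrite sk hy oppr0.
  case: (eqVneq v w) => [->|vw]; first by rewrite mutate_quiver_l hy oppr0.
  case: (eqVneq y w) => [e|yw]; first by rewrite -e mutate_quiver_r hy oppr0.
  by rewrite mutate_quiverE // !hy posp0 mul0r mulr0 !addr0.
by split; apply: half => u; have [] := h u.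
Qed.

Lemma supported2_mutate S q a b x o w : skew S -> balanced S -> isolated_pair S x o ->
  supported2 S q a b x o -> supported2 (mutate w S) q a b x o.
Proof.
move=> sk ba iso h v vx vo; case: (eqVneq v w) => [e|vw]; last first.
  by rewrite /cluster mutate_weight_neq //; apply: h.
subst w; rewrite -rt_atE (phi_mutate v (additive_rt_at q a b)) // rt_atE h // oppr0 add0r.
apply: big1 => u _; rewrite rt_atE; have [e1 e2] := iso v.
case: (eqVneq u x) => [->|ux]; first by rewrite e1 posp0 mulr0.
case: (eqVneq u o) => [->|uo]; first by rewrite e2 posp0 mulr0.
by rewrite h // mul0r.
Qed.

Lemma entangled_mutate S p q w : skew S -> balanced S -> entangled S p q -> entangled (mutate w S) p q.
Proof.
move=> sk ba [x [o [a [b [c [d [xo ab cd iso [h1 h2]]]]]]]].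
exists x, o, a, b, c, d; split=> //; first exact: isolated_mutate.
by split; apply: supported2_mutate.
Qed.

Lemma not_entangled_mutate S p q w : skew S -> balanced S ->
  ~ entangled S p q -> ~ entangled (mutate w S) p q.
Proof.
move=> sk ba h h'; apply: h; rewrite -(mutateK w sk ba).
by apply: entangled_mutate h'; [apply: mutate_skew|apply: mutate_balanced].
Qed.

Lemma dosp_change S x p : skew S -> balanced S -> seed_spread S ->
  good_seed S -> good_seed (mutate x S) ->
  dosp (cluster S p) <> dosp (cluster (mutate x S) p) ->
  exists o a b, twins (cluster S p) a b x o \/ twins (cluster (mutate x S) p) a b x o.
Proof.
move=> sk ba sp gS gS' nd.
have [[o [a [b t]]]|n1] := classic (exists o a b, twins (cluster S p) a b x o).
  by exists o, a, b; left.
have [[o [a [b t]]]|n2] := classic (exists o a b, twins (cluster (mutate x S) p) a b x o).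
  by exists o, a, b; right.
case: nd; apply: (dosp_stable (x := x)) => //.
- exact/andP/gS.
- exact/andP/gS'.
- exact: sp.
- exact: spread_mutate.
- by move=> v vx; rewrite /cluster mutate_weight_neq.
- by move=> a b z t; apply: n1; exists z, a, b.
- by move=> a b z t; apply: n2; exists z, a, b.
Qed.

Lemma twins_mutate S x p a b o : skew S -> balanced S -> twins (cluster S p) a b x o ->
  [/\ x != o, supported2 (mutate x S) p a b x o, rt a b (cluster (mutate x S) p o) = -1 &
      rt a b (cluster (mutate x S) p x) = -1].
Proof.
move=> sk ba tw; have xo := twins_neq tw; have [tx to _ t0] := tw; split=> //.
- by move=> v vx vo; rewrite /cluster mutate_weight_neq //; apply: t0.
- by rewrite /cluster mutate_weight_neq // eq_sym.
- by rewrite -rt_atE (phi_mutate_pair (additive_rt_at p a b) sk ba xo) // rt_atE tx.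
Qed.

(** At [q] the weights of [x] and [o] agree, so no root at [q] can single out [x] on its positive
    side. *)
Lemma twins_not_twins S x p q a b c d o o' : skew S -> balanced S -> p != q ->
  weight S x - weight S o = alpha_at p a b -> twins (cluster S p) a b x o ->
  ~ twins (cluster S q) c d x o'.
Proof.
move=> sk ba pq e tw [tx to _ t0]; have xo := twins_neq tw.
have eq : cluster S q x = cluster S q o.
  apply/eqP; rewrite -subr_eq0; apply/eqP; have /ffunP/(_ q) := e.
  by rewrite !ffunE eq_sym (negbTE pq).
rewrite eq in tx; case: (eqVneq o o') => [h|oo]; first by move: tx; rewrite h to.
by move: tx; rewrite t0 // eq_sym.
Qed.

(** As the weights of [x] and [o] agree at [q], the support at [q] consists of the same pair.
    Balance for the root at [p], with values 1 and -1, and for the root at [q], with equal values,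
    forces the columns of both vertices to vanish. *)
Lemma twins_entangled S x p q a b c d o o' : skew S -> balanced S -> p != q ->
  weight S x - weight S o = alpha_at p a b -> twins (cluster S p) a b x o -> c != d ->
  supported2 S q c d x o' -> rt c d (cluster S q x) = -1 -> rt c d (cluster S q o') = -1 ->
  entangled S p q.
Proof.
move=> sk ba pq e tw cd sup qx qo; have xo := twins_neq tw; have [tx to _ t0] := tw.
have eq : cluster S q x = cluster S q o.
  apply/eqP; rewrite -subr_eq0; apply/eqP; have /ffunP/(_ q) := e.
  by rewrite !ffunE eq_sym (negbTE pq).
have oo : o' = o.
  apply/eqP/negP => /negP oo; move: qx; rewrite eq sup // eq_sym //.
subst o'; exists x, o, a, b, c, d; split=> //; first exact: twins_irr tw.
have pair r e1 f1 v : (forall w, w != x -> w != o -> rt e1 f1 (cluster S r w) = 0) ->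
    quiver S v x * rt e1 f1 (cluster S r x) + quiver S v o * rt e1 f1 (cluster S r o) = 0.
  move=> h; rewrite -[RHS](phi_out (additive_rt_at r e1 f1) sk ba v) (sum_supp2 xo) //.
  by move=> w wx wo; rewrite rt_atE h // mulr0.
move=> v; have := pair p a b v t0; have := pair q c d v sup; rewrite tx to qx qo.
by rewrite !mulr1 !mulrN1; lia.
Qed.

(** Twins at [p] and [q] on the same side of the mutation contradict each other directly; on
    opposite sides they are entangled. The invariant is called on at [p] alone, so either puncture
    may be chosen for this role. *)
Theorem dosp_change_unique S x p q : skew S -> balanced S -> seed_spread S ->
  good_seed S -> good_seed (mutate x S) -> invariant S p -> ~ entangled S p q -> p != q ->
  dosp (cluster S p) <> dosp (cluster (mutate x S) p) ->
  dosp (cluster S q) <> dosp (cluster (mutate x S) q) -> False.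
Proof.
move=> sk ba sp gS gS' iS ne pq.
have sk' := mutate_skew x sk; have ba' := mutate_balanced x sk ba.
have iS' := invariant_mutate sk ba sp gS gS' iS.
have ne' := not_entangled_mutate (w := x) sk ba ne.
move=> /(dosp_change sk ba sp gS gS')[o [a [b tp]]].
move=> /(dosp_change sk ba sp gS gS')[o' [c [d tq]]].
case: tp tq => tp [] tq.
- exact: (twins_not_twins sk ba pq (inv_twins iS tp) tp tq).
- have [_ h1 h2 h3] := twins_mutate sk' ba' tq; rewrite mutateK // in h1 h2 h3.
  apply: ne; apply: (twins_entangled sk ba pq (inv_twins iS tp) tp (twins_irr tq) h1 h3 h2).
- have [_ h1 h2 h3] := twins_mutate sk ba tq.
  apply: ne'; apply: (twins_entangled sk' ba' pq (inv_twins iS' tp) tp (twins_irr tq) h1 h3 h2).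
- exact: (twins_not_twins sk' ba' pq (inv_twins iS' tp) tp tq).
Qed.

End Main.

(* Corners and positions of a triangle *)
Local Close Scope ring_scope.

Lemma ordSS (c : 'I_3) : ordS (ordS c) = ord_pred c.
Proof. by apply: val_inj; case: c => [[|[|[|m]]] h]. Qed.

Lemma ord_predP (c : 'I_3) : ord_pred (ord_pred c) = ordS c.
Proof. by apply: val_inj; case: c => [[|[|[|m]]] h]. Qed.

Lemma ordS_neq (c : 'I_3) : (ordS c == c) = false.
Proof. by case: c => [[|[|[|m]]] h]. Qed.

Lemma ord_pred_neq (c : 'I_3) : (ord_pred c == c) = false.
Proof. by case: c => [[|[|[|m]]] h]. Qed.

Lemma ord_pred_ordS (c : 'I_3) : (ord_pred c == ordS c) = false.
Proof. by case: c => [[|[|[|m]]] h]. Qed.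

Lemma ordS_sym (c : 'I_3) : (c == ordS c) = false. Proof. by rewrite eq_sym ordS_neq. Qed.
Lemma ord_pred_sym (c : 'I_3) : (c == ord_pred c) = false. Proof. by rewrite eq_sym ord_pred_neq. Qed.
Lemma ordS_pred_neq (c : 'I_3) : (ordS c == ord_pred c) = false.
Proof. by rewrite eq_sym ord_pred_ordS. Qed.

Definition I3E := (ordSS, ord_predP, ordSK, ord_predK, ordS_neq, ord_pred_neq, ord_pred_ordS,
  ordS_sym, ord_pred_sym, ordS_pred_neq, eqxx).

Variant I3_spec (c : 'I_3) : 'I_3 -> Type :=
  | I3_same : I3_spec c c | I3_next : I3_spec c (ordS c) | I3_prev : I3_spec c (ord_pred c).

Lemma I3P c i : I3_spec c i.
Proof.
case: (eqVneq i c) => [->|h1]; first by constructor.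
case: (eqVneq i (ordS c)) => [->|h2]; first by constructor.
suff -> : i = ord_pred c by constructor.
by apply: val_inj; move: h1 h2; case: i c => [[|[|[|i]]] hi] [[|[|[|c]]] hc].
Qed.

Lemma big_I3 (R : Type) (idx : R) (op : Monoid.com_law idx) (c : 'I_3) (F : 'I_3 -> R) :
  \big[op/idx]_i F i = op (F c) (op (F (ordS c)) (F (ord_pred c))).
Proof.
rewrite (bigD1 c) //= (bigD1 (ordS c)) /= ?I3E //; congr (op _ (op _ _)).
rewrite (big_pred1 (ord_pred c)) // => i /=.
by case: (I3P c i); rewrite !I3E.
Qed.

Section Positions.
Variable k : nat.
Implicit Types (c i j m : 'I_3) (a b g : nat) (d e : position k).

(** The coordinates are listed clockwise from the corner [c]. [inord] is faithful as soon as
    [a + b + g = k], which accompanies every use. *)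
Definition pos3 c a b g : position k :=
  [ffun i => inord (if i == c then a else if i == ordS c then b else g)].

Lemma pos3P c a b g : a + b + g = k ->
  [/\ pos3 c a b g c = a :> nat, pos3 c a b g (ordS c) = b :> nat &
      pos3 c a b g (ord_pred c) = g :> nat].
Proof. by move=> h; split; rewrite ffunE !I3E inordK //; lia. Qed.

Lemma pos3_eq c a b g d : a + b + g = k ->
  (d == pos3 c a b g) = [&& d c == a :> nat, d (ordS c) == b :> nat & d (ord_pred c) == g :> nat].
Proof.
move=> h; have [h1 h2 h3] := pos3P c h; apply/eqP/and3P => [->|[/eqP e1 /eqP e2 /eqP e3]].
  by rewrite h1 h2 h3.
by apply/ffunP => i; apply: val_inj; case: (I3P c i) => /=; rewrite ?h1 ?h2 ?h3.
Qed.

Lemma pos3_self c d : \sum_i (d i : nat) = k -> d = pos3 c (d c) (d (ordS c)) (d (ord_pred c)).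
Proof.
move=> h; apply/eqP; rewrite pos3_eq ?eqxx //.
by rewrite -[RHS]h (big_I3 _ c) /= addnA.
Qed.

Lemma pos3_rot c a b g : a + b + g = k -> pos3 c a b g = pos3 (ordS c) b g a.
Proof.
move=> h; have [h1 h2 h3] := pos3P c h; apply/eqP.
by rewrite pos3_eq ?I3E ?h1 ?h2 ?h3 ?eqxx //; lia.
Qed.

Lemma pos3_sum c a b g : a + b + g = k -> \sum_i (pos3 c a b g i : nat) = k.
Proof. by move=> h; rewrite (big_I3 _ c); have [-> -> ->] := pos3P c h; rewrite /= addnA. Qed.

Lemma is_position_pos3 c a b g : a + b + g = k -> a < k -> b < k -> g < k ->
  is_position (pos3 c a b g).
Proof.
move=> h ak bk gk; rewrite /is_position pos3_sum // eqxx /=; apply/forallP => i.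
by have [h1 h2 h3] := pos3P c h; case: (I3P c i); rewrite ?h1 ?h2 ?h3.
Qed.

Lemma is_positionP d c : is_position d ->
  [/\ d c + d (ordS c) + d (ord_pred c) = k, d c < k, d (ordS c) < k & d (ord_pred c) < k].
Proof.
move=> /andP[/eqP h /forallP hk]; split=> //.
by rewrite -[RHS]h (big_I3 _ c) /= addnA.
Qed.

Lemma pos3_eq_self c d : is_position d -> d = pos3 c (d c) (d (ordS c)) (d (ord_pred c)).
Proof. by move=> /andP[/eqP h _]; apply: pos3_self. Qed.

End Positions.

Lemma connect_closed (T : finType) (e : rel T) (A : {pred T}) (x y : T) :
  (forall u v, u \in A -> e u v -> v \in A) -> x \in A -> connect e x y -> y \in A.
Proof.
move=> cl xA /connectP[s ps ->]; elim: s x xA ps => //= z s IH x xA /andP[xz].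
by apply: IH; apply: cl xz.
Qed.

(** * Nodes of a triangulation *)

Section Glue.
Variables (k : nat) (M : moduli) (D : triangulation).
Hypothesis adm : admissible M D.
Local Notation ng := (@node_glue k M D).
Implicit Types (t : tri D) (c i j s : 'I_3) (x y z : node k D) (d e : position k).

Lemma adm_regular : regular D.
Proof. by case: M adm => //= /andP[]. Qed.

Lemma glue_tri_neq t i t' j : glue (t, i) = (t', j) -> ~~ boundary_side (t, i) -> t != t'.
Proof.
move=> e; apply: contraNneq => tt; subst t'; rewrite /boundary_side e.
have /forallP/(_ t)/forallP/(_ i)/forallP/(_ j)/implyP := adm_regular.
by rewrite e eqxx => /(_ isT)/eqP ->.
Qed.

Lemma glue_inv (s s' : side D) : @glue D s = s' -> glue s' = s.
Proof. by move=> <-; rewrite glueK. Qed.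

Lemma boundary_glue (s : side D) : boundary_side (@glue D s) = boundary_side s.
Proof. by rewrite /boundary_side glueK eq_sym. Qed.

Lemma bottom_boundary t s : bottom M t = Some s -> boundary_side (t, s).
Proof. by rewrite /bottom; case: M => //; case: pickP => // s' h [<-]. Qed.

(** The node glued to [x] across side [i]. Gluing reverses orientation, hence the exchange of the
    two coordinates. *)
Definition mate_at x i : node k D :=
  if x.2 is Some d then
    let s := glue (x.1, i) in (s.1, Some (pos3 k s.2 0 (d (ord_pred i)) (d (ordS i))))
  else x.

Lemma node_position t d : is_node M (t, Some d) -> is_position d.
Proof. by rewrite /is_node /=; case: bottom => // s /andP[]. Qed.

Lemma is_node_mate t d i : is_node M (t, Some d) -> d i = 0 :> nat -> ~~ boundary_side (t, i) ->
  is_node M (mate_at (t, Some d) i).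
Proof.
move=> nx di bi; have := node_position nx => /(is_positionP i)[h1 h2 h3 h4].
rewrite di add0n in h1; rewrite /mate_at /=; case e: (glue (t, i)) => [t' j] /=.
have bj : ~~ boundary_side (t', j) by rewrite -e boundary_glue.
have pp : is_position (pos3 k j 0 (d (ord_pred i)) (d (ordS i))).
  by apply: is_position_pos3 => //; lia.
have hs : 0 + d (ord_pred i) + d (ordS i) = k by lia.
rewrite /is_node /=; case bt: (bottom M t') => [s|] //; rewrite pp /=.
have [e1 e2 e3] := pos3P j hs.
case: (I3P j s) (bottom_boundary bt) => [|_|_]; first by rewrite (negbTE bj).
  by rewrite !I3E e1 orbT.
by rewrite !I3E e1.
Qed.

Lemma node_glueP t d i y : is_node M (t, Some d) -> d i = 0 :> nat -> ~~ boundary_side (t, i) ->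
  node_glue M (t, Some d) y = (y == mate_at (t, Some d) i).
Proof.
move=> nx di bi; have := node_position nx => /(is_positionP i)[h1 h2 h3 h4].
rewrite di add0n in h1.
have hs : 0 + d (ord_pred i) + d (ordS i) = k by rewrite add0n addnC.
apply/idP/eqP => [/and3P[_ ny] /= | ->].
  case: y ny => [t' [e|]] //= ny /existsP[i' /existsP[j /and5P[/eqP g bi' /eqP di' /eqP ej /andP[/eqP p1 /eqP p2]]]].
  have ii : i' = i by case: (I3P i i') di' => // di'; lia.
  subst i'; rewrite /mate_at /= g /=; congr (_, Some _); apply/eqP.
  by rewrite pos3_eq // ej p1 p2 !eqxx.
apply/and3P; split=> //; first exact: is_node_mate.
rewrite /mate_at /=; case e: (glue (t, i)) => [t' j] /=.
have [e1 e2 e3] := pos3P j hs.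
apply/existsP; exists i; apply/existsP; exists j; rewrite e eqxx bi di e1 /=.
by apply/andP; split; apply/eqP/val_inj; rewrite /= ?e2 ?e3.
Qed.

Lemma node_glue_side t d y : node_glue M (t, Some d) y ->
  exists2 i, d i = 0 :> nat & ~~ boundary_side (t, i).
Proof.
move=> /and3P[_ _] /=; case: y => [t' [e|]] //= /existsP[i /existsP[j /and5P[_ bi /eqP di _ _]]].
by exists i.
Qed.

Lemma mate_atK t d i : is_node M (t, Some d) -> d i = 0 :> nat ->
  mate_at (mate_at (t, Some d) i) (glue (t, i)).2 = (t, Some d).
Proof.
move=> nx di; have := node_position nx => np; have [h1 h2 h3 h4] := is_positionP i np.
rewrite di add0n in h1.
rewrite /mate_at /=; case e: (glue (t, i)) => [t' j] /=.
have hs : 0 + d (ord_pred i) + d (ordS i) = k by lia.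
have [e1 e2 e3] := pos3P j hs; rewrite (glue_inv e) e2 e3 /=.
by congr (_, Some _); rewrite [RHS](pos3_eq_self i np) di.
Qed.

Lemma node_glue_sym : symmetric ng.
Proof.
suff h x y : node_glue M x y -> node_glue M y x by move=> x y; apply/idP/idP; apply: h.
move=> /and3P[nx ny]; rewrite /node_glue nx ny /=; case: x y {nx ny} => [t [d|]] [t' [e|]] //=.
move=> /existsP[i /existsP[j /and5P[/eqP g bi di ej /andP[/eqP p1 /eqP p2]]]].
apply/existsP; exists j; apply/existsP; exists i.
by rewrite (glue_inv g) -g boundary_glue bi ej di p1 p2 !eqxx.
Qed.

Lemma connect_node_sym : connect_sym ng.
Proof. by apply: sym_connect_sym; apply: node_glue_sym. Qed.

(** All coordinates are below [k], so at most one of them is 0: a node lies on at most one side, and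
    its class has at most two elements. *)
Lemma connect_side t d i y : is_node M (t, Some d) -> d i = 0 :> nat -> ~~ boundary_side (t, i) ->
  connect ng (t, Some d) y = (y == (t, Some d)) || (y == mate_at (t, Some d) i).
Proof.
move=> nx di bi; set x := (t, Some d); apply/idP/orP => [|[/eqP ->|/eqP ->]].
- move=> cxy; apply/orP; suff : y \in [pred z | (z == x) || (z == mate_at x i)] by rewrite inE.
  apply: connect_closed cxy; last by rewrite inE eqxx.
  move=> u v; rewrite !inE => /orP[]/eqP ->; first by rewrite (node_glueP _ nx di bi) => ->; rewrite orbT.
  rewrite node_glue_sym => h; have nm := is_node_mate nx di bi; have := mate_atK nx di; rewrite -/x.
  move: h nm; rewrite /mate_at /=; case e: (glue (t, i)) => [t' j] /= h nm mk.
  have hs : 0 + d (ord_pred i) + d (ordS i) = k.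
    by have [h1 _ _ _] := is_positionP i (node_position nx); lia.
  have [e1 _ _] := pos3P j hs.
  have bj : ~~ boundary_side (t', j) by rewrite -e boundary_glue.
  by move: h; rewrite node_glue_sym (node_glueP _ nm e1 bj) [mate_at _ j]mk => ->.
- exact: connect0.
- by apply: connect1; rewrite (node_glueP _ nx di bi).
Qed.

Lemma connect_interior x y : (forall z, ~~ node_glue M x z) -> connect ng x y = (y == x).
Proof.
move=> h; apply/idP/eqP => [|->]; last exact: connect0.
move=> cxy; suff : y \in pred1 x by rewrite inE => /eqP.
apply: connect_closed cxy; last by rewrite inE.
by move=> u v; rewrite !inE => /eqP -> xv; have := h v; rewrite xv.
Qed.

Lemma node_root_eq x y : (fingraph.root ng x == fingraph.root ng y) = connect ng x y.
Proof. exact: (root_connect connect_node_sym). Qed.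

Lemma connect_cases x y : connect ng x y -> y = x \/ node_glue M x y.
Proof.
move=> c; case: (boolP [exists z, node_glue M x z]) => [/existsP[z h]|/existsPn h]; last first.
  by left; apply/eqP; rewrite -connect_interior.
case: x h c => [t [d|]]; last by rewrite /node_glue /= !andbF.
move=> h; have [i di bi] := node_glue_side h; have /and3P[nx _ _] := h.
by rewrite (connect_side _ nx di bi) => /orP[/eqP|/eqP ->]; [left|right; rewrite (node_glueP _ nx di bi)].
Qed.

(** Regularity: no side is glued to another side of the same triangle. *)
Lemma connect_tri x y : connect ng x y -> x.1 = y.1 -> x = y.
Proof.
move=> /connect_cases[//|h] e; case: x y e h => [t [d|]] [t' [e|]] //= tt; try by rewrite /node_glue /= !andbF.
subst t'; move=> /and3P[_ _] /existsP[i /existsP[j /and5P[/eqP g bi _ _ _]]].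
by have := glue_tri_neq g bi; rewrite eqxx.
Qed.

Lemma connect_node x y : connect ng x y -> is_node M x = is_node M y.
Proof. by move=> /connect_cases[-> //|/and3P[-> ->]]. Qed.

End Glue.

Local Open Scope ring_scope.

Lemma exists_sum (T : finType) (P : pred T) : (forall m m', P m -> P m' -> m = m') ->
  ([exists m, P m] : nat) = (\sum_m P m)%N.
Proof.
move=> h; case: (pickP P) => [m Pm|P0].
  have -> : [exists m, P m] by apply/existsP; exists m.
  rewrite (bigD1 m) //= Pm big1 // => m' mm; case: (boolP (P m')) => // Pm'.
  by case/eqP: mm; apply: h.
have -> : [exists m, P m] = false by apply/existsP => -[m]; rewrite P0.
by rewrite big1 // => m _; rewrite P0.
Qed.

(** * Signed arrow counts in a triangle *)

Section Net.
Variables (k : nat) (M : moduli) (D : triangulation) (A : zmodType).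
Hypothesis adm : admissible M D.
Implicit Types (t : tri D) (c i j m s : 'I_3) (x y z : node k D) (d e : position k).

(** Taking for [F] the indicator of a vertex gives entries of the exchange matrix; taking the
    weights gives the balance condition. In both cases one still has to sum over the nodes
    identified with [y]. *)
Definition net (F : node k D -> A) y : A :=
  \sum_x F x *~ ((arrow M x y)%:Z - (arrow M y x)%:Z).

Variable F : node k D -> A.
Hypothesis F0 : forall x, ~~ is_node M x -> F x = 0.
Hypothesis FM : forall t, F (t, None) = 0.

Definition at3 t c a b g : node k D := (t, Some (pos3 k c a b g)).

Lemma at3_rot t c a b g : (a + b + g = k)%N -> at3 t (ordS c) b g a = at3 t c a b g.
Proof. by move=> h; rewrite /at3 -pos3_rot. Qed.

Lemma at3_rot2 t c a b g : (a + b + g = k)%N -> at3 t (ord_pred c) g a b = at3 t c a b g.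
Proof. by move=> h; rewrite -ordSS at3_rot ?at3_rot //; lia. Qed.

Lemma sum_at z : \sum_x F x *~ (x == z)%:Z = F z.
Proof. by rewrite (bigD1 z) //= eqxx mulr1z big1 ?addr0 // => x /negbTE ->. Qed.

Lemma sum_moves (B : node k D -> bool) (cond : pred 'I_3) (z : 'I_3 -> node k D) :
  (forall x, is_node M x -> x.2 != None -> (B x : nat) = (\sum_m (cond m && (x == z m) : nat))%N) ->
  \sum_x F x *~ (B x)%:Z = \sum_m if cond m then F (z m) else 0.
Proof.
move=> h; rewrite (eq_bigr (fun x => \sum_m F x *~ (cond m && (x == z m))%:Z)).
  rewrite exchange_big; apply: eq_bigr => m _; case: (cond m) => /=; first exact: sum_at.
  by rewrite big1 // => x _; rewrite mulr0z.
move=> x _; case: (boolP (is_node M x)) => nx; last first.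
  by rewrite F0 // mul0rz big1 // => m _; rewrite mul0rz.
case: (eqVneq x.2 None) => x2.
  have -> : F x = 0 by case: x x2 {nx} => t o /= ->.
  by rewrite mul0rz big1 // => m _; rewrite mul0rz.
by rewrite h // -mulrz_sumr (big_morph Posz PoszD (erefl (0%:Z))).
Qed.

Lemma Qk_arrow_in d e : is_position d -> is_position e -> (Qk_arrow e d : nat) =
  (\sum_m (((0 < d m) && (0 < d (ord_pred m)))%N &&
     (e == pos3 k m (d m) (d (ordS m)).+1 (d (ord_pred m)).-1)))%N.
Proof.
move=> pd pe; rewrite /Qk_arrow exists_sum; last first.
  move=> m m' /and4P[_ /eqP h1 /eqP h2 /eqP h3] /and4P[_ /eqP h1' /eqP h2' /eqP h3'].
  by case: (I3P m m') h1' h2' h3' => //; rewrite !I3E; lia.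
apply: eq_bigr => m _; have [h1 h2 h3 h4] := is_positionP m pd.
case: (boolP (0 < d m)%N) => dm /=; last first.
  by rewrite (_ : (0 < e m)%N && _ = false) //; apply/and4P => -[h5 /eqP h6 _ _]; lia.
case: (boolP (0 < d (ord_pred m))%N) => dp /=; last first.
  by rewrite (_ : (0 < e m)%N && _ = false) //; apply/and4P => -[_ _ _ /eqP h6]; lia.
rewrite pos3_eq; last by lia.
by congr (nat_of_bool _); apply/and4P/and3P => [[_ /eqP p1 /eqP p2 /eqP p3]|[/eqP p1 /eqP p2 /eqP p3]];
  split; try apply/eqP; lia.
Qed.

Lemma Qk_arrow_out d e : is_position d -> is_position e -> (Qk_arrow d e : nat) =
  (\sum_m (((0 < d m) && (0 < d (ordS m)))%N &&
     (e == pos3 k m (d m) (d (ordS m)).-1 (d (ord_pred m)).+1)))%N.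
Proof.
move=> pd pe; rewrite /Qk_arrow exists_sum; last first.
  move=> m m' /and4P[_ /eqP h1 /eqP h2 /eqP h3] /and4P[_ /eqP h1' /eqP h2' /eqP h3'].
  by case: (I3P m m') h1' h2' h3' => //; rewrite !I3E; lia.
apply: eq_bigr => m _; have [h1 h2 h3 h4] := is_positionP m pd.
case: (boolP (0 < d m)%N) => dm //=.
case: (boolP (0 < d (ordS m))%N) => dp /=; last first.
  by rewrite (_ : (d m == e m :> nat) && _ = false) //; apply/and3P => -[_ /eqP h6 _]; lia.
rewrite pos3_eq; last by lia.
by congr (nat_of_bool _); apply/and3P/and3P => [[/eqP p1 /eqP p2 /eqP p3]|[/eqP p1 /eqP p2 /eqP p3]];
  split; apply/eqP; lia.
Qed.

Lemma net_none t d : bottom M t = None -> is_position d -> net F (t, Some d) =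
  \sum_m ((if (0 < d m)%N && (0 < d (ord_pred m))%N then
             F (at3 t m (d m) (d (ordS m)).+1 (d (ord_pred m)).-1) else 0) -
          (if (0 < d m)%N && (0 < d (ordS m))%N then
             F (at3 t m (d m) (d (ordS m)).-1 (d (ord_pred m)).+1) else 0)).
Proof.
move=> bt pd; rewrite /net; under eq_bigr => x _ do rewrite mulrzBr.
rewrite !sumrB; congr (_ - _); apply: sum_moves => -[t' [e|]] //= nx _;
  rewrite /arrow /=; case: (eqVneq t' t) nx => [->|tt] nx /=;
  rewrite ?bt ?(eq_sym t t') ?(negbTE tt) ?eqxx /=.
- rewrite (Qk_arrow_in pd); last exact: node_position nx.
  by apply: eq_bigr => m _; rewrite /at3 xpair_eqE eqxx.
- by rewrite big1 // => m _; rewrite /at3 xpair_eqE (negbTE tt) /= andbF.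
- rewrite (Qk_arrow_out pd); last exact: node_position nx.
  by apply: eq_bigr => m _; rewrite /at3 xpair_eqE eqxx.
- by rewrite big1 // => m _; rewrite /at3 xpair_eqE (negbTE tt) /= andbF.
Qed.

(** The terms are the six neighbours in the triangular grid. The conditions drop those outside the
    triangle, and for a node on a side also those along it, since an arrow keeps a nonzero
    coordinate. *)
Lemma net_none3 t c a b g : bottom M t = None -> (a + b + g = k)%N -> (a < k)%N -> (b < k)%N -> (g < k)%N ->
  net F (at3 t c a b g) =
   ((if (0 < a)%N && (0 < g)%N then F (at3 t c a b.+1 g.-1) else 0) -
    (if (0 < a)%N && (0 < b)%N then F (at3 t c a b.-1 g.+1) else 0)) +
   (((if (0 < b)%N && (0 < a)%N then F (at3 t c a.-1 b g.+1) else 0) -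
     (if (0 < b)%N && (0 < g)%N then F (at3 t c a.+1 b g.-1) else 0)) +
    ((if (0 < g)%N && (0 < b)%N then F (at3 t c a.+1 b.-1 g) else 0) -
     (if (0 < g)%N && (0 < a)%N then F (at3 t c a.-1 b.+1 g) else 0))).
Proof.
move=> bt h ak bk gk; have [e1 e2 e3] := pos3P c h.
rewrite net_none //; last exact: is_position_pos3.
rewrite (big_I3 _ c) /= !I3E !e1 !e2 !e3.
congr (_ + (_ - _ + (_ - _))); case: ifP => // /andP[h1 h2]; congr (F _);
  (rewrite at3_rot2 //; lia) || (rewrite at3_rot //; lia).
Qed.

Lemma sum_list (B : node k D -> bool) (zs : seq (node k D)) :
  (forall x, is_node M x -> x.2 != None -> (B x : nat) = (\sum_(z <- zs) (x == z))%N) ->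
  \sum_x F x *~ (B x)%:Z = \sum_(z <- zs) F z.
Proof.
move=> h; rewrite (eq_bigr (fun x => \sum_(z <- zs) F x *~ (x == z)%:Z)).
  by rewrite exchange_big; apply: eq_bigr => z _; exact: sum_at.
move=> x _; case: (boolP (is_node M x)) => nx; last first.
  by rewrite F0 // mul0rz big1 // => m _; rewrite mul0rz.
case: (eqVneq x.2 None) => x2.
  have -> : F x = 0 by case: x x2 {nx} => t o /= ->.
  by rewrite mul0rz big1 // => m _; rewrite mul0rz.
by rewrite h // -mulrz_sumr (big_morph Posz PoszD (erefl (0%:Z))).
Qed.

Lemma at3_eq t t' c a b g e : (a + b + g = k)%N -> ((t', Some e) == at3 t c a b g) =
  [&& t' == t, e c == a :> nat, e (ordS c) == b :> nat & e (ord_pred c) == g :> nat].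
Proof. by move=> h; rewrite /at3 xpair_eqE (inj_eq Some_inj) pos3_eq. Qed.

Section Bottom.
Variables (t : tri D) (s : 'I_3) (a : nat).
Hypotheses (bt : bottom M t = Some s) (a0 : (0 < a)%N) (ak : (a < k)%N).

Lemma net_left : net F (at3 t s a 0 (k - a)) =
  F (at3 t s a (k - a) 0) - F (at3 t s a.-1 (k - a).+1 0).
Proof.
rewrite /net; under eq_bigr => x _ do rewrite mulrzBr.
have h : (a + 0 + (k - a) = k)%N by lia.
have [e1 e2 e3] := pos3P s h; have ka : (k - a == 0)%N = false by lia.
rewrite sumrB -[F (at3 t s a _ _)](big_seq1 +%R) -[F (at3 t s a.-1 _ _)](big_seq1 +%R).
congr (_ - _); apply: sum_list => -[t' [e|]] //= nx _; rewrite /arrow /= big_seq1 at3_eq; try lia;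
  case: (eqVneq t' t) nx => [->|tt] nx /=; rewrite ?bt ?(eq_sym t t') ?(negbTE tt) ?eqxx //=;
  have [p1 p2 p3 p4] := is_positionP s (node_position nx); rewrite e1 e2 e3 ka /= ?andbF ?orbF; lia.
Qed.

(** For [a = k - 1] the positions of height [a + 1] are not nodes and [F] vanishes there, so the
    formula is uniform in [a]. *)
Lemma net_right : net F (at3 t s a (k - a) 0) =
  F (at3 t s a.+1 0 (k - a).-1) + F (at3 t s a.-1 (k - a).+1 0) -
  F (at3 t s a 0 (k - a)) - F (at3 t s a.+1 (k - a).-1 0).
Proof.
rewrite /net; under eq_bigr => x _ do rewrite mulrzBr.
have h : (a + (k - a) + 0 = k)%N by lia.
have [e1 e2 e3] := pos3P s h; have ka : (k - a == 0)%N = false by lia.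
have e12 (z1 z2 : node k D) : F z1 + F z2 = \sum_(z <- [:: z1; z2]) F z.
  by rewrite !big_cons big_nil addr0.
rewrite sumrB -addrA -opprD !e12; congr (_ - _); apply: sum_list => -[t' [e|]] //= nx _;
  rewrite /arrow /= !big_cons big_nil !at3_eq; try lia;
  case: (eqVneq t' t) nx => [->|tt] nx /=; rewrite ?bt ?(eq_sym t t') ?(negbTE tt) ?eqxx //=;
  have [p1 p2 p3 p4] := is_positionP s (node_position nx); rewrite e1 e2 e3 ka /= ?andbF ?orbF; lia.
Qed.

End Bottom.

End Net.

(** * Corners around a puncture *)

Section Corners.
Variables (k : nat) (M : moduli) (D : triangulation).
Hypothesis adm : admissible M D.
Implicit Types (t : tri D) (c i j s : 'I_3) (p q : puncture D) (C : corner D).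

Lemma corner_glue_sym : symmetric (@corner_glue D).
Proof.
suff h C C' : corner_glue C C' -> corner_glue C' C by move=> C C'; apply/idP/idP; apply: h.
move=> /existsP[i /existsP[j /and3P[/eqP e bi h]]]; apply/existsP; exists j; apply/existsP; exists i.
rewrite (glue_inv e) eqxx /= -e boundary_glue bi /=.
by case/orP: h => /andP[-> ->]; rewrite ?orbT.
Qed.

Lemma corner_glueE t i t' j : glue (t, i) = (t', j) -> ~~ boundary_side (t, i) ->
  corner_glue (t, ordS i) (t', ord_pred j) /\ corner_glue (t, ord_pred i) (t', ordS j).
Proof.
move=> e bi; split; apply/existsP; exists i; apply/existsP; exists j; rewrite e bi !eqxx //=.
by rewrite orbT.
Qed.

Lemma puncture_closed p C C' : corner_glue C C' -> (C \in val p) = (C' \in val p).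
Proof.
case: p => m /= /andP[/existsP[C0 /eqP ->] _] h; rewrite !inE.
have sg := sym_connect_sym corner_glue_sym.
by apply/idP/idP => h'; apply: (connect_trans h'); [apply: connect1|rewrite sg; apply: connect1].
Qed.

Lemma puncture_glue p t i t' j : glue (t, i) = (t', j) -> ~~ boundary_side (t, i) ->
  ((t, ordS i) \in val p) = ((t', ord_pred j) \in val p) /\
  ((t, ord_pred i) \in val p) = ((t', ordS j) \in val p).
Proof. by move=> e bi; have [/puncture_closed -> /puncture_closed ->] := corner_glueE e bi. Qed.

Lemma puncture_side p t c : (t, c) \in val p ->
  ~~ boundary_side (t, ordS c) /\ ~~ boundary_side (t, ord_pred c).
Proof.
case: p => m /= /andP[_ /forall_inP h] /h; rewrite /boundary_corner /= negb_or.
by move/andP.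
Qed.

Lemma puncture_connect p C C' : C \in val p -> (C' \in val p) = connect (@corner_glue D) C C'.
Proof.
case: p => m /= /andP[/existsP[C0 /eqP ->] _]; rewrite !inE => h.
have sg := sym_connect_sym corner_glue_sym.
by apply/idP/idP => h'; [apply: connect_trans _ h'; rewrite sg|apply: connect_trans h h'].
Qed.

Lemma puncture_nonempty p : exists C, C \in val p.
Proof. by case: p => m /= /andP[/existsP[C0 /eqP ->] _]; exists C0; rewrite inE. Qed.

Lemma puncture_eq p q C : C \in val p -> C \in val q -> p = q.
Proof.
move=> hp hq; apply/val_inj/setP => C'.
by rewrite (puncture_connect _ hp) (puncture_connect _ hq).
Qed.

Lemma puncture_bottom p t c s : (t, c) \in val p -> bottom M t = Some s -> c = s.
Proof.
move=> /puncture_side[b1 b2] /bottom_boundary bs.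
by case: (I3P c s) bs => // bs; [rewrite bs in b1|rewrite bs in b2].
Qed.

(* The next corner around the marked point. *)
Definition nx C : corner D := let s := glue (C.1, ordS C.2) in (s.1, ordS s.2).

Lemma nx_inj : injective nx.
Proof.
move=> [t c] [t' c'] h; have := congr1 fst h; have := congr1 snd h.
rewrite /nx /= => /(can_inj (@ordSK 3)) h2 h1.
have e : glue (t, ordS c) = glue (t', ordS c') by rewrite [LHS]surjective_pairing h1 h2 -surjective_pairing.
have := can_inj (@glueK D) e; move=> e2; have := congr1 fst e2; have := congr1 snd e2.
by move=> /= /(can_inj (@ordSK 3)) -> ->.
Qed.

Lemma nx_glue t c : ~~ boundary_side (t, ordS c) -> corner_glue (t, c) (nx (t, c)).
Proof.
move=> b; rewrite /nx /=; case e: (glue (t, ordS c)) => [t' j].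
by have [_] := corner_glueE e b; rewrite ordSK.
Qed.

Lemma nx_puncture p C : C \in val p -> nx C \in val p.
Proof.
by case: C => t c h; have [b _] := puncture_side h; rewrite -(puncture_closed p (nx_glue b)).
Qed.

Lemma corner_glue_nx C C' : corner_glue C C' -> nx C = C' \/ nx C' = C.
Proof.
case: C C' => t c [t' c'] /existsP[i /existsP[j /and3P[/eqP e bi]]] /= h.
case/orP: h => /andP[/eqP -> /eqP ->] /=; [right|left]; rewrite /nx /= ord_predK.
  by rewrite (glue_inv e).
by rewrite e.
Qed.

Lemma puncture_fconnect p C C' : C \in val p -> (C' \in val p) = fconnect nx C C'.
Proof.
move=> h; apply/idP/idP => [|h'].
  rewrite (puncture_connect _ h); apply: connect_sub => A B /corner_glue_nx[<-|<-].
    exact: fconnect1.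
  by rewrite (fconnect_sym nx_inj) fconnect1.
suff : C' \in [pred A | A \in val p] by [].
by apply: connect_closed h' => // A B; rewrite !inE => hA /eqP <-; apply: nx_puncture.
Qed.

Section Ring.
Variable i : nat.
Hypotheses (i0 : (0 < i)%N) (ik : (i < k)%N).

Definition len t : nat := if bottom M t is Some _ then 1 else (k - i)%N.
Definition src t c b : node k D :=
  if bottom M t is Some _ then at3 k t c i (k - i) 0 else at3 k t c i b.+1 (k - i - b).-1.
Definition tgtn t c b : node k D := at3 k t c i b (k - i - b).
Definition up t c b : node k D := at3 k t c i.+1 b (k - i - b).-1.
Definition down t c b : node k D :=
  if bottom M t is Some _ then at3 k t c i.-1 (k - i).+1 0 else at3 k t c i.-1 b.+1 (k - i - b).

Variable F : node k D -> int.
Hypothesis F0 : forall x, ~~ is_node M x -> F x = 0.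
Hypothesis FM : forall t, F (t, None) = 0.

(** Each arrow of the ring is the common edge of two small triangles with apexes [up] and [down].
    With [F] an indicator, this is the exponent of a vertex in the Goncharov-Shen term of the
    rhombus, the product of the apexes over the product of the two ends of the arrow. *)
Definition TF t c b : int := F (up t c b) + F (down t c b) - F (src t c b) - F (tgtn t c b).

Definition top_corner t c : Prop := forall s, bottom M t = Some s -> c = s.

(** The hexagon around a node shared by two consecutive arrows is the difference of their rhombi.
    Where the ring meets a side, half of the hexagon is missing; the leftover terms in [net_tgt0]
    and [net_src_last] sit on glued nodes and cancel in [Tv_step]. *)
Lemma net_inside t c b : bottom M t = None -> (b.+1 < k - i)%N ->
  net M F (tgtn t c b.+1) = TF t c b - TF t c b.+1.
Proof.
move=> bt bk; rewrite /tgtn net_none3 //; try lia.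
rewrite /TF /up /down /src /tgtn bt i0 /= subn_gt0 bk.
have -> : (k - i - b.+1 = (k - i - b).-1)%N by lia.
have -> : ((k - i - b).-1.+1 = k - i - b)%N by lia.
rewrite ltn0Sn /=; lia.
Qed.

Lemma net_tgt0 t c : top_corner t c ->
  net M F (tgtn t c 0) = F (at3 k t c i.+1 0 (k - i).-1) - F (tgtn t c 0) - TF t c 0.
Proof.
move=> tc; rewrite /TF /up /down /src /tgtn subn0; case bt: (bottom M t) => [s|].
  by have := tc _ bt => e; subst c; rewrite net_left //; lia.
by rewrite net_none3 //; try lia; rewrite i0 /= subn_gt0 ik /=; lia.
Qed.

Lemma net_src_last t c : top_corner t c -> net M F (at3 k t c i (k - i) 0) =
  TF t c (len t).-1 + F (at3 k t c i (k - i) 0) - F (at3 k t c i.+1 (k - i).-1 0).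
Proof.
move=> tc; rewrite /TF /up /down /src /tgtn /len; case bt: (bottom M t) => [s|].
  by have := tc _ bt => e; subst c; rewrite net_right //= !subn0; lia.
rewrite net_none3 //; try lia; rewrite i0 /= !subn_gt0 ik /=.
have -> : ((k - i - (k - i).-1) = 1)%N by lia.
have -> : ((k - i).-1.+1 = k - i)%N by lia.
rewrite /=; lia.
Qed.

End Ring.

End Corners.

(** * Vertices of the initial quiver *)

Section Initial.
Variables (k : nat) (M : moduli) (D : triangulation).
Hypothesis adm : admissible M D.
Local Notation ng := (@node_glue k M D).
Local Notation V := (mutable_vertex k M D).
Local Notation S0 := (initial_seed k M D).
Implicit Types (t : tri D) (c i j s : 'I_3) (x y z : node k D) (d e : position k) (p q : puncture D).

Definition nodev (v : V) : node k D := val (val v).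

Lemma nodev_node v : is_node M (nodev v).
Proof. by case/andP: (valP (val v)). Qed.

Lemma nodev_root v : fingraph.root ng (nodev v) = nodev v.
Proof. by case/andP: (valP (val v)) => _ /eqP. Qed.

Lemma nodev_mutable v : ~~ frozen_node (nodev v).
Proof. exact: (valP v). Qed.

Lemma nodev_inj : injective nodev.
Proof. by move=> u v e; apply/val_inj/val_inj. Qed.

Definition mutable_node x := is_node M x && ~~ frozen_node x.

Lemma frozen_glue x y : node_glue M x y -> ~~ frozen_node x.
Proof.
case: x => t [d|]; last by rewrite /node_glue /= !andbF.
move=> g; have [i di bi] := node_glue_side g; have /and3P[nx _ _] := g.
apply/negP => /existsP[j /andP[bj /eqP dj]].
have [h1 h2 h3 h4] := is_positionP i (node_position nx).
case: (I3P i j) bj dj => [bj|_ dj|_ dj]; [by rewrite bj in bi| |]; lia.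
Qed.

Lemma mutable_connect x y : connect ng x y -> mutable_node x = mutable_node y.
Proof.
move=> h; rewrite /mutable_node (connect_node adm h); congr (_ && _).
case: (connect_cases adm h) => [-> //|g]; rewrite (negbTE (frozen_glue g)).
by rewrite node_glue_sym // in g; rewrite (negbTE (frozen_glue g)).
Qed.

Lemma mutable_some x : mutable_node x -> exists d, x = (x.1, Some d).
Proof. by case: x => t [d|]; [exists d|rewrite /mutable_node andbF]. Qed.

Lemma root_nodev x v : (fingraph.root ng x == nodev v) = connect ng x (nodev v).
Proof. by rewrite -[in LHS](nodev_root v) node_root_eq. Qed.

Lemma mutable_vertexP x : mutable_node x -> exists v : V, connect ng x (nodev v).
Proof.
move=> mx; have cx := connect_root ng x; have := mx; rewrite (mutable_connect cx) => /andP[nr fr].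
have rr : is_node M (fingraph.root ng x) && (fingraph.root ng (fingraph.root ng x) == fingraph.root ng x).
  by rewrite nr root_root ?eqxx //; apply: connect_node_sym.
by exists (Sub (Sub (fingraph.root ng x) rr : vertex k M D) fr).
Qed.

Lemma connect_nodev x (u v : V) : connect ng x (nodev u) -> connect ng x (nodev v) -> u = v.
Proof.
by rewrite -!root_nodev => /eqP e /eqP e'; apply: nodev_inj; rewrite -e.
Qed.

Lemma sum_vertices (A : zmodType) (E : node k D -> A) :
  \sum_(v : V) \sum_(x | connect ng x (nodev v)) E x = \sum_(x | mutable_node x) E x.
Proof.
rewrite (exchange_big_dep mutable_node) /=; last first.
  by move=> v x _ /mutable_connect ->; rewrite /mutable_node nodev_node nodev_mutable.
apply: eq_bigr => x /mutable_vertexP[v hv]; rewrite (big_pred1 v) // => u /=.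
by apply/idP/eqP => [h|-> //]; apply: connect_nodev h hv.
Qed.

Definition vind (v : V) x : int := (connect ng x (nodev v))%:R.

Lemma vind_node v x : ~~ is_node M x -> vind v x = 0.
Proof.
rewrite /vind => h; case: (boolP (connect ng x (nodev v))) => // /(connect_node adm) e.
by rewrite e nodev_node in h.
Qed.

Lemma vind_none v t : vind v (t, None) = 0.
Proof.
rewrite /vind; case: (boolP (connect ng (t, None) (nodev v))) => // /mutable_connect.
by rewrite /mutable_node nodev_node nodev_mutable /= andbF.
Qed.

Lemma quiver_net (u v : V) : quiver S0 u v = \sum_(y | connect ng y (nodev v)) net M (vind u) y.
Proof.
rewrite /= /surface_quiver exchange_big /=.
rewrite (eq_bigl (fun y => connect ng y (nodev v))) => [|y]; last exact: root_nodev.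
apply: eq_bigr => y _; rewrite /net big_mkcond; apply: eq_bigr => x _.
by rewrite -/(nodev u) root_nodev /vind; case: ifP; rewrite ?mulr1z ?mul0rz // mulrzz mul1r.
Qed.

Lemma initial_skew : skew S0.
Proof.
move=> u v; rewrite /= /surface_quiver exchange_big /= -sumrN; apply: eq_bigr => y _.
by rewrite -sumrN; apply: eq_bigr => x _; rewrite opprB.
Qed.

Lemma weight_glue x y : node_glue M x y -> node_weight x = node_weight y.
Proof.
case: x => t [d|]; last by rewrite /node_glue /= !andbF.
move=> g; have [i di bi] := node_glue_side g; have /and3P[nx _ _] := g.
move: g; rewrite (node_glueP adm _ nx di bi) => /eqP ->; rewrite /mate_at /=.
case e: (glue (t, i)) => [t' j] /=; have [h1 _ _ _] := is_positionP i (node_position nx).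
have hs : (0 + d (ord_pred i) + d (ordS i) = k)%N by lia.
have [e1 e2 e3] := pos3P j hs.
apply/ffunP => q; rewrite !ffunE /node_weight_at /= [LHS]big_mkcond [RHS]big_mkcond (big_I3 _ i) [RHS](big_I3 _ j) /=.
have [-> ->] := puncture_glue q e bi; rewrite e1 e2 e3 di.
have -> : omega k 0 = 0 by rewrite /omega big1.
by rewrite !if_same [in RHS]addrC [in LHS]addrC /= !addr0 [LHS]addrC.
Qed.

Lemma weight_connect x y : connect ng x y -> node_weight x = node_weight y.
Proof. by move=> /(connect_cases adm)[-> //|]; apply: weight_glue. Qed.

Lemma frozen_weight x : is_node M x -> frozen_node x -> node_weight x = 0.
Proof.
case: x => t [d|] nx; last by move=> _; apply/ffunP => q; rewrite !ffunE.
move=> /existsP[i /andP[bi /eqP di]]; apply/ffunP => q; rewrite !ffunE /node_weight_at /=.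
rewrite big_mkcond (big_I3 _ i) /= di.
have -> : omega k 0 = 0 by rewrite /omega big1.
rewrite if_same add0r.
case: ifP => [/puncture_side[_ ]|_]; first by rewrite ordSK bi.
by case: ifP => [/puncture_side[]|_]; rewrite ?ord_predK ?bi ?addr0.
Qed.

End Initial.

(** * Balance of the initial seed *)

Lemma omega0 k : omega k 0 = 0.
Proof. by rewrite /omega big1. Qed.

Section Balance.
Variables (k : nat) (M : moduli) (D : triangulation).
Hypothesis adm : admissible M D.
Local Notation ng := (@node_glue k M D).
Local Notation V := (mutable_vertex k M D).
Local Notation S0 := (initial_seed k M D).
Implicit Types (t : tri D) (c i j s : 'I_3) (x y z : node k D) (d e : position k) (p q : puncture D).

Lemma class_sum (A : zmodType) (G : node k D -> A) t d : mutable_node M (t, Some d) ->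
  (forall i, (0 < d i)%N) /\ \sum_(y | connect ng y (t, Some d)) G y = G (t, Some d) \/
  exists i, [/\ d i = 0 :> nat, ~~ boundary_side (t, i) &
   \sum_(y | connect ng y (t, Some d)) G y = G (t, Some d) + G (mate_at (t, Some d) i)].
Proof.
move=> /andP[nx fr]; have sg := @connect_node_sym k M D.
case: (pickP (fun i => d i == 0 :> nat)) => [i /eqP di|dn]; [right|left].
  have bi : ~~ boundary_side (t, i).
    by apply: contra fr => bi; apply/existsP; exists i; rewrite bi di.
  exists i; split=> //; rewrite (bigD1 (t, Some d)) ?connect0 //=; congr (_ + _).
  rewrite (big_pred1 (mate_at (t, Some d) i)) // => y /=; rewrite sg (connect_side adm _ nx di bi).
  case: (eqVneq y (t, Some d)) => [-> /=|]; last by rewrite andbT.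
  apply/esym/negbTE; rewrite /mate_at /=; case e: (glue (t, i)) => [t' j] /=.
  by rewrite xpair_eqE (negbTE (glue_tri_neq adm e bi)).
split=> [i|]; first by rewrite lt0n dn.
rewrite (big_pred1 (t, Some d)) // => y /=; rewrite sg connect_interior // => z.
by apply/negP => /node_glue_side[i di]; have := dn i; rewrite di.
Qed.

Definition omega_at c (x : node k D) : weightP k :=
  if x.2 is Some d then if is_node M x then omega k (d c) else 0 else 0.

Lemma omega_at_node c x : ~~ is_node M x -> omega_at c x = 0.
Proof. by case: x => t [d|] //= /negbTE h; rewrite /omega_at h. Qed.

Definition delta (a : nat) : weightP k := omega k a - omega k a.-1.

Lemma omega_at3 t c a b g : bottom M t = None -> (a + b + g = k)%N ->
  (a < k)%N -> (b < k)%N -> (g < k)%N -> omega_at c (at3 k t c a b g) = omega k a.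
Proof.
move=> bt h ak bk gk; have [e1 _ _] := pos3P c h.
by rewrite /omega_at /at3 /is_node /= bt is_position_pos3 //= e1.
Qed.

Lemma omega_at3_bottom t s a b g : bottom M t = Some s -> (a + b + g = k)%N -> (a < k)%N ->
  (b == 0)%N || (g == 0)%N -> omega_at s (at3 k t s a b g) = omega k a.
Proof.
move=> bt h ak bg; have [e1 e2 e3] := pos3P s h; rewrite /omega_at /at3 /is_node /= bt e2 e3 bg andbT e1.
case: ifP => // /negP np; case: (posnP a) => a0; first by rewrite a0 omega0.
by case: np; apply: is_position_pos3 => //; lia.
Qed.

(** At an interior node the six neighbours cancel. On the two sides adjacent to [c] one difference
    of fundamental weights survives, with opposite signs, so that gluing cancels it as well. *)
Lemma net_omega t c d : is_node M (t, Some d) -> top_corner M t c ->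
  net M (omega_at c) (t, Some d) =
  delta (d c) *~ (if (0 < d c)%N then (0 < d (ord_pred c))%N%:Z - (0 < d (ordS c))%N%:Z else 0).
Proof.
move=> nx tc; have pd := node_position nx; have [h1 h2 h3 h4] := is_positionP c pd.
rewrite {1}(pos3_eq_self c pd) -/(at3 k t c _ _ _).
have [a ea] : {a : nat | d c = a :> nat} by exists (d c).
have [b eb] : {b : nat | d (ordS c) = b :> nat} by exists (d (ordS c)).
have [g eg] : {g : nat | d (ord_pred c) = g :> nat} by exists (d (ord_pred c)).
rewrite ea eb eg in h1 h2 h3 h4 *.
have FM t' : omega_at c (t', None) = 0 by [].
case bt: (bottom M t) => [s|].
  have e := tc _ bt; subst c; move: nx; rewrite /is_node /= bt => /andP[_ /orP[/eqP b0|/eqP g0]].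
    have {}b0 : b = 0%N by rewrite -eb.
    rewrite b0 in h1 h3 *; have a0 : (0 < a)%N by lia.
    have eg' : g = (k - a)%N by lia.
    rewrite eg' (net_left adm (@omega_at_node s) FM bt a0 h2) !omega_at3_bottom ?eqxx ?orbT //; try lia.
    by rewrite a0 subn_gt0 h2 subr0 mulr1z.
  have {}g0 : g = 0%N by rewrite -eg.
  rewrite g0 in h1 h4 *; have a0 : (0 < a)%N by lia.
  have eb' : b = (k - a)%N by lia.
  rewrite eb' (net_right adm (@omega_at_node s) FM bt a0 h2) a0 subn_gt0 h2 sub0r mulrN1z opprB.
  have -> : omega_at s (at3 k t s a.+1 0 (k - a).-1) = omega_at s (at3 k t s a.+1 (k - a).-1 0).
    case: (ltnP a.+1 k) => ak; first by rewrite !omega_at3_bottom ?eqxx ?orbT //; lia.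
    have -> : (k - a).-1 = 0%N by lia.
    by [].
  set X := omega_at s (at3 k t s a.+1 _ _).
  rewrite !omega_at3_bottom ?eqxx ?orbT //; try lia.
  by rewrite addrAC [X + _]addrC addrK addrC.
rewrite (net_none3 adm (@omega_at_node c) FM c bt h1 h2 h3 h4).
case: (posnP a) => a0; case: (posnP b) => b0; case: (posnP g) => g0 /=; rewrite ?andbF /=;
  rewrite ?omega_at3 //; try lia;
  rewrite ?subr0 ?sub0r ?subrr ?addr0 ?add0r ?mulr1z ?mulr0z ?mulrN1z /delta ?opprB //.
- exact: addNr.
- exact: addrC.
- by rewrite addrA subrK subrr.
Qed.

Definition weight_of (x : node k D) : {ffun puncture D -> weightP k} :=
  if is_node M x then node_weight x else 0.

Lemma net_weight t d q : is_node M (t, Some d) -> net M weight_of (t, Some d) q =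
  \sum_(c | (t, c) \in val q)
    delta (d c) *~ (if (0 < d c)%N then (0 < d (ord_pred c))%N%:Z - (0 < d (ordS c))%N%:Z else 0).
Proof.
move=> nx; rewrite /net sum_ffunE.
rewrite (eq_bigr (fun c => net M (omega_at c) (t, Some d))) => [|c hc]; last first.
  by rewrite net_omega // => s /(puncture_bottom hc).
rewrite [RHS](exchange_big) /=; apply: eq_bigr => -[t' o] _; rewrite ffun_mulz.
rewrite -mulrz_suml; case: (eqVneq t' t) => [->|tt]; last first.
  by rewrite /arrow /= (negbTE tt) (eq_sym t) (negbTE tt) !mulr0z.
congr (_ *~ _); rewrite /weight_of /omega_at; case: o => [e|] /=; last first.
  by rewrite big1 //; case: ifP => _; rewrite ?ffunE.
by case: ifP => _; rewrite ffunE //= big1.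
Qed.

Lemma net_weight_side t d i q : is_node M (t, Some d) -> d i = 0 :> nat -> net M weight_of (t, Some d) q =
  (if (t, ord_pred i) \in val q then delta (d (ord_pred i)) else 0) -
  (if (t, ordS i) \in val q then delta (d (ordS i)) else 0).
Proof.
move=> nx di; have [h1 h2 h3 h4] := is_positionP i (node_position nx); rewrite di add0n in h1.
have s0 : (0 < d (ordS i))%N by lia.
have p0 : (0 < d (ord_pred i))%N by lia.
rewrite net_weight // big_mkcond (big_I3 _ i) /= !I3E di s0 p0 /= mulr0z if_same add0r.
rewrite subr0 sub0r mulr1z mulrN1z addrC; congr (_ + _).
by case: ifP => // _; rewrite oppr0.
Qed.

Lemma initial_balanced : balanced S0.
Proof.
move=> v; transitivity (\sum_(y | connect ng y (nodev v)) net M weight_of y).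
  transitivity (\sum_x weight_of x *~
      \sum_(y | connect ng y (nodev v)) ((arrow M x y)%:Z - (arrow M y x)%:Z)).
    rewrite [RHS](bigID (@mutable_node k M D)) /= [X in _ = _ + X]big1 ?addr0; last first.
      move=> x; rewrite /mutable_node /weight_of negb_and negbK; case: ifP => /= nx; last by rewrite mul0rz.
      by move=> fx; rewrite (frozen_weight nx fx) mul0rz.
    rewrite -(sum_vertices adm); apply: eq_bigr => u _.
    rewrite /surface_quiver mulrz_sumr; apply: eq_big => [x|x].
      by rewrite -/(nodev u) root_nodev.
    rewrite -/(nodev u) root_nodev => h; have nx : is_node M x by rewrite (connect_node adm h) nodev_node.
    rewrite /weight_of nx (weight_connect adm h); congr (_ *~ _).
    by apply: eq_bigl => y; rewrite -/(nodev v) root_nodev.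
  rewrite /net exchange_big /=; apply: eq_bigr => x _; exact: mulrz_sumr.
apply/ffunP => q; rewrite sum_ffunE ffunE.
have mv : mutable_node M (nodev v) by rewrite /mutable_node nodev_node nodev_mutable.
have [d ed] := mutable_some mv; case: (nodev v) mv ed => t o mv /= eo; case: eo mv => -> mv.
have /andP[nx _] := mv.
have [[dp ->]|[i [di bi ->]]] := class_sum (fun y => net M weight_of y q) mv.
  by rewrite net_weight // big1 // => c _; rewrite !dp subrr mulr0z.
have nm := is_node_mate adm nx di bi; rewrite (net_weight_side q nx di).
move: nm; rewrite /mate_at /=; case e: (glue (t, i)) => [t' j] /= nm.
have [h1 _ _ _] := is_positionP i (node_position nx).
have hs : (0 + d (ord_pred i) + d (ordS i) = k)%N by lia.
have [e1 e2 e3] := pos3P j hs; rewrite (net_weight_side q nm e1) e2 e3.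
by have [-> ->] := puncture_glue q e bi; rewrite addrA subrK subrr.
Qed.

End Balance.

(** * Weights of the initial seed *)

Lemma rt_omega k (a b : 'I_k) n : rt a b (omega k n) = (a < n)%N%:Z - (b < n)%N%:Z.
Proof.
rewrite /omega (am_sum (additive_rt a b)); under eq_bigr => i _ do rewrite rtE.
have h (c : 'I_k) : \sum_(i < k | (i < n)%N) (c == i)%:Z = (c < n)%N%:Z :> int.
  rewrite big_mkcond (bigD1 c) //= eqxx big1 ?addr0; first by case: ifP.
  by move=> i /negbTE ic; rewrite eq_sym ic if_same.
by rewrite sumrB !h.
Qed.

Section InitialWeights.
Variables (k : nat) (M : moduli) (D : triangulation).
Hypothesis adm : admissible M D.
Local Notation ng := (@node_glue k M D).
Local Notation V := (mutable_vertex k M D).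
Local Notation S0 := (initial_seed k M D).
Implicit Types (t : tri D) (c i j s : 'I_3) (x y z : node k D) (d e : position k) (p q : puncture D).

Lemma initial_rt p (a b : 'I_k) (v : V) t d : connect ng (t, Some d) (nodev v) ->
  rt a b (cluster S0 p v) = \sum_(c | (t, c) \in val p) ((a < d c)%N%:Z - (b < d c)%N%:Z).
Proof.
move=> h; rewrite /cluster /= -/(nodev v) -(weight_connect adm h) ffunE /node_weight_at /=.
by rewrite (am_sum (additive_rt a b)); apply: eq_bigr => c _; apply: rt_omega.
Qed.

Lemma nodev_some (v : V) : exists t d, nodev v = (t, Some d).
Proof.
have mv : mutable_node M (nodev v) by rewrite /mutable_node nodev_node nodev_mutable.
by have [d ->] := mutable_some mv; exists (nodev v).1, d.
Qed.

Lemma initial_rt_ge0 p (a b : 'I_k) (v : V) : (a < b)%N -> 0 <= rt a b (cluster S0 p v).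
Proof.
move=> ab; have [t [d e]] := nodev_some v; rewrite (@initial_rt p a b v t d) ?e ?connect0 //.
by apply: sumr_ge0 => c _; case: (ltnP a (d c)); case: (ltnP b (d c)) => //; lia.
Qed.

Lemma initial_rt_gt0 p (a b : 'I_k) (v : V) t c d : (a < b)%N -> connect ng (t, Some d) (nodev v) ->
  (t, c) \in val p -> d c = b :> nat -> 0 < rt a b (cluster S0 p v).
Proof.
move=> ab h tc dc; rewrite (initial_rt p a b h) (bigD1 c) //= dc ab ltnn subr0.
apply: ltr_pwDl => //; apply: sumr_ge0 => c' _.
by case: (ltnP a (d c')); case: (ltnP b (d c')) => //; lia.
Qed.

Section RingNodes.
Variables (i : nat) (p : puncture D) (t : tri D) (c : 'I_3).
Hypotheses (i0 : (0 < i)%N) (ik : (i < k)%N) (tc : (t, c) \in val p).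

Lemma mutable_ring_node b g : (i + b + g = k)%N -> (bottom M t = None \/ b = 0%N \/ g = 0%N) ->
  mutable_node M (at3 k t c i b g).
Proof.
move=> h hb; have [e1 e2 e3] := pos3P c h; have [b1 b2] := puncture_side tc.
apply/andP; split.
  rewrite /is_node /=; case bt: (bottom M t) => [s|]; last by apply: is_position_pos3 => //; lia.
  have cs := puncture_bottom tc bt; subst s; rewrite e2 e3.
  have pp : is_position (pos3 k c i b g) by apply: is_position_pos3 => //; lia.
  by rewrite pp /=; case: hb => [|[->|->]]; rewrite ?bt ?eqxx ?orbT.
apply/negP => /existsP[j /andP[bj /eqP dj]]; move: bj dj.
by case: (I3P c j); rewrite ?(negbTE b1) ?(negbTE b2) // => _; rewrite e1; lia.
Qed.

Lemma mutable_left : mutable_node M (at3 k t c i 0 (k - i)).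
Proof. by apply: mutable_ring_node; [lia|right; left]. Qed.

Lemma mutable_right : mutable_node M (at3 k t c i (k - i) 0).
Proof. by apply: mutable_ring_node; [lia|right; right]. Qed.

Lemma left_right_disconnected v : connect ng (at3 k t c i 0 (k - i)) v ->
  ~ connect ng (at3 k t c i (k - i) 0) v.
Proof.
rewrite (@connect_node_sym k M D _ v) => h1 h2; have := connect_trans h2 h1.
move/(connect_tri adm) => /(_ erefl) /eqP; have h : (i + 0 + (k - i) = k)%N by lia.
have h' : (i + (k - i) + 0 = k)%N by lia.
by rewrite at3_eq //; have [_ -> _] := pos3P c h'; case/and4P => _ _ /eqP; lia.
Qed.

End RingNodes.

(** At height [b], the two side nodes of a corner at [p] are different vertices with positive root
    value; at most one of them is [x]. *)
Lemma initial_spread : seed_spread S0.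
Proof.
suff h p (a b : 'I_k) : (a < b)%N -> spread (cluster S0 p) a b.
  move=> p a b; rewrite -val_eqE /= neq_ltn => /orP[|/h sp x]; first exact: h.
  by have [v vx vn] := sp p x; exists v => //; rewrite rt_opp oppr_eq0.
move=> ab x; have [[t c] tc] := puncture_nonempty p.
have i0 : (0 < b)%N by lia.
have [v1 h1] := mutable_vertexP adm (mutable_left i0 (ltn_ord b) tc).
have [v2 h2] := mutable_vertexP adm (mutable_right i0 (ltn_ord b) tc).
have e1 : (b + 0 + (k - b) = k)%N by have := ltn_ord b; lia.
have e2 : (b + (k - b) + 0 = k)%N by have := ltn_ord b; lia.
have [f1 _ _] := pos3P c e1; have [f2 _ _] := pos3P c e2.
have n1 := initial_rt_gt0 ab h1 tc f1; have n2 := initial_rt_gt0 ab h2 tc f2.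
case: (eqVneq v1 x) => [e|vx]; last by exists v1 => //; rewrite gt_eqF // n1.
exists v2; last by rewrite gt_eqF // n2.
by apply/eqP => e'; subst v1 v2; case: (left_right_disconnected i0 (ltn_ord b) tc h1 h2).
Qed.

(** The height is the larger index of the root. At this height both side nodes of every corner at
    [p] have positive root value and represent different vertices, so they exhaust the support. *)
Lemma supported_sides p (a b : 'I_k) (x o : V) : a != b -> supported2 S0 p a b x o ->
  exists i : nat, [/\ (0 < i)%N, (i < k)%N & forall t c, (t, c) \in val p ->
   [/\ connect ng (at3 k t c i 0 (k - i)) (nodev x) & connect ng (at3 k t c i (k - i) 0) (nodev o)] \/
   [/\ connect ng (at3 k t c i 0 (k - i)) (nodev o) & connect ng (at3 k t c i (k - i) 0) (nodev x)]].
Proof.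
wlog ab : a b / (a < b)%N.
  move=> h; rewrite -val_eqE /= neq_ltn => /orP[ab|ab] sup.
    by apply: (h a b) => //; rewrite -val_eqE /= neq_ltn ab.
  apply: (h b a) => //; first by rewrite -val_eqE /= neq_ltn ab.
  by move=> v vx vo; rewrite rt_opp sup ?oppr0.
move=> _ sup; have i0 : (0 < b)%N by lia.
exists (b : nat); split=> // t c tc.
have e1 : (b + 0 + (k - b) = k)%N by have := ltn_ord b; lia.
have e2 : (b + (k - b) + 0 = k)%N by have := ltn_ord b; lia.
have [f1 _ _] := pos3P c e1; have [f2 _ _] := pos3P c e2.
have in2 y d (v : V) : y = (t, Some d) -> d c = b :> nat -> connect ng y (nodev v) ->
    connect ng y (nodev x) \/ connect ng y (nodev o).
  move=> -> dc h; have := initial_rt_gt0 ab h tc dc.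
  case: (eqVneq v x) => [<-|vx]; first by left.
  case: (eqVneq v o) => [<-|vo]; first by right.
  by rewrite sup.
have [v1 h1] := mutable_vertexP adm (mutable_left i0 (ltn_ord b) tc).
have [v2 h2] := mutable_vertexP adm (mutable_right i0 (ltn_ord b) tc).
have := in2 _ _ _ erefl f1 h1; have := in2 _ _ _ erefl f2 h2.
have nd v := left_right_disconnected i0 (ltn_ord b) tc (v := v).
move=> [g2|g2] [g1|g1]; [|by right|by left|]; by case: (nd _ g1 g2).
Qed.

Lemma connect_meet x y z : connect ng x z -> connect ng y z -> connect ng x y.
Proof. by move=> h1 h2; apply: connect_trans h1 _; rewrite connect_node_sym. Qed.

Lemma connect_side_tri t j d x : is_node M (t, Some d) -> d j = 0 :> nat -> ~~ boundary_side (t, j) ->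
  connect ng (t, Some d) x -> x.1 = t \/ x.1 = (glue (t, j)).1.
Proof.
move=> nx dj bj; rewrite (connect_side adm _ nx dj bj) => /orP[]/eqP ->; [by left|right].
by rewrite /mate_at.
Qed.

End InitialWeights.

Lemma left_sum i n : (i < n)%N -> (i + 0 + (n - i) = n)%N.
Proof. lia. Qed.

Lemma right_sum i n : (i < n)%N -> (i + (n - i) + 0 = n)%N.
Proof. lia. Qed.

Section InitialWeights.
Variables (k : nat) (M : moduli) (D : triangulation).
Hypothesis adm : admissible M D.
Local Notation ng := (@node_glue k M D).
Local Notation V := (mutable_vertex k M D).
Local Notation S0 := (initial_seed k M D).
Implicit Types (t : tri D) (c i j s : 'I_3) (x y z : node k D) (d e : position k) (p q : puncture D).

(** The pair would be formed by the two side vertices of every corner at [p] and of every corner at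
    [q]. Some triangle then has corners at both, but two different corners of a triangle have only
    one adjacent side in common. *)
Lemma initial_not_entangled p q : p != q -> ~ entangled S0 p q.
Proof.
move=> pq [x [o [a [b [a' [b' [xo ab ab' _ [sp sq]]]]]]]].
have [i [i0 ik hp]] := supported_sides adm ab sp.
have [i' [i0' ik' hq]] := supported_sides adm ab' sq.
have [[t c] tc] := puncture_nonempty p; have [[t' c'] tc'] := puncture_nonempty q.
have [b1 b2] := puncture_side tc.
have h := left_sum ik; have h2 := right_sum ik.
have [l1 l2 l3] := pos3P c h; have [r1 r2 r3] := pos3P c h2.
have [n1 _] := andP (mutable_left adm i0 ik tc); have [n2 _] := andP (mutable_right adm i0 ik tc).
have tri_l z : connect ng (at3 k t c i 0 (k - i)) z -> exists c1, (z.1, c1) \in val p.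
  move=> hz; case: (connect_side_tri adm n1 l2 b1 hz) => ->; first by exists c.
  exists (nx (t, c)).2; rewrite (_ : (_, _) = nx (t, c)); first exact: nx_puncture.
  by rewrite /nx /=.
have tri_r z : connect ng (at3 k t c i (k - i) 0) z -> exists c1, (z.1, c1) \in val p.
  move=> hz; case: (connect_side_tri adm n2 r3 b2 hz) => ->; first by exists c.
  case e: (glue (t, ord_pred c)) => [t1 j1] /=; exists (ord_pred j1).
  by have [<- _] := puncture_glue p e b2; rewrite ord_predK.
have hv (v : V) : connect ng (at3 k t c i 0 (k - i)) (nodev v) \/ connect ng (at3 k t c i (k - i) 0) (nodev v) ->
    connect ng (at3 k t' c' i' 0 (k - i')) (nodev v) -> exists c1, (t', c1) \in val p.
  by case=> g1 g2; [exact: (tri_l _ (connect_meet g1 g2))|exact: (tri_r _ (connect_meet g1 g2))].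
have [c1 tc1] : exists c1, (t', c1) \in val p.
  case: (hq _ _ tc') => -[g1 _]; refine (hv _ _ g1).
    by case: (hp _ _ tc) => -[h3 h4]; [left; exact: h3|right; exact: h4].
  by case: (hp _ _ tc) => -[h3 h4]; [right; exact: h4|left; exact: h3].
have g := left_sum ik'; have g2 := right_sum ik'.
have same y y' (v : V) : connect ng y (nodev v) -> connect ng y' (nodev v) -> y.1 = y'.1 -> y = y'.
  by move=> c2 c3 e; exact: (connect_tri adm (connect_meet c2 c3) e).
have [m1 m2 m3] := pos3P c1 h; have [m1' m2' m3'] := pos3P c1 h2.
have [o1 o2 o3] := pos3P c' g; have [o1' o2' o3'] := pos3P c' g2.
have fin : c1 = c' -> False.
  move=> e; case/eqP: pq; apply: (puncture_eq tc1); rewrite e; exact: tc'.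
have straight : at3 k t' c' i' 0 (k - i') = at3 k t' c1 i 0 (k - i) -> False.
  move/eqP; rewrite at3_eq // => /and4P[_ /eqP z1 /eqP z2 /eqP z3]; move: fin z1 z2 z3.
  by case: (I3P c' c1) => [/(_ erefl)//|_|_]; rewrite ?I3E ?o1 ?o2 ?o3; clear -i0 i0' ik ik'; lia.
have crossed : at3 k t' c' i' 0 (k - i') = at3 k t' c1 i (k - i) 0 ->
    at3 k t' c' i' (k - i') 0 = at3 k t' c1 i 0 (k - i) -> False.
  move=> /eqP E /eqP; move: E; rewrite !at3_eq // => /and4P[_ /eqP z1 /eqP z2 /eqP z3] /and4P[_ /eqP _ /eqP z5 _].
  move: fin z1 z2 z3 z5.
  by case: (I3P c' c1) => [/(_ erefl)//|_|_]; rewrite ?I3E ?o1 ?o2 ?o3 ?o1'; clear -i0 i0' ik ik'; lia.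
case: (hp _ _ tc1) (hq _ _ tc') => [][u1 u2] [][w1 w2].
- exact (straight (same _ _ x w1 u1 erefl)).
- exact (crossed (same _ _ o w1 u2 erefl) (same _ _ x w2 u1 erefl)).
- exact (crossed (same _ _ x w1 u2 erefl) (same _ _ o w2 u1 erefl)).
- exact (straight (same _ _ o w1 u1 erefl)).
Qed.

(* In such a triangle, both ends of an arrow of the ring around [p] have root
   value exactly one, which [word_potential] needs for one arrow. *)
Definition exact_corner p t c := (t, c) \in val p /\ forall c', (t, c') \in val p -> c' = c.

(** Without an exact corner at [r], a triangle with a corner at [r] has two of them, so every side
    has an end at [r] and the adjacent triangles meet [r] too. By connectedness all triangles have
    two corners at [r]; three corners cannot serve [p] and [q] in this way. *)
Lemma exact_corner_exists p q : p != q ->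
  (exists t c, exact_corner p t c) \/ (exists t c, exact_corner q t c).
Proof.
have key r : ~ (exists t c, exact_corner r t c) -> forall t, exists c1 c2,
   [/\ c1 != c2, (t, c1) \in val r & (t, c2) \in val r].
  move=> ne; have two t c : (t, c) \in val r -> exists2 c2, c2 != c & (t, c2) \in val r.
    move=> tc; apply: NNPP => h; apply: ne; exists t, c; split=> // c' tc'.
    by apply/eqP/negP => /negP cc; apply: h; exists c'.
  have [[t0 c0] tc0] := puncture_nonempty r.
  suff all t : exists c, (t, c) \in val r.
    by move=> t; have [c tc] := all t; have [c2 cc tc2] := two t c tc; exists c2, c.
  suff : t \in [pred t | [exists c, (t, c) \in val r]] by rewrite inE => /existsP.
  apply: connect_closed (tri_connected t0 t); last by rewrite inE; apply/existsP; exists c0.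
  move=> u w; rewrite !inE => /existsP[c tc] /existsP[i /eqP e].
  case: (boolP (boundary_side (u, i))) => [/eqP bi|bi].
    by move: e; rewrite bi /= => <-; apply/existsP; exists c.
  have [c' ci tc'] : exists2 c', c' != i & (u, c') \in val r.
    case: (eqVneq c i) => [ei|ci]; last by exists c.
    by have [c2 h1 h2] := two u c tc; exists c2; rewrite -?ei.
  case eg: (glue (u, i)) => [w' j]; move: e; rewrite eg /= => ew; subst w'.
  have [q1 q2] := puncture_glue r eg bi; apply/existsP.
  case: (I3P i c') ci tc' => [|_ tc'|_ tc']; first by rewrite eqxx.
    by exists (ord_pred j); rewrite -q1.
  by exists (ordS j); rewrite -q2.
move=> pq; apply: NNPP => /not_or_and[/key kp /key kq].
have [[t0 c0] _] := puncture_nonempty p.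
have [c1 [c2 [c12 p1 p2]]] := kp t0; have [c3 [c4 [c34 q1 q2]]] := kq t0.
have dis c c' : (t0, c) \in val p -> (t0, c') \in val q -> c' = c -> False.
  by move=> h1 h2 e; case/eqP: pq; apply: (puncture_eq h1); rewrite -e.
have e3 := dis _ _ p1 q1; have e4 := dis _ _ p1 q2; have e5 := dis _ _ p2 q1; have e6 := dis _ _ p2 q2.
move: c12 c34 e3 e4 e5 e6; clear.
by case: (I3P c1 c2); case: (I3P c1 c3); case: (I3P c1 c4); rewrite ?eqxx //; auto.
Qed.

End InitialWeights.

Lemma sum_orbit (T : finType) (A : zmodType) (f : T -> T) (x : T) (G : T -> A) : injective f ->
  \sum_(i < fingraph.order f x) G (iter i f x) = \sum_(y | fconnect f x y) G y.
Proof.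
move=> fi; rewrite -(big_mkord xpredT (fun i => G (iter i f x))).
transitivity (\sum_(y <- fingraph.orbit f x) G y).
  rewrite (big_nth x) size_orbit; apply: eq_big_nat => i /andP[_ hi].
  by rewrite /fingraph.orbit nth_traject.
rewrite -big_enum /=; apply: perm_big; apply: uniq_perm; rewrite ?orbit_uniq ?enum_uniq //.
by move=> y; rewrite mem_enum -fconnect_orbit.
Qed.

(** * Rings of arrows around a puncture *)

Section Steps.
Variables (k : nat) (M : moduli) (D : triangulation) (i : nat).
Hypotheses (i0 : (0 < i)%N) (ik : (i < k)%N).
Local Notation len := (@len k M D i).

Lemma len_gt0 t : (0 < len t)%N.
Proof. by rewrite /len; case: bottom; rewrite ?subn_gt0. Qed.

Lemma len_le t : (len t <= k)%N.
Proof. by rewrite /len; case: bottom => [a|]; lia. Qed.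

(* The arrows of the ring around a marked point: the arrow [(C, b)] goes from
   [src C b] to [tgtn C b]. *)
Definition ring_arrow := {e : corner D * 'I_k.+1 | (e.2 < len e.1.1)%N}.
Implicit Types (e : ring_arrow) (C : corner D).

Definition cor e : corner D := (val e).1.
Definition lev e : nat := (val e).2.

Lemma lev_lt e : (lev e < len (cor e).1)%N.
Proof. exact: (valP e). Qed.

Lemma ring_arrow_exists C b : (b < len C.1)%N -> exists e, cor e = C /\ lev e = b.
Proof.
move=> h; have hb : (b < k.+1)%N by have := len_le C.1; lia.
have h' : ((C, Ordinal hb).2 < len (C, Ordinal hb).1.1)%N by [].
by exists (Sub (C, Ordinal hb) h').
Qed.

Lemma ring_arrow_eq e e' : cor e = cor e' -> lev e = lev e' -> e = e'.
Proof.
case: e e' => [[C b] h] [[C' b'] h']; rewrite /cor /lev /= => e1 e2.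
by apply: val_inj; rewrite /= e1; congr (_, _); apply: val_inj.
Qed.

(** Inside a corner the level decreases; from level 0 the ring crosses a side and enters the next
    corner at its top level. The argument of [insubd] is always valid, so the default value does not
    occur. *)
Definition step e : ring_arrow :=
  insubd e (if lev e == 0 then (nx (cor e), inord (len (nx (cor e)).1).-1)
            else (cor e, inord (lev e).-1)).

Lemma step_val e (x : corner D * 'I_k.+1) : (x.2 < len x.1.1)%N ->
  (if lev e == 0%N then (nx (cor e), inord (len (nx (cor e)).1).-1)
            else (cor e, inord (lev e).-1)) = x -> cor (step e) = x.1 /\ lev (step e) = x.2.
Proof. by move=> h ex; rewrite /cor /lev /step ex insubdK. Qed.

Lemma step0 e : lev e = 0%N -> cor (step e) = nx (cor e) /\ lev (step e) = (len (nx (cor e)).1).-1.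
Proof.
move=> l0; have l1 := len_gt0 (nx (cor e)).1; have l2 := len_le (nx (cor e)).1.
have hb : ((len (nx (cor e)).1).-1 < k.+1)%N by lia.
have [||-> ->] := @step_val e (nx (cor e), inord (len (nx (cor e)).1).-1) => /=.
- by rewrite inordK // ltn_predL; exact: l1.
- by rewrite l0.
- by rewrite inordK.
Qed.

Lemma stepS e b : lev e = b.+1 -> cor (step e) = cor e /\ lev (step e) = b.
Proof.
move=> l0; have l1 := lev_lt e; have l2 := len_le (cor e).1.
have hb : (b < k.+1)%N by lia.
have [||-> ->] := @step_val e (cor e, inord b) => /=.
- by rewrite inordK //; lia.
- by rewrite l0.
- by rewrite inordK.
Qed.

Lemma step_inj : injective step.
Proof.
move=> e e' h; have l1 := len_gt0 (nx (cor e)).1; have l2 := len_gt0 (nx (cor e')).1.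
have h1 := lev_lt e; have h2 := lev_lt e'.
case E: (lev e) => [|b]; case E': (lev e') => [|b'].
- have [c1 _] := step0 E; have [c2 _] := step0 E'; apply: ring_arrow_eq; last by rewrite E E'.
  by apply: nx_inj; rewrite -c1 -c2 h.
- have [c1 g1] := step0 E; have [c2 g2] := stepS E'; exfalso.
  rewrite h c2 in c1; rewrite h g2 in g1; rewrite -c1 in g1 l1; clear -h2 E' g1 l1; lia.
- have [c1 g1] := stepS E; have [c2 g2] := step0 E'; exfalso.
  rewrite -h c1 in c2; rewrite -h g1 in g2; rewrite -c2 in g2 l2; clear -h1 E g2 l2; lia.
- have [c1 g1] := stepS E; have [c2 g2] := stepS E'; apply: ring_arrow_eq; first by rewrite -c1 -c2 h.
  by rewrite E E' -g1 -g2 h.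
Qed.

Lemma step_down e e' : cor e = cor e' -> (lev e' <= lev e)%N -> fconnect step e e'.
Proof.
move=> ec; move E: (lev e - lev e')%N => n; elim: n e ec E => [|n IH] e ec E le.
  have -> : e = e' by apply: ring_arrow_eq => //; lia.
  exact: connect0.
case El: (lev e) => [|b]; first by lia.
have [c1 g1] := stepS El; apply: connect_trans (fconnect1 _ _) _; apply: IH; rewrite ?c1 ?g1 //; lia.
Qed.

Lemma step_same e e' : cor e = cor e' -> fconnect step e e'.
Proof.
move=> ec; case: (leqP (lev e') (lev e)) => h; first exact: step_down.
by rewrite (fconnect_sym step_inj); apply: step_down; rewrite // ltnW.
Qed.

Lemma step_fconnect e e' : fconnect step e e' = fconnect (@nx D) (cor e) (cor e').
Proof.
apply/idP/idP => h.
  suff : e' \in [pred x | fconnect (@nx D) (cor e) (cor x)] by rewrite inE.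
  apply: connect_closed h; last by rewrite inE connect0.
  move=> u v; rewrite !inE => hu /eqP <-; case E: (lev u) => [|b].
    have [-> _] := step0 E; exact: connect_trans hu (fconnect1 _ _).
  by have [-> _] := stepS E.
suff : cor e' \in [pred C | [forall x, (cor x == C) ==> fconnect step e x]].
  by rewrite inE => /forallP/(_ e'); rewrite eqxx.
apply: connect_closed h; last first.
  by rewrite inE; apply/forallP => x; apply/implyP => /eqP ex; apply: step_same.
move=> C C'; rewrite !inE => /forallP hC /eqP <-; apply/forallP => x; apply/implyP => /eqP ex.
have [y [yC y0]] := ring_arrow_exists (len_gt0 C.1).
have := hC y; rewrite yC eqxx /= => hy; have [c1 g1] := step0 y0.
apply: connect_trans hy _; apply: connect_trans (fconnect1 _ _) _; apply: step_same.
by rewrite c1 yC.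
Qed.

End Steps.

Section Ring.
Variables (k : nat) (M : moduli) (D : triangulation) (i : nat) (p : puncture D).
Hypotheses (adm : admissible M D) (i0 : (0 < i)%N) (ik : (i < k)%N).
Local Notation ng := (@node_glue k M D).
Local Notation V := (mutable_vertex k M D).
Local Notation S0 := (initial_seed k M D).
Local Notation arrow := (ring_arrow k M D i).
Local Notation step := (@step k M D i).
Implicit Types (t : tri D) (c j s : 'I_3) (v : V) (e : arrow).

Definition in_p e := cor e \in val p.
Definition tg e : node k D := tgtn k i (cor e).1 (cor e).2 (lev e).
Definition sr e : node k D := src k M i (cor e).1 (cor e).2 (lev e).
Definition upn e : node k D := up k i (cor e).1 (cor e).2 (lev e).
Definition dn e : node k D := down k M i (cor e).1 (cor e).2 (lev e).
Definition Tv e v : int := TF M i (vind v) (cor e).1 (cor e).2 (lev e).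

Lemma cor_pair e : cor e = ((cor e).1, (cor e).2). Proof. exact: surjective_pairing. Qed.

Lemma in_p_pair e : in_p e -> ((cor e).1, (cor e).2) \in val p.
Proof. by rewrite /in_p {1}cor_pair. Qed.

Lemma lev_bound e : bottom M (cor e).1 = None -> (lev e < k - i)%N.
Proof. by move=> bt; have := lev_lt e; rewrite /len bt. Qed.

Lemma lev_bottom e s : bottom M (cor e).1 = Some s -> lev e = 0%N.
Proof. by move=> bt; have := lev_lt e; rewrite /len bt; case: (lev e). Qed.

Lemma lev_sum e : (i + lev e + (k - i - lev e) = k)%N.
Proof.
case bt: (bottom M (cor e).1) => [s|]; last by have := lev_bound bt; clear -ik; lia.
by rewrite (lev_bottom bt); clear -ik; lia.
Qed.

Lemma lev_lt_ki e : (lev e < k - i)%N.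
Proof.
case bt: (bottom M (cor e).1) => [s|]; last exact: lev_bound.
by rewrite (lev_bottom bt) subn_gt0.
Qed.

Lemma top_corner_p e : in_p e -> top_corner M (cor e).1 (cor e).2.
Proof. by move=> /in_p_pair h s; apply: puncture_bottom h. Qed.

Lemma tg_mutable e : in_p e -> mutable_node M (tg e).
Proof.
move=> h; apply: (mutable_ring_node adm i0 ik (in_p_pair h) (lev_sum e)).
by case bt: (bottom M (cor e).1) => [s|]; [right; left; exact: lev_bottom bt|left].
Qed.

Lemma nx_mate t c b g a : (t, c) \in val p -> (a + b + g = k)%N -> b = 0%N ->
  mate_at (at3 k t c a b g) (ordS c) = at3 k (nx (t, c)).1 (nx (t, c)).2 a g 0.
Proof.
move=> tc h b0; subst b; have [e1 e2 e3] := pos3P c h; rewrite /mate_at /at3 /= /nx /=.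
case e: (glue (t, ordS c)) => [t' j] /=; congr (_, Some _).
have h' : (a + g + 0 = k)%N by clear -h; lia.
have hs : (0 + a + g = k)%N by clear -h; lia.
by rewrite !I3E e1 e3; rewrite [LHS]pos3_rot.
Qed.

Lemma connect_nx t c a g : (t, c) \in val p -> (a + 0 + g = k)%N -> is_node M (at3 k t c a 0 g) ->
  connect ng (at3 k t c a 0 g) (at3 k (nx (t, c)).1 (nx (t, c)).2 a g 0).
Proof.
move=> tc h nx1; have [b1 _] := puncture_side tc; have [_ e2 _] := pos3P c h.
by rewrite (connect_side adm _ nx1 e2 b1) (nx_mate tc h erefl) eqxx orbT.
Qed.

Lemma sr_step e : in_p e -> connect ng (tg e) (sr (step e)).
Proof.
move=> h; rewrite /tg /sr /tgtn /src; case E: (lev e) => [|b].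
  have [-> ->] := step0 i0 ik E; rewrite subn0.
  have hh := left_sum ik.
  have := connect_nx (in_p_pair h) hh (proj1 (andP (mutable_left adm i0 ik (in_p_pair h)))).
  rewrite -cor_pair; case bt: (bottom M (nx (cor e)).1) => [s|] //.
  rewrite /len bt; have -> : ((k - i).-1.+1 = k - i)%N by clear -ik; lia.
  by have -> : ((k - i - (k - i).-1).-1 = 0)%N by clear -ik; lia.
have [-> ->] := stepS i0 ik E; have := lev_lt e; rewrite /len E.
case: (bottom M (cor e).1) => // hb.
have -> : ((k - i - b).-1 = k - i - b.+1)%N by clear -hb; lia.
exact: connect0.
Qed.

Lemma in_p_step e : in_p (step e) = in_p e.
Proof.
rewrite /in_p; case E: (lev e) => [|b]; last by have [-> _] := stepS i0 ik E.
have [-> _] := step0 i0 ik E; apply/idP/idP => [h|]; last exact: nx_puncture.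
rewrite (puncture_fconnect _ h); rewrite (fconnect_sym (@nx_inj D)); exact: fconnect1.
Qed.

Lemma vind_connect v x y : connect ng x y -> vind v x = vind v y.
Proof.
move=> h; rewrite /vind (_ : connect ng x _ = connect ng y (nodev v)) //.
exact: (same_connect (@connect_node_sym k M D) h).
Qed.

Lemma quiver_class v w x : mutable_node M x -> connect ng x (nodev w) ->
  quiver S0 v w = \sum_(y | connect ng y x) net M (vind v) y.
Proof.
move=> mx h; rewrite quiver_net; apply: eq_bigl => y.
by rewrite !(@connect_node_sym k M D y) (same_connect (@connect_node_sym k M D) h).
Qed.

(** Successive rhombi differ by the column of the exchange matrix at the vertex they share. When
    this vertex lies on a side, the contributions of two triangles are added. *)
Lemma Tv_step e v w : in_p e -> connect ng (tg e) (nodev w) ->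
  Tv (step e) v = Tv e v + quiver S0 v w.
Proof.
move=> h hw; have mt := tg_mutable h; rewrite (quiver_class v mt hw).
have nF := @vind_node k M D adm v; have nM := @vind_none k M D adm v.
have tc := top_corner_p h; have hp := in_p_pair h.
have [e1 e2 e3] := pos3P (cor e).2 (lev_sum e).
have [[dpos ->]|[j [dj bj ->]]] := class_sum adm (net M (vind v)) mt.
  have lpos : (0 < lev e)%N by rewrite -e2; exact: dpos.
  case E: (lev e) lpos => [//|b] _; have [c1 g1] := stepS i0 ik E.
  have bt : bottom M (cor e).1 = None.
    by case bt: (bottom M (cor e).1) => [s|] //; have := lev_bottom bt; rewrite E.
  have hb : (b.+1 < k - i)%N by rewrite -E; exact: lev_bound.
  have hn := net_inside adm i0 ik nF nM (cor e).2 bt hb; rewrite /tgtn /at3 in hn.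
  by rewrite /Tv c1 g1 E hn addrC subrK.
have lj : j = ordS (cor e).2.
  case: (I3P (cor e).2 j) dj => //; rewrite ?e1 ?e3 => dj; first by exfalso; move: i0 dj; clear; lia.
  by have := lev_lt_ki e; move: dj; clear; lia.
subst j; have E : lev e = 0%N by rewrite -e2.
have [c1 g1] := step0 i0 ik E; have hh : (i + 0 + (k - i) = k)%N := left_sum ik.
have tgE : tg e = at3 k (cor e).1 (cor e).2 i 0 (k - i) by rewrite /tg /tgtn E subn0.
have hpn : ((nx (cor e)).1, (nx (cor e)).2) \in val p by rewrite -surjective_pairing; apply: nx_puncture.
have tcn : top_corner M (nx (cor e)).1 (nx (cor e)).2 by move=> s; apply: puncture_bottom hpn.
rewrite (_ : ((cor e).1, Some _) = at3 k (cor e).1 (cor e).2 i 0 (k - i)); last exact: tgE.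
rewrite (nx_mate hp hh erefl) -cor_pair.
have a1 := net_tgt0 adm i0 ik nF nM tc; have a2 := net_src_last adm i0 ik nF nM tcn.
rewrite /tgtn subn0 in a1; rewrite a1 a2 /Tv c1 g1 E.
have v1 : vind v (at3 k (cor e).1 (cor e).2 i 0 (k - i)) =
    vind v (at3 k (nx (cor e)).1 (nx (cor e)).2 i (k - i) 0).
  apply: vind_connect; have := connect_nx hp hh (proj1 (andP (mutable_left adm i0 ik hp))).
  by rewrite -cor_pair.
have v2 : vind v (at3 k (cor e).1 (cor e).2 i.+1 0 (k - i).-1) =
    vind v (at3 k (nx (cor e)).1 (nx (cor e)).2 i.+1 (k - i).-1 0).
  have hs : (i.+1 + 0 + (k - i).-1 = k)%N by clear -ik; lia.
  case: (ltnP i.+1 k) => ik1.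
    have hs2 : (k - i).-1 = (k - i.+1)%N by clear; lia.
    apply: vind_connect; have nd := proj1 (andP (mutable_left adm (isT : (0 < i.+1)%N) ik1 hp)).
    rewrite -hs2 in nd; have := connect_nx hp hs nd; by rewrite -cor_pair.
  have e0 : (k - i).-1 = 0%N by clear -ik1; lia.
  have nn t c : ~~ is_node M (at3 k t c i.+1 0 0).
    apply/negP => /node_position /(is_positionP c)[_]; rewrite e0 in hs.
    by have [-> _ _] := pos3P c hs; clear -ik1; lia.
  by rewrite e0 !nF.
by rewrite v1 v2 /tgtn; clear; lia.
Qed.

Lemma four_nodes e : in_p e ->
  [/\ upn e != dn e, upn e != sr e, upn e != tg e & [/\ dn e != sr e, dn e != tg e & sr e != tg e]].
Proof.
move=> h; have hl := lev_lt_ki e; have [t1 t2 t3] := pos3P (cor e).2 (lev_sum e).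
have hu : (i.+1 + lev e + (k - i - lev e).-1 = k)%N by clear -hl; lia.
have [u1 u2 u3] := pos3P (cor e).2 hu.
rewrite /upn /dn /sr /tg /tgtn /up /down /src; case bt: (bottom M (cor e).1) => [s|].
  have hd : (i.-1 + (k - i).+1 + 0 = k)%N by clear -i0 ik; lia.
  have hr := right_sum ik.
  have [d1 d2 d3] := pos3P (cor e).2 hd; have [s1 s2 s3] := pos3P (cor e).2 hr.
  have l0 := lev_bottom bt; rewrite l0 in t1 t2 t3 u1 u2 u3 *.
  have ls := left_sum ik; rewrite subn0 in t1 t2 t3 u1 u2 u3 *.
  rewrite !at3_eq // ?u1 ?u2 ?u3 ?d1 ?d2 ?d3 ?s1 ?s2 ?s3 !eqxx /=.
  by split; [| | |split]; clear -i0 ik hl; lia.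
have hd : (i.-1 + (lev e).+1 + (k - i - lev e) = k)%N by clear -i0 ik hl; lia.
have hr : (i + (lev e).+1 + (k - i - lev e).-1 = k)%N by clear -i0 ik hl; lia.
have [d1 d2 d3] := pos3P (cor e).2 hd; have [s1 s2 s3] := pos3P (cor e).2 hr.
have ls := lev_sum e.
rewrite !at3_eq // ?u1 ?u2 ?u3 ?d1 ?d2 ?d3 ?s1 ?s2 ?s3 !eqxx /=.
by split; [| | |split]; clear -i0 ik hl; lia.
Qed.

Lemma vind_excl e v x y : x != y -> x.1 = y.1 -> vind v x + vind v y <= 1.
Proof.
move=> xy e1; rewrite /vind.
case: (boolP (connect ng x (nodev v))) => h1; case: (boolP (connect ng y (nodev v))) => h2 //.
by case/eqP: xy; exact: (connect_tri adm (connect_meet h1 h2) e1).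
Qed.

Lemma vind01 v x : vind v x = 0 \/ vind v x = 1.
Proof. by rewrite /vind; case: connect; [right|left]. Qed.

Lemma Tv_E e v : Tv e v = vind v (upn e) + vind v (dn e) - vind v (sr e) - vind v (tg e).
Proof. by []. Qed.

Lemma tri_same e : [/\ (upn e).1 = (cor e).1, (dn e).1 = (cor e).1, (sr e).1 = (cor e).1 & (tg e).1 = (cor e).1].
Proof. by rewrite /dn /down /sr /src; case: bottom. Qed.

(** The four nodes of a rhombus are distinct nodes of one triangle, so they represent distinct
    vertices and nothing cancels between them. *)
Lemma Tv_ge e v : in_p e -> -1 <= Tv e v /\
  nat_of_bool (Tv e v == -1) = (connect ng (tg e) (nodev v) + connect ng (sr e) (nodev v))%N.
Proof.
move=> h; rewrite Tv_E; have [n1 n2 n3 [n4 n5 n6]] := four_nodes h.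
have [q1 q2 q3 q4] := tri_same e.
have x2 := vind_excl e v n2 (etrans q1 (esym q3)); have x3 := vind_excl e v n3 (etrans q1 (esym q4)).
have x4 := vind_excl e v n4 (etrans q2 (esym q3)); have x5 := vind_excl e v n5 (etrans q2 (esym q4)).
have x6 := vind_excl e v n6 (etrans q3 (esym q4)); move: x2 x3 x4 x5 x6; rewrite /vind.
by case: (connect ng (upn e) _); case: (connect ng (dn e) _); case: (connect ng (sr e) _); case: (connect ng (tg e) _).
Qed.

Lemma Tv_le0 e v : in_p e -> vind v (upn e) = 0 -> vind v (dn e) = 0 -> Tv e v <= 0.
Proof.
by move=> h; rewrite Tv_E => -> ->; case: (vind01 v (sr e)) => ->; case: (vind01 v (tg e)) => ->.
Qed.

End Ring.

(** * Root values and weights along a ring *)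

Lemma sum_bool_card (T : finType) (P Q : pred T) :
  \sum_(x | P x) (Q x)%:Z = #|[set x | P x && Q x]|%:Z :> int.
Proof.
rewrite -sum1_card (big_morph Posz PoszD (erefl (0%:Z))) [RHS](eq_bigl (fun x => P x && Q x)).
  by rewrite big_mkcondr; apply: eq_bigr => x _; case: (Q x).
by move=> x; rewrite inE.
Qed.

Lemma omegaS k (a : 'I_k) : omega k a.+1 = omega k a + e_ a.
Proof.
rewrite /omega !(big_mkcond (fun i : 'I_k => (i < _)%N)) (bigD1 a) //= ltnSn addrC.
rewrite [X in _ = X + _](bigD1 a) //= ltnn add0r; congr (_ + _); apply: eq_bigr => i ia.
by rewrite ltnS leq_eqVlt val_eqE (negbTE ia).
Qed.

Lemma omega_full k : omega k k = 0.
Proof. by apply: rt_ext => a b; rewrite rt_omega !ltn_ord subrr (am0 (additive_rt a b)). Qed.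

Lemma sub_cross (A : zmodType) (x1 x2 x3 o1 o2 p1 p2 : A) :
  x1 + (o1 + p1) + (x2 + (o2 + p2)) - (x3 + (o2 + p1)) - (x3 + (o1 + p2)) = x1 + x2 - x3 - x3.
Proof.
rewrite [x1 + _ + _]addrACA -[LHS]addrA -[in LHS]opprD [x3 + _ + _]addrACA.
rewrite [o1 + p1]addrC [p1 + o1 + _]addrACA [p1 + o2]addrC.
by rewrite opprD [LHS]addrACA subrr addr0 opprD addrA.
Qed.

Section Ring.
Variables (k : nat) (M : moduli) (D : triangulation) (p : puncture D) (a b : 'I_k).
Hypotheses (adm : admissible M D) (ab : b = a.+1 :> nat).
Local Notation ng := (@node_glue k M D).
Local Notation V := (mutable_vertex k M D).
Local Notation S0 := (initial_seed k M D).
Local Notation i := (nat_of_ord b).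
Local Notation step := (@step k M D i).
Local Notation tg := (@tg k M D i).
Local Notation upn := (@upn k M D i).
Local Notation in_p := (@in_p k M D i).
Implicit Types (t : tri D) (c j s : 'I_3) (v : V) (e : ring_arrow k M D i) (d : position k).

Let i0 : (0 < i)%N. Proof. by rewrite ab. Qed.
Let ik : (i < k)%N := ltn_ord b.

Lemma rt_node v t d : connect ng (t, Some d) (nodev v) ->
  rt a b (cluster S0 p v) = \sum_(c | (t, c) \in val p) (d c == i :> nat)%:Z.
Proof.
move=> /(initial_rt adm p a b) ->; apply: eq_bigr => c _; rewrite ab.
by case: (ltngtP (d c) a.+1); lia.
Qed.

(** A node at height [i] over a corner is the target of exactly one arrow of that corner, unless it
    lies on the side where the ring enters. *)
Lemma count_tg t d : is_node M (t, Some d) ->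
  \sum_(e | in_p p e) (tg e == (t, Some d))%:Z =
  \sum_(c | (t, c) \in val p) ((d c == i :> nat) && (0 < d (ord_pred c))%N)%:Z.
Proof.
move=> nd; rewrite !sum_bool_card; congr Posz.
pose f (e : ring_arrow k M D i) := (cor e).2; rewrite -(card_in_imset (f := f)); last first.
  move=> e e'; rewrite !inE => /andP[_ /eqP h] /andP[_ /eqP h'] ff.
  have e1 : cor e = cor e'.
    by rewrite [LHS]cor_pair [RHS]cor_pair -/(f e) -/(f e') ff; congr (_, _); rewrite -[LHS]/((tg e).1) h -h'.
  apply: ring_arrow_eq => //; have [_ <- _] := pos3P (cor e).2 (lev_sum ik e).
  have [_ <- _] := pos3P (cor e').2 (lev_sum ik e').
  have := h; rewrite -h' /tg /tgtn /at3 => /(congr1 snd) /= [->].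
  by rewrite [(cor e).2]ff.
apply: eq_card => c; rewrite !inE; apply/imsetP/and3P => [[e]|[tc /eqP dc dp]].
  rewrite !inE => /andP[pe /eqP h] ->; have [e1 e2 e3] := pos3P (cor e).2 (lev_sum ik e).
  have et : (cor e).1 = t by rewrite -[LHS]/((tg e).1) h.
  have ed : pos3 k (cor e).2 i (lev e) (k - i - lev e) = d.
    by have := congr1 snd h; rewrite /tg /tgtn /at3 /= => -[].
  rewrite /f -et -ed e1 e3 eqxx subn_gt0 lev_lt_ki //; split=> //.
  by rewrite -surjective_pairing.
have [h1 h2 h3 h4] := is_positionP c (node_position nd); rewrite dc in h1 h2.
have hb : (d (ordS c) < len k M i t)%N.
  rewrite /len; case bt: (bottom M t) => [s|]; last by clear -h1 dp; lia.
  have cs := puncture_bottom tc bt; subst s.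
  move: nd; rewrite /is_node /= bt => /andP[_ /orP[/eqP ->//|/eqP d0]].
  by rewrite d0 in dp.
have [e [ec el]] := ring_arrow_exists i0 ik (C := (t, c)) hb; exists e; last by rewrite /f ec.
rewrite !inE /in_p ec tc /=; apply/eqP; rewrite /tg /tgtn ec el /at3 /=; congr (_, Some _).
rewrite [RHS](pos3_eq_self c (node_position nd)) dc; congr (pos3 _ _ _ _ _).
by clear -h1; lia.
Qed.

(** A node on a side is seen from two triangles, at a given corner as a target from one of them
    only; so targets count each passage of the ring through a vertex once. *)
Lemma count_vertex v :
  rt a b (cluster S0 p v) = \sum_(e | in_p p e) (connect ng (tg e) (nodev v))%:Z.
Proof.
have mv : mutable_node M (nodev v) by rewrite /mutable_node nodev_node nodev_mutable.
have [t [d ev]] := nodev_some v; rewrite ev in mv *.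
rewrite (@rt_node v t d) ?ev ?connect0 //.
transitivity (\sum_(y | connect ng y (t, Some d)) \sum_(e | in_p p e) (tg e == y)%:Z : int); last first.
  rewrite exchange_big /=; apply: eq_bigr => e _; rewrite big_mkcond (bigD1 (tg e)) //= eqxx big1 ?addr0.
    by case: connect.
  by move=> y /negbTE h; rewrite eq_sym h if_same.
have /andP[nd _] := mv.
have [[dp ->]|[j [dj bj ->]]] := class_sum adm (fun y => \sum_(e | in_p p e) (tg e == y)%:Z : int) mv.
  by rewrite count_tg //; apply: eq_bigr => c _; rewrite dp andbT.
have nm := is_node_mate adm nd dj bj; rewrite count_tg //.
move: nm; rewrite /mate_at /=; case e: (glue (t, j)) => [t' j'] /= nm; rewrite count_tg //.
have [h1 _ _ _] := is_positionP j (node_position nd); rewrite dj add0n in h1.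
have hs : (0 + d (ord_pred j) + d (ordS j) = k)%N by rewrite add0n addnC.
have [e1 e2 e3] := pos3P j' hs; have [q1 q2] := puncture_glue p e bj.
rewrite [LHS]big_mkcond [X in _ = X + _]big_mkcond [X in _ = _ + X]big_mkcond.
rewrite (big_I3 _ j) [X in _ = X + _](big_I3 _ j) [X in _ = _ + X](big_I3 _ j') /= !I3E q1 q2 e1 e2 e3 dj.
have [l1 l2] : (0 < d (ordS j))%N /\ (0 < d (ord_pred j))%N.
  have [_ _ x1 x2] := is_positionP j (node_position nd); clear -h1 x1 x2; lia.
rewrite l1 l2 !andbT !andbF [0%N == i]eq_sym (gtn_eqF i0) /= !if_same !add0r.
by rewrite addrC.
Qed.

Lemma weight_vind (x : node k D) : \sum_(v : V) weight S0 v *~ vind v x = weight_of M x.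
Proof.
case: (boolP (mutable_node M x)) => mx.
  have [v hv] := mutable_vertexP adm mx; have /andP[nx _] := mx.
  rewrite (bigD1 v) // big1; last first.
    move=> u /andP[_ uv]; rewrite /vind; case: (boolP (connect ng x (nodev u))) => // hu.
    by case/eqP: uv; apply: connect_nodev hu hv.
  by rewrite /vind hv mulr1z /weight_of nx (weight_connect adm hv) /= addr0.
rewrite big1 => [|v _]; last first.
  rewrite /vind; case: (boolP (connect ng x (nodev v))) => // h.
  by move: mx; rewrite (mutable_connect adm h) /mutable_node nodev_node nodev_mutable.
rewrite /weight_of; case: ifP => // nx; rewrite (frozen_weight nx) //.
by move: mx; rewrite /mutable_node nx negbK.
Qed.

Lemma weight_at3 t c x y z q : (x + y + z = k)%N -> (t, c) \in val p ->
  (bottom M t = None \/ y = 0%N \/ z = 0%N) ->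
  weight_of M (at3 k t c x y z) q =
  (if (t, c) \in val q then omega k x else 0) +
  ((if (t, ordS c) \in val q then omega k y else 0) +
   (if (t, ord_pred c) \in val q then omega k z else 0)).
Proof.
move=> h tc hb; have [e1 e2 e3] := pos3P c h; rewrite /weight_of.
case: ifP => nd.
  by rewrite ffunE /node_weight_at /= big_mkcond (big_I3 _ c) /= e1 e2 e3.
rewrite ffunE; have big : (x == k) || (y == k) || (z == k).
  apply: contraFT nd; rewrite !negb_or -andbA => /and3P[xk yk zk].
  rewrite /is_node /=; have pp : is_position (pos3 k c x y z).
    by apply: is_position_pos3 => //; clear -h xk yk zk; lia.
  case bt: (bottom M t) => [s|] //; have cs := puncture_bottom tc bt; subst s.
  by rewrite pp e2 e3; case: hb => [|[->|->]]; rewrite ?bt ?eqxx ?orbT.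
have [hx hy hz] : [/\ x = 0%N \/ x = k, y = 0%N \/ y = k & z = 0%N \/ z = k].
  by clear -h big; split; move: big; lia.
have om n : n = 0%N \/ n = k -> omega k n = 0 by case=> ->; rewrite ?omega0 ?omega_full.
by rewrite !om // !if_same !addr0.
Qed.

(** [omega (i + 1) + omega (i - 1) - 2 omega i] is minus a simple root, while at the other two
    corners of the triangle the contributions of the rhombus cancel. *)
Lemma Tv_weight e : in_p p e -> \sum_(v : V) weight S0 v *~ Tv e v = - alpha_at p a b.
Proof.
move=> pe; under eq_bigr => v _ do rewrite Tv_E !mulrzBr mulrzDr.
rewrite !sumrB big_split /= !weight_vind; apply/ffunP => q; rewrite !ffunE.
have hp := in_p_pair pe; have hl := lev_lt_ki ik e; have ls := lev_sum ik e.
have hu : (i.+1 + lev e + (k - i - lev e).-1 = k)%N by clear -hl; lia.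
have ea : omega k i.+1 + omega k i.-1 - omega k i - omega k i = - alpha a b.
  have -> : i.-1 = a by rewrite ab.
  have om : omega k b = omega k a + e_ a by rewrite ab omegaS.
  rewrite omegaS om /alpha.
  by apply: rt_ext => x y; rewrite !(amN (additive_rt x y), additive_rt x y) -/(rt x y _); lia.
have qp : ((cor e).1, (cor e).2) \in val q = (q == p).
  by apply/idP/eqP => [h|->//]; apply: puncture_eq h hp.
have el : ((lev e).+1 + (k - i - lev e).-1 = k - i)%N by clear -hl; lia.
have fin : (if q == p then omega k i.+1 else 0) + (if q == p then omega k i.-1 else 0)
    - (if q == p then omega k i else 0) - (if q == p then omega k i else 0) =
    - (if q == p then alpha a b else 0).
  by case: (q == p); rewrite ?ea // !subr0 addr0 oppr0.
case bt: (bottom M (cor e).1) => [s|]; rewrite /upn /dn /sr /tg /up /down /src /tgtn bt.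
  have l0 := lev_bottom bt; rewrite l0 subn0 in ls hu *.
  have hd : (i.-1 + (k - i).+1 + 0 = k)%N by clear -i0 ik; lia.
  rewrite (weight_at3 q hu hp (or_intror (or_introl erefl))) (weight_at3 q hd hp (or_intror (or_intror erefl))).
  rewrite (weight_at3 q (right_sum ik) hp (or_intror (or_intror erefl))).
  rewrite (weight_at3 q ls hp (or_intror (or_introl erefl))) qp.
  have cs := puncture_bottom hp bt; subst s.
  have -> : ((cor e).1, ordS (cor e).2) \in val q = false.
    by apply/negP => /puncture_bottom/(_ bt)/eqP; rewrite I3E.
  have -> : ((cor e).1, ord_pred (cor e).2) \in val q = false.
    by apply/negP => /puncture_bottom/(_ bt)/eqP; rewrite I3E.
  by rewrite !addr0.
have hd : (i.-1 + (lev e).+1 + (k - i - lev e) = k)%N by clear -i0 ik hl; lia.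
have hr : (i + (lev e).+1 + (k - i - lev e).-1 = k)%N by clear -i0 ik hl; lia.
have nb y z : bottom M (cor e).1 = None \/ y = 0%N \/ z = 0%N by left.
rewrite (weight_at3 q hu hp (nb _ _)) (weight_at3 q hd hp (nb _ _)) (weight_at3 q hr hp (nb _ _)).
by rewrite (weight_at3 q ls hp (nb _ _)) qp sub_cross.
Qed.

End Ring.

Section Ring.
Variables (k : nat) (M : moduli) (D : triangulation) (p : puncture D) (a b : 'I_k).
Hypotheses (adm : admissible M D) (ab : b = a.+1 :> nat).
Local Notation ng := (@node_glue k M D).
Local Notation V := (mutable_vertex k M D).
Local Notation S0 := (initial_seed k M D).
Local Notation i := (nat_of_ord b).
Local Notation step := (@step k M D i).
Local Notation tg := (@tg k M D i).
Local Notation sr := (@sr k M D i).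
Local Notation upn := (@upn k M D i).
Local Notation dn := (@dn k M D i).
Local Notation in_p := (@in_p k M D i).
Implicit Types (t : tri D) (c j s : 'I_3) (v : V) (e : ring_arrow k M D i) (d : position k).

Let i0 : (0 < i)%N. Proof. by rewrite ab. Qed.
Let ik : (i < k)%N := ltn_ord b.

Lemma ring_vertexP e : in_p p e -> exists v : V, connect ng (tg e) (nodev v).
Proof. by move=> pe; apply: (mutable_vertexP adm (tg_mutable adm i0 ik pe)). Qed.

Lemma rt_exact t c v x y z : exact_corner p t c -> (x + y + z = k)%N ->
  connect ng (at3 k t c x y z) (nodev v) -> rt a b (cluster S0 p v) = (x == i :> nat)%:Z.
Proof.
move=> [tc ex] h hv; have [e1 _ _] := pos3P c h.
rewrite (rt_node p adm ab hv) (bigD1 c) //= e1 big1 ?addr0 // => c' /andP[pc' cc'].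
by case/eqP: cc'; apply: ex.
Qed.

Lemma ring_potential t0 c0 : exact_corner p t0 c0 ->
  (forall v, rt a b (cluster S0 p v) = 0 -> exists2 e, in_p p e & Tv e v <= 0) ->
  potential rat S0 (rt_at p a b) (alpha_at p a b).
Proof.
move=> ex W6; have [tc0 ex0] := ex.
(* The word starts at the arrow of level 0 of the exact corner: its target is the first letter, its
   source the last one, and on both the root value is 1. *)
have [e0 [ec0 el0]] := ring_arrow_exists i0 ik (C := (t0, c0)) (len_gt0 M ik t0).
have pe0 : in_p p e0 by rewrite /in_p ec0.
have [v0 hv0] := ring_vertexP pe0.
pose J n := iter n step e0.
have pJ n : in_p p (J n) by elim: n => //= n IH; rewrite in_p_step.
pose tgt n : V := odflt v0 [pick v | connect ng (tg (J n)) (nodev v)].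
have tgtP n : connect ng (tg (J n)) (nodev (tgt n)).
  rewrite /tgt; case: pickP => [v //|h]; have [v hv] := ring_vertexP (pJ n).
  by have := h v; rewrite hv.
have tgtE n v : (tgt n == v) = connect ng (tg (J n)) (nodev v).
  by apply/eqP/idP => [<-|h]; [exact: tgtP|exact: connect_nodev (tgtP n) h].
have srE n v : (tgt n == v) = connect ng (sr (J n.+1)) (nodev v).
  rewrite tgtE; exact: (same_connect (@connect_node_sym k M D) (sr_step adm i0 ik (pJ n))).
have inj := @step_inj k M D i i0 ik.
have o0 := fingraph.order_gt0 step e0; move oM: (fingraph.order step e0) o0 => N; case: N oM => // m oM _.
have per : J m.+1 = e0 by rewrite /J -oM; apply: iter_order.
have inpE e : in_p p e = fconnect step e0 e.
  by rewrite step_fconnect // -(puncture_fconnect _ pe0).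
have exE v x y z : (x + y + z = k)%N -> connect ng (at3 k t0 c0 x y z) (nodev v) ->
    rt a b (cluster S0 p v) = (x == i :> nat)%:Z := rt_exact ex.
have hl := lev_lt_ki ik e0; have ls := lev_sum ik e0.
have [q1 q2 q3 q4] := tri_same e0.
have [n1 n2 n3 [n4 n5 n6]] := four_nodes i0 ik pe0.
have srm v : connect ng (sr e0) (nodev v) -> tgt m = v.
  by move=> h; apply/eqP; rewrite srE per.
have srP : connect ng (sr e0) (nodev (tgt m)) by rewrite -per -srE.
apply: (@word_potential _ _ _ _ _ m tgt (fun n v => Tv (J n) v)).
- exact: additive_rt_at.
- exact: initial_skew.
- exact: initial_balanced adm.
- move=> v; rewrite rt_atE (count_vertex p adm ab) (eq_bigl _ _ inpE).
  rewrite -(sum_orbit _ _ inj) oM (big_morph Posz PoszD (erefl (0%:Z))).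
  by apply: eq_bigr => n _; rewrite tgtE.
- by apply/eqP; rewrite tgtE per; exact: (tgtP 0).
- by move=> n v _; apply: (Tv_step adm i0 ik v (pJ n)); exact: tgtP.
- by move=> n v _; have [] := Tv_ge adm i0 ik v (pJ n.+1).
- by move=> n v _; rewrite (tgtE n.+1) (srE n); have [] := Tv_ge adm i0 ik v (pJ n.+1).
- exact: (Tv_weight adm ab pe0).
- rewrite rt_atE (@exE _ i (lev e0) (k - i - lev e0)%N) ?eqxx //.
  by have := tgtP 0; rewrite /tg /tgtn ec0.
- rewrite rt_atE; move: srP; rewrite /sr /src ec0 /=; case bt: (bottom M t0) => [s|] h.
    by rewrite (exE _ _ _ _ (right_sum ik) h) eqxx.
  rewrite (exE _ i (lev e0).+1 (k - i - lev e0).-1 _ h) ?eqxx //.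
  by clear -hl ik; lia.
- apply: contra n6 => /eqP h; apply/eqP; apply: (connect_tri adm _ (etrans q3 (esym q4))).
  by apply: connect_meet srP _; rewrite -h; exact: (tgtP 0).
(* At an exact corner, the apexes of the rhombus have heights [i + 1] and [i - 1] and no other
   corner at [p], so the root vanishes on them. *)
- move=> v vt vm; rewrite rt_atE => nz; apply: (Tv_le0 pe0).
    rewrite /vind; case: (boolP (connect ng (upn e0) (nodev v))) => // h.
    case/eqP: nz; move: h; rewrite /upn /up ec0 => h.
    rewrite (exE _ _ _ _ _ h); last by clear -hl ik; lia.
    by rewrite gtn_eqF.
  rewrite /vind; case: (boolP (connect ng (dn e0) (nodev v))) => // h.
  case/eqP: nz; move: h; rewrite /dn /down ec0 /=; case: (bottom M t0) => [s|] h.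
    rewrite (exE _ _ _ _ _ h); last by clear -i0 ik; lia.
    by rewrite ltn_eqF // ltn_predL.
  rewrite (exE _ _ _ _ _ h); last by clear -hl i0 ik; lia.
  by rewrite ltn_eqF // ltn_predL.
- move=> v; rewrite rt_atE => /W6[e pe te].
  have : fconnect step e0 (finv step e) by rewrite -inpE -(in_p_step p i0 ik) f_finv // .
  move=> /iter_findex fe; have hf : fconnect step e0 (finv step e).
    by rewrite -inpE -(in_p_step p i0 ik) f_finv.
  exists (findex step e0 (finv step e)).
    by have := findex_max hf; rewrite oM ltnS.
  by rewrite /J /= fe f_finv.
Qed.

End Ring.

(** * The exceptional case of the thrice-punctured sphere *)

Section ClosedRing.
Variables (D : triangulation) (p : puncture D).
Hypotheses (reg : regular D) (cl : forall C : corner D, C \in val p -> glue C = nx C).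
Implicit Types (t : tri D) (c j s : 'I_3) (C : corner D).

(** A corner read as a side is the side opposite to it. As opposite sides of successive triangles
    are glued together, the ring closes after two triangles. *)
Lemma closed_ring_opposite C : C \in val p ->
  [/\ glue C = ((nx C).1, (nx C).2), glue (C.1, ordS C.2) = ((nx C).1, ord_pred (nx C).2) &
      glue (C.1, ord_pred C.2) = ((nx C).1, ordS (nx C).2)].
Proof.
move=> pC; have pC' := nx_puncture pC; have e := cl pC; split.
- by rewrite -surjective_pairing.
- by rewrite /nx /= ordSK -surjective_pairing.
have : nx (nx C) = C by rewrite -(cl pC') -e glueK.
move: (nx C) => C'; rewrite /nx; case g: (glue (C'.1, ordS C'.2)) => [t j] /= <- /=.
by rewrite ordSK -g glueK.
Qed.

End ClosedRing.

Section Sphere.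
Variables (D : triangulation) (t t' : tri D) (c c' : 'I_3).
Hypotheses (tt : t != t') (g0 : glue (t, c) = (t', c')) (g1 : glue (t, ordS c) = (t', ord_pred c'))
  (g2 : glue (t, ord_pred c) = (t', ordS c')).
Implicit Types (C : corner D).

Lemma two_triangles u : u = t \/ u = t'.
Proof.
have : u \in [pred x | (x == t) || (x == t')].
  apply: connect_closed (tri_connected t u); last by rewrite inE eqxx.
  move=> x y; rewrite !inE => /orP[] /eqP -> /existsP[j].
    by case: (I3P c j); rewrite ?g0 ?g1 ?g2 eq_sym => ->; rewrite orbT.
  by case: (I3P c' j); rewrite -?g0 -?g1 -?g2 glueK eq_sym => ->.
by rewrite inE => /orP[] /eqP; [left|right].
Qed.

Lemma two_triangles_closed (s : side D) : ~~ boundary_side s.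
Proof.
case: s => u j; rewrite /boundary_side; have [->|->] := two_triangles u.
  by case: (I3P c j); rewrite ?g0 ?g1 ?g2 xpair_eqE eq_sym (negbTE tt).
by case: (I3P c' j); rewrite -?g0 -?g1 -?g2 glueK ?g0 ?g1 ?g2 xpair_eqE (negbTE tt).
Qed.

(* The marked points are the classes of the corners of [t]. *)
Definition repr_corner C : 'I_3 :=
  if C.1 == t then C.2 else if C.2 == c' then c else if C.2 == ordS c' then ord_pred c else ordS c.

Lemma repr_nx C : repr_corner (nx C) = repr_corner C.
Proof.
case: C => u j; have [->|->] := two_triangles u; rewrite /repr_corner /nx /= ?eqxx.
  case: (I3P c j); rewrite ?I3E ?g0 ?g1 ?g2 /= eq_sym (negbTE tt) ?I3E ?eqxx //.
rewrite [t' == t]eq_sym (negbTE tt); case: (I3P c' j); rewrite ?I3E ?eqxx.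
- by rewrite -g2 glueK /= eqxx I3E.
- by rewrite -g1 glueK /= eqxx I3E.
- by rewrite -g0 glueK /= eqxx.
Qed.

Lemma repr_glue C C' : corner_glue C C' -> repr_corner C = repr_corner C'.
Proof. by move=> /corner_glue_nx[<-|<-]; rewrite repr_nx. Qed.

Lemma marked_puncture C : is_puncture (marked_point_of C).
Proof.
apply/andP; split; first by apply/existsP; exists C.
by apply/forall_inP => C' _; rewrite /boundary_corner negb_or !two_triangles_closed.
Qed.

Lemma repr_puncture (q : puncture D) : val q = marked_point_of (t, repr_corner (odflt (t, c) [pick C in val q])).
Proof.
case: pickP => [C qC|h]; last by have [C qC] := puncture_nonempty q; rewrite h in qC.
rewrite /=; suff h : (t, repr_corner C) \in val q.
  by apply/setP => C'; rewrite inE (puncture_connect C' h).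
case: C qC => u j; have [->|->] := two_triangles u => qC; rewrite /repr_corner /= ?eqxx //.
have b := two_triangles_closed (t', ordS j); have h := nx_puncture qC; move: h.
rewrite [t' == t]eq_sym (negbTE tt) /nx /=; case: (I3P c' j) {b qC}; rewrite ?I3E ?eqxx.
- by rewrite -g2 glueK /= I3E.
- by rewrite -g1 glueK /= I3E.
- by rewrite -g0 glueK.
Qed.

Lemma two_triangles_sphere : thrice_punctured_sphere D.
Proof.
have p3 : #|{: puncture D}| = 3.
  rewrite -[RHS](card_ord 3).
  pose f (j : 'I_3) : puncture D := Sub _ (marked_puncture (t, j)).
  pose g (q : puncture D) := repr_corner (odflt (t, c) [pick C in val q]).
  have gf : cancel g f by move=> q; apply: val_inj; rewrite /= -repr_puncture.
  have fg : cancel f g.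
    move=> j; rewrite /g; case: pickP => [C|/(_ (t, j))]; last by rewrite /= inE connect0.
    rewrite /= inE => h; have : C \in [pred x | repr_corner x == j].
      apply: connect_closed h; last by rewrite inE /repr_corner eqxx.
      by move=> x y; rewrite !inE => /eqP <- /repr_glue ->.
    by rewrite inE => /eqP.
  by apply: (bij_eq_card (f := g)); exists f.
have t2 : #|tri D| = 2.
  rewrite -[RHS](_ : #|[set t; t']| = 2); last by rewrite cards2 tt.
  by apply: eq_card => u; rewrite !inE; have [->|->] := two_triangles u; rewrite eqxx ?orbT.
rewrite /thrice_punctured_sphere p3 t2 /= !andbT.
by apply/forallP => s; exact: two_triangles_closed.
Qed.

End Sphere.

Section Ring.
Variables (k : nat) (M : moduli) (D : triangulation) (i : nat) (p : puncture D) (v : mutable_vertex k M D).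
Hypotheses (adm : admissible M D) (i0 : (0 < i)%N) (ik : (i < k)%N).
Local Notation ng := (@node_glue k M D).
Implicit Types (t : tri D) (c j s : 'I_3).
Hypothesis H : forall e : ring_arrow k M D i, in_p p e ->
  connect ng (upn e) (nodev v) \/ connect ng (dn e) (nodev v).

Lemma around t c b : (t, c) \in val p -> (b < len k M i t)%N ->
  connect ng (up k i t c b) (nodev v) \/ connect ng (down k M i t c b) (nodev v).
Proof.
move=> tc hb; have [e [ec el]] := ring_arrow_exists i0 ik (C := (t, c)) hb.
by have := @H e; rewrite /in_p /upn /dn ec el; apply.
Qed.

Lemma around_node x : connect ng x (nodev v) -> is_node M x.
Proof. by move=> h; rewrite (connect_node adm h) nodev_node. Qed.

Lemma around_eq x y : connect ng x (nodev v) -> connect ng y (nodev v) -> x.1 = y.1 -> x = y.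
Proof. by move=> h1 h2; apply: (connect_tri adm (connect_meet h1 h2)). Qed.

Lemma around_lt t c x y z : (x + y + z = k)%N -> connect ng (at3 k t c x y z) (nodev v) ->
  [/\ x < k, y < k & z < k]%N.
Proof.
move=> h /around_node/node_position/(is_positionP c)[_].
by have [-> -> ->] := pos3P c h.
Qed.

(** In a bottom triangle both apexes of the only rhombus lie on sides that are glued to neighbours
    in the ring. Seen from the neighbour across that side, the same node is not an apex of the
    rhombus of level 0. *)
Lemma around_bottom t c : (t, c) \in val p -> bottom M t = None.
Proof.
move=> tc; case bt: (bottom M t) => [s|] //; exfalso.
have hb t1 : (0 < len k M i t1)%N := len_gt0 M ik t1.
have hu : (i.+1 + 0 + (k - i).-1 = k)%N by clear -ik; lia.
have hd : (i.-1 + (k - i).+1 + 0 = k)%N by clear -i0 ik; lia.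
have hd2 : (i.-1 + 1 + (k - i) = k)%N by clear -i0 ik; lia.
case: (around tc (hb t)); rewrite /up /down ?bt ?subn0 => h.
  have [ik1 _ _] := around_lt hu h.
  have h2 := connect_nx adm tc hu (around_node h).
  have tn := nx_puncture tc; rewrite [nx _]surjective_pairing in tn.
  have h3 : connect ng (at3 k (nx (t, c)).1 (nx (t, c)).2 i.+1 (k - i).-1 0) (nodev v).
    by apply: connect_trans h; rewrite (@connect_node_sym k M D).
  have hs : (i.+1 + (k - i).-1 + 0 = k)%N by clear -ik; lia.
  case: (around tn (hb _)) => h4.
    have /eqP := around_eq h4 h3 erefl; rewrite /up at3_eq // ?subn0.
    have [-> -> ->] := pos3P (nx (t, c)).2 hu => /and4P[_ _ /eqP a1 _].
    by clear -a1 ik1; lia.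
  move: h4; rewrite /down subn0; case: (bottom M _) => [s'|] h4.
    have /eqP := around_eq h4 h3 erefl; rewrite at3_eq //.
    have [-> -> ->] := pos3P (nx (t, c)).2 hd => /and4P[_ /eqP a1 _ _].
    by clear -a1 i0; lia.
  have /eqP := around_eq h4 h3 erefl; rewrite at3_eq //.
  have [-> -> ->] := pos3P (nx (t, c)).2 hd2 => /and4P[_ /eqP a1 _ _].
  by clear -a1 i0; lia.
have [_ kk _] := around_lt hd h.
have [b1 b2] := puncture_side tc.
case g: (glue (t, ord_pred c)) => [t1 j1].
have tc1 : (t1, ord_pred j1) \in val p.
  by have [<- _] := puncture_glue p g b2; rewrite ord_predK.
have nxE : nx (t1, ord_pred j1) = (t, c) by rewrite /nx /= ord_predK (glue_inv g) /= I3E.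
have i1 : (0 < i.-1)%N by clear -kk i0; lia.
have i1k : (i.-1 < k)%N by clear -ik; lia.
have hs : (i.-1 + 0 + (k - i.-1) = k)%N by clear -i1k; lia.
have h2 := connect_nx adm tc1 hs (proj1 (andP (mutable_left adm i1 i1k tc1))).
have h3 : connect ng (at3 k t1 (ord_pred j1) i.-1 0 (k - i.-1)) (nodev v).
  apply: connect_trans h2 _; rewrite nxE /= (_ : k - i.-1 = (k - i).+1)%N //.
  by clear -i0 ik; lia.
case: (around tc1 (hb _)) => h4.
  have /eqP := around_eq h4 h3 erefl; rewrite /up at3_eq // ?subn0.
  have [-> -> ->] := pos3P (ord_pred j1) hu => /and4P[_ /eqP a1 _ _].
  by clear -a1 i0; lia.
move: h4; rewrite /down subn0; case: (bottom M _) => [s'|] h4.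
  have /eqP := around_eq h4 h3 erefl; rewrite at3_eq //.
  by have [-> -> ->] := pos3P (ord_pred j1) hd => /and4P[_ _ /eqP a1 _].
have /eqP := around_eq h4 h3 erefl; rewrite at3_eq //.
by have [-> -> ->] := pos3P (ord_pred j1) hd2 => /and4P[_ _ /eqP a1 _].
Qed.

(** Consecutive arrows inside a triangle have no apex in common, so each triangle contains one arrow
    and [k - i = 1]. Its upper apex [(k, 0, 0)] is not a node, so [v] is the lower one. *)
Lemma around_interior t c : (t, c) \in val p ->
  k = i.+1 /\ connect ng (at3 k t c i.-1 1 1) (nodev v).
Proof.
move=> tc; have bt := around_bottom tc.
have h0 : (0 < len k M i t)%N := len_gt0 M ik t.
have hu : (i.+1 + 0 + (k - i).-1 = k)%N by clear -ik; lia.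
have hd2 : (i.-1 + 1 + (k - i) = k)%N by clear -i0 ik; lia.
case: (ltnP i.+1 k) => ik1.
  exfalso; have h1 : (1 < len k M i t)%N by rewrite /len bt; clear -ik1; lia.
  have hu2 : (i.+1 + 1 + (k - i - 1).-1 = k)%N by clear -ik1; lia.
  have hd3 : (i.-1 + 2 + (k - i - 1) = k)%N by clear -i0 ik1; lia.
  case: (around tc h0) => g1; case: (around tc h1) => g2.
  - have /eqP := around_eq g1 g2 erefl; rewrite /up subn0 at3_eq //.
    by have [-> -> ->] := pos3P c hu => /and4P[_ _ /eqP a1 _].
  - move: g1 g2; rewrite /up /down ?bt ?subn0 => g1 g2.
    have /eqP := around_eq g1 g2 erefl; rewrite at3_eq //.
    by have [-> -> ->] := pos3P c hu => /and4P[_ /eqP a1 _ _]; clear -a1 i0; lia.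
  - move: g1 g2; rewrite /up /down ?bt ?subn0 => g1 g2.
    have /eqP := around_eq g1 g2 erefl; rewrite at3_eq //.
    by have [-> -> ->] := pos3P c hd2 => /and4P[_ /eqP a1 _ _]; clear -a1 i0; lia.
  - move: g1 g2; rewrite /up /down ?bt ?subn0 => g1 g2.
    have /eqP := around_eq g1 g2 erefl; rewrite at3_eq //.
    by have [-> -> ->] := pos3P c hd2 => /and4P[_ _ /eqP a1 _].
have ek : k = i.+1 by apply/eqP; rewrite eqn_leq ik1 ik.
split=> //; have e1 : (k - i = 1)%N by rewrite ek subSnn.
case: (around tc h0); rewrite /up /down ?bt subn0 => h.
  by have [h1 _ _] := around_lt hu h; rewrite ltnNge ik1 in h1.
by rewrite e1 in h.
Qed.

(** The vertex [v] sits at [(i - 1, 1, 1)] in every triangle at [p]. Being common to a triangle and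
    the next one, it lies on a side; so [i = 1], and the sides opposite to the two corners are
    glued. *)
Lemma around_sphere : k = 2 /\ thrice_punctured_sphere D.
Proof.
have [[t0 c0] tc0] := puncture_nonempty p.
have [ek _] := around_interior tc0.
have h3 : (i.-1 + 1 + 1 = k)%N by rewrite ek; clear -i0; lia.
have key t c : (t, c) \in val p -> i = 1%N /\ glue (t, c) = nx (t, c).
  move=> tc; have tn := nx_puncture tc; have [b1 _] := puncture_side tc.
  have nt : t != (nx (t, c)).1.
    by rewrite /nx /=; case g: (glue (t, ordS c)) => [t1 j1] /=; exact (glue_tri_neq adm g b1).
  move: tn nt; case: (nx (t, c)) => t' c' /= tn nt.
  have [_ g1] := around_interior tc; have [_ g2] := around_interior tn.
  case: (connect_cases adm (connect_meet g1 g2)) => [/(congr1 fst)/= e|].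
    by rewrite e eqxx in nt.
  move=> /and3P[_ _] /existsP[j /existsP[j' /and5P[/eqP g _ dj dj' _]]].
  have [e1 e2 e3] := pos3P c h3; have [f1 f2 f3] := pos3P c' h3.
  have [jc i1] : j = c /\ i.-1 = 0%N.
    by move: dj; case: (I3P c j); rewrite ?e1 ?e2 ?e3 // => /eqP.
  have jc' : j' = c' by move: dj'; case: (I3P c' j'); rewrite ?f1 ?f2 ?f3.
  subst j j'; split; last exact: g.
  by clear -i0 i1; lia.
have [i1 _] := key _ _ tc0; split; first by rewrite ek i1.
have cl C : C \in val p -> glue C = nx C by case: C => t c /key[].
have [g0 g1 g2] := closed_ring_opposite cl tc0.
apply: (two_triangles_sphere _ g0 g1 g2).
have [b1 _] := puncture_side tc0; exact: (glue_tri_neq adm g1 b1).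
Qed.

End Ring.

(** * The invariant along the good part *)

Section Main.
Variables (k : nat) (M : moduli) (D : triangulation).
Hypotheses (adm : admissible M D) (nsphere : ~ (k = 2 /\ thrice_punctured_sphere D)).
Local Notation ng := (@node_glue k M D).
Local Notation V := (mutable_vertex k M D).
Local Notation S0 := (initial_seed k M D).
Implicit Types (S : P_seed k M D) (p q : puncture D) (t : tri D) (c : 'I_3).

Lemma ring_off p (a b : 'I_k) (v : V) : b = a.+1 :> nat ->
  exists2 e : ring_arrow k M D b, in_p p e & Tv e v <= 0.
Proof.
move=> ab; apply: NNPP => h; apply: nsphere.
have b0 : (0 < b)%N by rewrite ab.
apply: (@around_sphere k M D b p v adm b0 (ltn_ord b)) => e pe.
have zero x : ~ connect ng x (nodev v) -> vind v x = 0 by rewrite /vind; case: connect.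
apply: NNPP => /not_or_and[/zero h1 /zero h2]; apply: h; exists e => //.
exact: Tv_le0 pe h1 h2.
Qed.

(** The initial weights are dominant, so there are no twins and domination is the natural order of
    the indices. Its covers are the pairs of consecutive indices, for which the ring provides the
    potential. *)
Lemma initial_invariant p t c : exact_corner p t c -> invariant S0 p.
Proof.
move=> ex; have [tc _] := ex; split=> [a b y z [h1 h2 _ _]|a b ab dom cov].
  have /orP[h|h] : (a < b)%N || (b < a)%N.
  - by rewrite -neq_ltn; apply/eqP => /val_inj e; move: h1; rewrite e /rt subrr.
  - by have := initial_rt_ge0 adm p z h; rewrite h2.
  - by have := initial_rt_ge0 adm p y h; rewrite rt_opp h1.
have lt : (a < b)%N.
  rewrite ltnNge leq_eqVlt (inj_eq val_inj) eq_sym (negbTE ab) /=; apply/negP => ba.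
  have b0 : (0 < a)%N by apply: leq_ltn_trans ba.
  have [v _] := mutable_vertexP adm (mutable_left adm b0 (ltn_ord a) tc).
  have [w _ /eqP] := initial_spread adm p ab v; apply; apply/eqP; rewrite eq_le.
  have := initial_rt_ge0 adm p w ba; rewrite rt_opp oppr_ge0 => ->.
  by have /forallP/(_ w) := dom.
have e : b = a.+1 :> nat.
  apply/eqP; rewrite eqn_leq lt andbT leqNgt; apply/negP => lt2.
  have dk : (a.+1 < k)%N := ltn_trans lt2 (ltn_ord b).
  have := cov (Ordinal dk); rewrite -!val_eqE /= gtn_eqF // (ltn_eqF lt2) => /(_ isT isT)/negP; apply.
  by apply/andP; split; apply/forallP => v; apply: (initial_rt_ge0 adm p v) => /=.
by apply: (ring_potential adm e ex) => v _; exact: (ring_off p v e).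
Qed.

Lemma good_seed_of_good S : good S -> good_seed S.
Proof. by move=> /forallP. Qed.

Lemma good_part_invariant S p : (exists t c, exact_corner p t c) -> in_good_part S ->
  [/\ skew S, balanced S, seed_spread S, good_seed S &
    invariant S p /\ forall q, p != q -> ~ entangled S p q].
Proof.
move=> [t [c ex]]; elim=> [g|{}S S' _ [sk ba sp gS [iS ne]] [x ->] g'].
  split; [exact: initial_skew|exact: initial_balanced|exact: initial_spread|exact: good_seed_of_good|].
  by split; [exact: initial_invariant ex|exact: initial_not_entangled].
have gS' := good_seed_of_good g'; split=> //.
- exact: mutate_skew.
- exact: mutate_balanced.
- exact: spread_mutate.
split; first exact: invariant_mutate.
by move=> q pq; apply: not_entangled_mutate => //; apply: ne.
Qed.

Lemma in_good_part_good S : in_good_part S -> good_seed S.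
Proof. by case=> [|? ? _ _] /good_seed_of_good. Qed.

End Main.

Local Close Scope ring_scope.

Theorem lemma6p11 (k : nat) (M : moduli) (D : triangulation)
    (S S' : P_seed k M D) :
  2 <= k ->
  admissible M D ->
  ~ (k = 2 /\ thrice_punctured_sphere D) ->
  in_good_part S -> in_good_part S' -> adjacent S S' ->
  forall p q : puncture D,
    dosp_at S p <> dosp_at S' p -> dosp_at S q <> dosp_at S' q -> p = q.
Proof.
move=> _ adm ns gS gS' [x eS'] p q; rewrite eS' => dp dq; apply/eqP/negP => /negP pq.
have g' := in_good_part_good gS'; rewrite eS' in g'.
(* Whichever puncture has an exact corner carries the invariant. *)
have [ep|eq] := exact_corner_exists pq.
  have [sk ba sp g [iS ne]] := good_part_invariant adm ns ep gS.
  exact: (dosp_change_unique sk ba sp g g' iS (ne q pq) pq dp dq).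
have [sk ba sp g [iS ne]] := good_part_invariant adm ns eq gS.
rewrite eq_sym in pq.
exact: (dosp_change_unique sk ba sp g g' iS (ne p pq) pq dq dp).
Qed.
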